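(* For each even integer $n\ge 6$, let $A(P)$ denote the area of a polygon $P$, let $B_n$ denote the small $n$-gon defined in the context, and let $$\overline{A}_n=\frac{n}{2}\sin\left(\frac{\pi}{n}\right)-\frac{n-1}{2}\tan\left(\frac{\pi}{2n-2}\right),$$ which is an upper bound on the area of every small $n$-gon. Then there exist a constant $\delta=0.0733883168\ldots$ (that is, $0.0733883168\le\delta<0.0733883169$) and, for each even integer $n\ge 6$, a small $n$-gon $Q_n$, such that $$\overline{A}_n-A(Q_n)=\frac{\delta\pi^3}{n^3}+O\left(\frac{1}{n^4}\right)<\frac{8\pi^3}{109n^3}+O\left(\frac{1}{n^4}\right),$$ and hence $$A(Q_n)-A(B_n)>\frac{\pi^3}{725n^3}+O\left(\frac{1}{n^4}\right),$$ as $n\to\infty$ through even integers. Moreover, for $n\in\{6,8,10,12\}$ the polygon $Q_n$ is the optimal small $n$-gon, i.e. it has maximal area among all small $n$-gons.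
   Context: A polygon is called small if its diameter (the maximal distance between two of its points) equals $1$. A small $n$-gon is a small polygon with $n$ sides. A small $n$-gon is optimal if its area is maximal among all small $n$-gons. The implied constants in the $O(1/n^4)$ terms are absolute (independent of $n$). An inequality of the form $f(n)<g(n)+O(1/n^4)$ (respectively $f(n)>g(n)+O(1/n^4)$) means that there is a function $h$ with $h(n)=O(1/n^4)$ such that $f(n)<g(n)+h(n)$ (respectively $f(n)>g(n)+h(n)$) for all even $n\ge 6$. Definition of $B_n$ (for even $n\ge 6$). For a real $\alpha\in\left[\frac{\pi}{2n-2},\frac{\pi}{n}\right]$ define $\beta$ and $\gamma$ by $$\alpha+\left(\frac n2-1\right)\beta=\frac{\pi}{2},\qquad \alpha+\beta+\gamma=\arcsin\left(\sin\alpha+\frac{\sin(\alpha+3\beta/2)}{2\cos(\beta/2)}\right),$$ and set $\theta_0=\alpha$, $\theta_1=\beta+\gamma$, $\theta_2=\beta-\gamma$, and $\theta_k=\beta$ for $3\le k\le \frac n2-1$. Let $v_0=(0,0)$, $v_{n-1}=(0,1)$, and for $1\le k\le \frac n2-1$ let $v_k=(x_k,y_k)$ with $$x_k=\sum_{j=0}^{k-1}(-1)^j\sin\Bigl(\sum_{i=0}^{j}\theta_i\Bigr),\qquad y_k=\sum_{j=0}^{k-1}(-1)^j\cos\Bigl(\sum_{i=0}^{j}\theta_i\Bigr),$$ and let $v_{n-1-k}=(-x_k,y_k)$ for $1\le k\le \frac n2-1$. (With these choices $x_{n/2-1}=(-1)^{n/2}/2$, so that $v_{n/2-1}$ and $v_{n/2}$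 are at distance $1$; consecutive points among $v_0,v_1,\ldots,v_{n-2},v_0$ are at distance $1$, as are $v_0$ and $v_{n-1}$.) The polygon is the convex $n$-gon with vertices $v_0,\ldots,v_{n-1}$, symmetric about the line through $v_0$ and $v_{n-1}$. The polygon $B_n$ is the one obtained by choosing $\alpha$ in the stated interval so that the area of this polygon is maximal. *)

(* Defs.v *)
From HB Require Import structures.
From mathcomp Require Import all_boot all_order all_algebra.
From mathcomp Require Import all_classical all_reals all_analysis.

Set Implicit Arguments.
Unset Strict Implicit.
Unset Printing Implicit Defensive.

Import Order.TTheory GRing.Theory Num.Theory.
Import numFieldNormedType.Exports.

Local Open Scope classical_set_scope.
Local Open Scope ring_scope.

Section Polygons.
Variable R : realType.
Implicit Types (a b c x : R * R) (P : set (R * R)) (n k : nat).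

(* The norm that the library puts on [R * R] is the max norm. *)
Definition edist a b : R :=
  Num.sqrt ((a.1 - b.1) ^+ 2 + (a.2 - b.2) ^+ 2).

Definition segment a b : set (R * R) :=
  [set ((1 - t) * a.1 + t * b.1, (1 - t) * a.2 + t * b.2) | t in `[0, 1]].

Definition collinear a b c : Prop :=
  (b.1 - a.1) * (c.2 - a.2) = (b.2 - a.2) * (c.1 - a.1).

(* The closed polygonal line [p_0 p_1 ... p_(n-1) p_0]; [ordS] is the successor
   modulo [n]. *)
Definition polygonal_line n (p : 'I_n -> R * R) : set (R * R) :=
  \bigcup_(i in [set: 'I_n]) segment (p i) (p (ordS i)).

(* Vertices of a simple polygon with exactly [n] sides: two distinct sides meet
   only at a common vertex of consecutive sides, and no angle is flat, so that
   every [p i] is a genuine vertex. *)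
Definition simple_polygon n (p : 'I_n -> R * R) : Prop :=
  [/\ (2 < n)%N,
      injective p,
      forall (i j : 'I_n) x, i != j ->
        segment (p i) (p (ordS i)) x -> segment (p j) (p (ordS j)) x ->
        (j = ordS i /\ x = p j) \/ (i = ordS j /\ x = p i)
    & forall i : 'I_n, ~ collinear (p i) (p (ordS i)) (p (ordS (ordS i)))].

(* The curve [L] together with the bounded connected components of its
   complement (for a point of [L] the condition is vacuous). *)
Definition enclosed (L : set (R * R)) : set (R * R) :=
  [set x | forall C : set (R * R),
     connected C -> C x -> C `&` L = set0 -> bounded_set C].

(* A polygon is identified with the closed plane region that it bounds. *)
Definition ngon n P : Prop :=
  exists p : 'I_n -> R * R,
    simple_polygon p /\ P = enclosed (polygonal_line p).

Definition has_diameter P (d : R) : Prop :=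
  (forall a b, P a -> P b -> edist a b <= d) /\
  (exists a b, [/\ P a, P b & edist a b = d]).

Definition small_ngon n P : Prop := ngon n P /\ has_diameter P 1.

Definition area P : R :=
  fine ((@lebesgue_measure R \x @lebesgue_measure R)%E P).

Definition optimal_small_ngon n P : Prop :=
  small_ngon n P /\ forall P', small_ngon n P' -> area P' <= area P.

Definition convex_hull n (v : 'I_n -> R * R) : set (R * R) :=
  [set x | exists w : 'I_n -> R,
     [/\ forall i, 0 <= w i,
         \sum_(i < n) w i = 1
       & x = (\sum_(i < n) w i * (v i).1, \sum_(i < n) w i * (v i).2)]].

Definition upper_area n : R :=
  n%:R / 2 * sin (pi / n%:R)
  - (n%:R - 1) / 2 * tan (pi / (2 * n%:R - 2)).

Section Bn.
Variable n : nat.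

Definition Bbeta (alpha : R) : R := (pi / 2 - alpha) / (n%:R / 2 - 1).

Definition Bgamma (alpha : R) : R :=
  let beta := Bbeta alpha in
  asin (sin alpha + sin (alpha + 3 * beta / 2) / (2 * cos (beta / 2)))
  - alpha - beta.

Definition Btheta (alpha : R) k : R :=
  match k with
  | 0%N => alpha
  | 1%N => Bbeta alpha + Bgamma alpha
  | 2%N => Bbeta alpha - Bgamma alpha
  | _ => Bbeta alpha
  end.

Definition Bx (alpha : R) k : R :=
  \sum_(j < k) (-1) ^+ j * sin (\sum_(i < j.+1) Btheta alpha i).

Definition By (alpha : R) k : R :=
  \sum_(j < k) (-1) ^+ j * cos (\sum_(i < j.+1) Btheta alpha i).

(* The numbering follows the unit-length path [v_0 v_1 ... v_(n-2)], not the
   boundary of the polygon; for [k = 0] both sums are empty. *)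
Definition Bvertex (alpha : R) (k : 'I_n) : R * R :=
  if k == n.-1 :> nat then (0, 1)
  else if (k < n./2)%N then (Bx alpha k, By alpha k)
  else (- Bx alpha (n.-1 - k)%N, By alpha (n.-1 - k)%N).

Definition Bregion (alpha : R) : set (R * R) := convex_hull (Bvertex alpha).

Definition Binterval : set R := `[pi / (2 * n%:R - 2), pi / n%:R].

Definition Boptimal (alpha : R) : Prop :=
  Binterval alpha /\
  forall alpha', Binterval alpha' ->
    area (Bregion alpha') <= area (Bregion alpha).

(* A maximizing parameter is selected by choice; the area of the resulting
   polygon does not depend on which one. *)
Definition Bpolygon : set (R * R) := Bregion (get [set alpha | Boptimal alpha]).

End Bn.

Definition even_ge6 n : Prop := ~~ odd n /\ (6 <= n)%N.

(* [h n = O(1/n^4)] for [n] ranging over the even integers [>= 6]. *)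
Definition O_inv4 (h : nat -> R) : Prop :=
  exists C : R, forall n, even_ge6 n -> `|h n| <= C / n%:R ^+ 4.

End Polygons.

Arguments upper_area R n : clear implicits.
Arguments Bpolygon R n : clear implicits.

(* Main.v *)
(* By compactness there is a configuration of n points with mutual distances at most 1
   whose hull has maximal area. Such a configuration is in strictly convex position and has
   diameter 1, so its hull is an optimal small n-gon. Compressing it orthogonally to a diametral
   chord keeps the diameter and scales the area; hence, as soon as the optimal area exceeds
   upper_area n - delta pi^3 / n^3, some small n-gon has exactly this area. Q_n is this
   n-gon for large n and an optimal n-gon otherwise.

   For n = 2m, closed paths of 2m unit edges with alternating signs and
   increasing directions phi_0 < ... < phi_(m-1) = pi / 2 (and mirrored), are the vertex sets of
   symmetric star polygons of diameter 1; B_n is of this form. The hull area is a sum over the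
   edges of terms given by the moments of the edges about a point of the axis, and these moments
   satisfy a backward recursion. If the directions after the first K are equally spaced with step b,
   the recursion starts on a circular tail and can be expanded in powers of b: the area deficit is
   D(g) (pi / n)^3 + O(1/n^4), where phi_j = g_j b + O(b^2) and D is a cubic polynomial. A
   choice with K = 11 gives D(g) < delta; for B_n, K = 2 and D >= delta + 1 / 725 + 10^-7 for every
   value of the parameter alpha / b in [0, 1]. *)

Require Import Defs.
From HB Require Import structures.
From mathcomp Require Import all_boot all_order all_algebra.
From mathcomp Require Import all_classical all_reals all_analysis.
From mathcomp Require Import measurable_realfun zify ring lra.

Set Implicit Arguments.
Unset Strict Implicit.
Unset Printing Implicit Defensive.

Import Order.TTheory GRing.Theory Num.Theory.
Import numFieldNormedType.Exports.

Local Open Scope classical_set_scope.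
Local Open Scope ring_scope.

(** * Area and convex hulls *)

(** The equality with [delta] must hold up to O(1/n^4) for one fixed number, so a rational slightly
    above the coefficient of an explicit star polygon is taken, and the compression tunes the area
    to it exactly. The star polygon only serves as a lower bound for the optimum. Competitors need
    not be convex, but the region enclosed by a polygonal line lies in the hull of its vertices, so
    maximising over configurations of points is enough. The moments are taken about the centre of
    the circle that carries the tail. There they are constant, so the tail contributes the number of
    its edges times a single term, and only K + 1 terms depend on the head. One direction of the
    head is determined by the closing of the path. All error bounds are uniform in the parameter of
    a family, so B_n is bounded through all values of alpha at once. The slacks, about 10^-11 for
    the star polygon and 10^-7 for B_n, absorb the O(1/n^4) terms for large n; the finitely many
    other n go into the implied constants. *)

Section PlaneMeasure.
Variable R : realType.
Local Notation leb := (@lebesgue_measure R).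
Local Notation mu2 := (leb \x leb)%E.
Implicit Types A B : set (R * R).

(** An open set is the union of the countably many rational squares that it contains, and a square
    is a measurable rectangle. *)
Lemma open_measurable2 A : open A -> measurable A.
Proof.
move=> oA.
pose F (q : rat * rat * rat) : set (R * R) :=
  ball (ratr q.1.1 : R) (ratr q.2) `*` ball (ratr q.1.2 : R) (ratr q.2).
pose G q : set (R * R) := if `[< F q `<=` A >] then F q else set0.
suff -> : A = \bigcup_q G q.
  apply: countable_bigcupT_measurable; first exact: countableP.
  move=> q; rewrite /G; case: ifPn => // _.
  by apply: measurableX; apply: open_measurable; exact: ball_open.
rewrite eqEsubset; split=> [x Ax|x [q _]]; last first.
  by rewrite /G; case: asboolP => // sub Fq; exact: sub.
have /nbhs_ballP[e /= e0 eA] : nbhs x A by rewrite nbhsE; exists A.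
(* A rational centre within e/4 of [x] in each coordinate and a radius between e/4 and e/2 give a
   square that contains [x] and stays within [e] of it. *)
have e4 : 0 < e / 4 by rewrite divr_gt0.
have er0 : e / 4 < e / 2 by lra.
have [r] := rat_in_itvoo er0.
rewrite in_itv/= => /andP[er re].
have xr1 : x.1 - e / 4 < x.1 + e / 4 by lra.
have [q1] := rat_in_itvoo xr1.
rewrite in_itv/= => /andP[q11 q12].
have xr2 : x.2 - e / 4 < x.2 + e / 4 by lra.
have [q2] := rat_in_itvoo xr2.
rewrite in_itv/= => /andP[q21 q22].
have near (a b : R) : a - e / 4 < b -> b < a + e / 4 -> `|b - a| < ratr r.
  by move=> h1 h2; rewrite ltr_norml; apply/andP; split; lra.
exists (q1, q2, r) => //; rewrite /G asboolT.
  by split; rewrite /ball /=; apply: near.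
move=> y [/= y1 y2]; apply: eA.
have far (a b c : R) : `|b - c| < ratr r -> a - e / 4 < b -> b < a + e / 4 ->
    `|a - c| < e.
  by rewrite !ltr_norml => /andP[h1 h2] h3 h4; apply/andP; split; lra.
split; rewrite /ball /=.
  exact: (far _ (ratr q1)).
exact: (far _ (ratr q2)).
Qed.

Lemma closed_measurable2 A : closed A -> measurable A.
Proof.
move=> cA; have := measurableC (open_measurable2 (closed_openC cA)).
by rewrite setCK.
Qed.

(** Uniqueness of Lebesgue measure: [k] times the pushforward by the affine map has the right value
    on half-open intervals. *)
Lemma lebesgue_affine (k c : R) (A : set R) : 0 < k -> measurable A ->
  leb ((fun x => k * x + c) @^-1` A) = (k^-1%:E * leb A)%E.
Proof.
move=> k0 mA.
have mf : measurable_fun setT (fun x : measurableTypeR R => (k * x + c : measurableTypeR R)).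
  by apply: measurable_funD => //; exact: measurable_funM.
have k1 : (0 <= k)%R := ltW k0.
have -> : leb A = (k%:E * leb ((fun x => (k * x + c)%R) @^-1` A))%E.
  pose m0 : {measure set _ -> \bar R} :=
    pushforward leb (fun x : measurableTypeR R => (k * x + c : measurableTypeR R)).
  pose m1 : {measure set (measurableTypeR R) -> \bar R} := mscale (NngNum k1) (m0 mf).
  apply: (@lebesgue_measure_unique R m1) => //= _ [[a b]] _ <-.
  rewrite /m1 /m0/= /mscale/= /pushforward.
  have -> : (fun x => (k * x + c)%R) @^-1` `]a, b] = `](a - c) / k, (b - c) / k]%classic.
    rewrite eqEsubset; split => x /=; rewrite !in_itv/= ltr_pdivrMr// ler_pdivlMr//.
      by move=> /andP[h1 h2]; apply/andP; split; lra.
    by move=> /andP[h1 h2]; apply/andP; split; lra.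
  rewrite !lebesgue_measure_itv/= !lte_fin ltr_pM2r ?invr_gt0// ltrD2r.
  case: ifPn => _; last by rewrite mule0.
  by rewrite -!EFinB -EFinM; congr (_%:E); field; rewrite gt_eqF.
by rewrite muleA -EFinM mulVf ?gt_eqF// mul1e.
Qed.

(** The product measure is defined by integrating over sections at a fixed first coordinate; this
    gives access to the horizontal sections. *)
Lemma mu2_ysection A : measurable A -> mu2 A = (leb \x^ leb)%E A.
Proof.
move=> mA; apply: product_measure_unique => // *; exact: product_measure2E.
Qed.

Lemma measurable_affine2 (a b c d e f : R) A : measurable A ->
  measurable ((fun p : R * R =>
    (a * p.1 + b * p.2 + e, c * p.1 + d * p.2 + f)) @^-1` A).
Proof.
move=> mA; rewrite -[X in measurable X]setTI.
have mf (u v w : R) : measurable_fun [set: measurableTypeR R * measurableTypeR R]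
    (fun p => (u * p.1 + v * p.2 + w : measurableTypeR R)).
  apply: measurable_funD => //; apply: measurable_funD; apply: measurable_funM => //.
by apply: (measurable_fun_pair (mf a b e) (mf c d f)).
Qed.

Lemma mu2_affine1 (k b e : R) A : 0 < k -> measurable A ->
  mu2 ((fun p => (k * p.1 + b * p.2 + e, p.2)) @^-1` A) = (k^-1%:E * mu2 A)%E.
Proof.
move=> k0 mA.
have mA' := measurable_affine2 k b 0 1 e 0 mA.
have E : (fun p : R * R => (k * p.1 + b * p.2 + e, 0 * p.1 + 1 * p.2 + 0))
     = (fun p => (k * p.1 + b * p.2 + e, p.2)).
  by apply/funext => p; rewrite mul0r add0r mul1r addr0.
rewrite E in mA'.
rewrite !mu2_ysection// /product_measure2 -ge0_integralZl//=; last 2 first.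
- exact: (measurable_fun_ysection leb).
- by rewrite lee_fin invr_ge0 ltW.
apply: eq_integral => y _ /=.
rewrite -(lebesgue_affine (b * y + e) k0) ?addrA; last exact: measurable_ysection.
by congr (leb _); apply/seteqP; split => x; rewrite /ysection/= !inE/= addrA.
Qed.

Lemma mu2_affine2 (k b e : R) A : 0 < k -> measurable A ->
  mu2 ((fun p => (p.1, b * p.1 + k * p.2 + e)) @^-1` A) = (k^-1%:E * mu2 A)%E.
Proof.
move=> k0 mA; rewrite /product_measure1 -ge0_integralZl//=; last 2 first.
- exact: (measurable_fun_xsection leb).
- by rewrite lee_fin invr_ge0 ltW.
apply: eq_integral => x _ /=.
rewrite -(lebesgue_affine (b * x + e) k0); last exact: measurable_xsection.
congr (leb _); apply/seteqP; split => y; rewrite /xsection/= !inE/=.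
  by rewrite addrCA addrA.
by rewrite addrCA addrA.
Qed.

(** Gaussian elimination with pivot [a]: the map is a shear and scaling of the first coordinate
    followed by one of the second, and each rescales all sections by a constant. *)
Lemma mu2_affine (a b c d e f : R) A : 0 < a -> 0 < a * d - b * c -> measurable A ->
  mu2 ((fun p => (a * p.1 + b * p.2 + e, c * p.1 + d * p.2 + f)) @^-1` A)
  = ((a * d - b * c)^-1%:E * mu2 A)%E.
Proof.
move=> a0 D0 mA.
pose k := (a * d - b * c) / a.
have k0 : 0 < k by rewrite divr_gt0.
have mA' := measurable_affine2 1 0 (c / a) k 0 (f - c * e / a) mA.
have E : (fun p : R * R => (1 * p.1 + 0 * p.2 + 0, c / a * p.1 + k * p.2 + (f - c * e / a)))
     = (fun p => (p.1, c / a * p.1 + k * p.2 + (f - c * e / a))).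
  by apply/funext => p; rewrite mul0r mul1r !addr0.
rewrite E in mA'.
transitivity (a^-1%:E * (k^-1%:E * mu2 A))%E; last first.
  rewrite muleA -EFinM; congr (_%:E * _)%E; rewrite /k; field.
  by rewrite !gt_eqF.
rewrite -(mu2_affine2 (c / a) (f - c * e / a) k0 mA) -(mu2_affine1 b e a0 mA').
congr (mu2 _); apply/seteqP; split => p /=.
  suff -> : c / a * (a * p.1 + b * p.2 + e) + k * p.2 + (f - c * e / a)
     = c * p.1 + d * p.2 + f by [].
  by rewrite /k; field; rewrite gt_eqF.
suff -> : c / a * (a * p.1 + b * p.2 + e) + k * p.2 + (f - c * e / a)
   = c * p.1 + d * p.2 + f by [].
by rewrite /k; field; rewrite gt_eqF.
Qed.

End PlaneMeasure.

Section Hulls.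
Variable R : realType.
Local Notation leb := (@lebesgue_measure R).
Local Notation mu2 := (leb \x leb)%E.
Implicit Types (A B : set (R * R)) (p q x : R * R).

Definition in_square (M : R) A := forall p, A p -> `|p.1| <= M /\ `|p.2| <= M.

Lemma in_square_mu2_fin M A : measurable A -> in_square M A -> mu2 A \is a fin_num.
Proof.
move=> mA AM; rewrite ge0_fin_numE ?measure_ge0//.
apply: (@le_lt_trans _ _ (mu2 (`[- M, M] `*` `[- M, M]))).
  apply: le_measure; rewrite ?inE//.
    by apply: measurableX; exact: measurable_itv.
  by move=> p /AM[h1 h2]; split; rewrite /= in_itv/= -ler_norml.
rewrite product_measure1E; [|exact: measurable_itv|exact: measurable_itv].
have [r Er] : exists r, leb `[- M, M]%classic = r%:E.
  rewrite lebesgue_measure_itv/=; case: ifPn => _; last by exists 0.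
  by eexists; rewrite -EFinB.
apply: (@le_lt_trans _ _ (r%:E * r%:E)%E); last by rewrite -EFinM ltry.
by rewrite -Er.
Qed.

Lemma area_le M A B : measurable A -> measurable B -> in_square M B ->
  A `<=` B -> area A <= area B.
Proof.
move=> mA mB BM AB; apply: fine_le.
- by apply: (@in_square_mu2_fin M) => // p /AB/BM.
- exact: (@in_square_mu2_fin M).
- by apply: le_measure; rewrite ?inE.
Qed.

Lemma area_ge0 A : 0 <= area A.
Proof. by apply: fine_ge0; exact: measure_ge0. Qed.

Lemma areaU M A B : measurable A -> measurable B -> in_square M A -> in_square M B ->
  A `&` B = set0 -> area (A `|` B) = area A + area B.
Proof.
move=> mA mB AM BM AB; rewrite /area measureU// fineD//; exact: (@in_square_mu2_fin M).
Qed.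

Lemma area_affine (a b c d e f : R) A : 0 < a -> 0 < a * d - b * c -> measurable A ->
  area ((fun p => (a * p.1 + b * p.2 + e, c * p.1 + d * p.2 + f)) @^-1` A)
  = (a * d - b * c)^-1 * area A.
Proof.
move=> a0 D0 mA; rewrite /area mu2_affine//.
have D1 : 0 < (a * d - b * c)^-1 by rewrite invr_gt0.
have : (0 <= mu2 A)%E by exact: measure_ge0.
case: (mu2 A) => [r||] h.
- by [].
- by rewrite gt0_muley ?lte_fin//= mulr0.
- by rewrite leeNy_eq in h.
Qed.

Definition sqd p q : R := (p.1 - q.1) ^+ 2 + (p.2 - q.2) ^+ 2.

Lemma sqd_ge0 p q : 0 <= sqd p q.
Proof. by rewrite addr_ge0// sqr_ge0. Qed.

Lemma sqdC p q : sqd p q = sqd q p.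
Proof. by rewrite /sqd; ring. Qed.

Lemma edist_le1 p q : (Defs.edist p q <= 1) = (sqd p q <= 1).
Proof. by rewrite -{1}(@sqrtr1 R) ler_sqrt// ler01. Qed.

Lemma edist_eq1 p q : (Defs.edist p q = 1) <-> (sqd p q = 1).
Proof.
split=> [h|h]; last by rewrite /Defs.edist [X in Num.sqrt X]h sqrtr1.
by rewrite -[RHS](expr1n R 2) -h sqr_sqrtr// sqd_ge0.
Qed.

Definition convex A := forall p q (t : R), A p -> A q -> 0 <= t <= 1 ->
  A ((1 - t) * p.1 + t * q.1, (1 - t) * p.2 + t * q.2).

Definition barycenter n (w : 'I_n -> R) (v : 'I_n -> R * R) : R * R :=
  (\sum_(i < n) w i * (v i).1, \sum_(i < n) w i * (v i).2).

Lemma hull_vertex n (v : 'I_n -> R * R) i : convex_hull v (v i).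
Proof.
exists (fun j => (j == i)%:R); split.
- by move=> j; rewrite ler0n.
- by rewrite (bigD1 i)//= eqxx big1 ?addr0// => j /negbTE ->.
- rewrite (bigD1 i)//= [in X in (_, X)](bigD1 i)//= eqxx !mul1r.
  rewrite !big1 ?addr0; first by case: (v i).
    by move=> j /negbTE ->; rewrite mul0r.
  by move=> j /negbTE ->; rewrite mul0r.
Qed.

Lemma hull_convex n (v : 'I_n -> R * R) : convex (convex_hull v).
Proof.
move=> p q t [w [w0 w1 ->]] [u [u0 u1 ->]] /andP[t0 t1] /=.
exists (fun i => (1 - t) * w i + t * u i); split.
- by move=> i; rewrite addr_ge0// mulr_ge0// subr_ge0.
- by rewrite big_split/= -!mulr_sumr w1 u1; ring.
- by congr (_, _); rewrite !mulr_sumr -big_split/=; apply: eq_bigr => i _; ring.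
Qed.

Lemma hull_subP n m (v : 'I_n -> R * R) (u : 'I_m -> R * R) :
  (forall i, convex_hull u (v i)) -> convex_hull v `<=` convex_hull u.
Proof.
move=> /(_ _)/cid-/all_sig[W HW] x [w [w0 w1 ->]].
exists (fun j => \sum_(i < n) w i * W i j); split.
- by move=> j; apply: sumr_ge0 => i _; rewrite mulr_ge0//; case: (HW i).
- rewrite exchange_big/= -[RHS]w1; apply: eq_bigr => i _.
  by rewrite -mulr_sumr; case: (HW i) => _ -> _; rewrite mulr1.
- have E (f : 'I_m -> R) : \sum_(j < m) (\sum_(i < n) w i * W i j) * f j
    = \sum_(i < n) w i * (\sum_(j < m) W i j * f j).
    under eq_bigr do rewrite mulr_suml.
    rewrite exchange_big/=; apply: eq_bigr => i _; rewrite mulr_sumr.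
    by apply: eq_bigr => j _; rewrite mulrA.
  by rewrite !E; congr (_, _); apply: eq_bigr => i _; case: (HW i) => _ _ {1}->.
Qed.

Lemma hull_halfplane n (v : 'I_n -> R * R) (a b c : R) :
  (forall i, c <= a * (v i).1 + b * (v i).2) ->
  forall x, convex_hull v x -> c <= a * x.1 + b * x.2.
Proof.
move=> h x [w [w0 w1 ->]] /=; rewrite -[c]mul1r -w1 mulr_suml !mulr_sumr -big_split/=.
by apply: ler_sum => i _; have := ler_wpM2l (w0 i) (h i); lra.
Qed.

Lemma hull_in_square n (v : 'I_n -> R * R) (M : R) :
  (forall i, `|(v i).1| <= M /\ `|(v i).2| <= M) -> in_square M (convex_hull v).
Proof.
move=> h x hx.
have H a b : (forall i, - M <= a * (v i).1 + b * (v i).2) -> - M <= a * x.1 + b * x.2.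
  by move=> /hull_halfplane; exact.
rewrite !ler_norml; split; apply/andP; split.
- have := H 1 0; rewrite mul0r addr0 mul1r; apply => i.
  by case: (h i); rewrite !ler_norml; lra.
- have := H (-1) 0; rewrite mul0r addr0 mulN1r lerN2; apply => i.
  by case: (h i); rewrite !ler_norml; lra.
- have := H 0 1; rewrite mul0r add0r mul1r; apply => i.
  by case: (h i); rewrite !ler_norml; lra.
- have := H 0 (-1); rewrite mul0r add0r mulN1r lerN2; apply => i.
  by case: (h i); rewrite !ler_norml; lra.
Qed.

(* The last term gives strict bounds off the vertices. *)
Lemma sqd_barycenter n (w : 'I_n -> R) (v : 'I_n -> R * R) x : \sum_(i < n) w i = 1 ->
  \sum_(i < n) w i * sqd (v i) x
  = sqd (barycenter w v) x + \sum_(i < n) w i * sqd (v i) (barycenter w v).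
Proof.
move=> w1; have [y Ey] : exists y, y = barycenter w v by eexists.
rewrite -Ey.
have E : \sum_(i < n) w i * (2 * (((v i).1 - y.1) * (y.1 - x.1) + ((v i).2 - y.2) * (y.2 - x.2))) = 0.
  transitivity (2 * (y.1 - x.1) * (\sum_i w i * (v i).1 - \sum_i w i * y.1)
     + 2 * (y.2 - x.2) * (\sum_i w i * (v i).2 - \sum_i w i * y.2)).
    rewrite -!sumrB !mulr_sumr -big_split/=; apply: eq_bigr => i _; ring.
  by rewrite -!mulr_suml w1 Ey /barycenter/=; ring.
have -> : sqd y x = \sum_(i < n) w i * sqd y x by rewrite -mulr_suml w1 mul1r.
rewrite -[RHS]addr0 -[X in _ = _ + X]E -!big_split/=.
by apply: eq_bigr => i _; rewrite /sqd; ring.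
Qed.

Lemma hull_sqd_le n (v : 'I_n -> R * R) x (d : R) :
  (forall i, sqd (v i) x <= d) -> forall y, convex_hull v y -> sqd y x <= d.
Proof.
move=> h y [w [w0 w1 ->]].
have -> : d = \sum_(i < n) w i * d by rewrite -mulr_suml w1 mul1r.
apply: (@le_trans _ _ (\sum_(i < n) w i * sqd (v i) x)).
  rewrite (sqd_barycenter _ _ w1) lerDl; apply: sumr_ge0 => i _.
  by rewrite mulr_ge0// sqd_ge0.
by apply: ler_sum => i _; rewrite ler_wpM2l.
Qed.

(** The squared distance is convex in each argument, so its bound passes from the vertices to the
    hull one argument at a time. *)
Lemma hull_diam n (v : 'I_n -> R * R) (d : R) : (forall i j, sqd (v i) (v j) <= d) ->
  forall x y, convex_hull v x -> convex_hull v y -> sqd x y <= d.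
Proof.
move=> h x y hx hy; apply: (hull_sqd_le _ hx) => i; rewrite sqdC.
by apply: (hull_sqd_le _ hy) => j.
Qed.

Lemma continuous_sum_ord (T : topologicalType) n (f : 'I_n -> T -> R) :
  (forall i, continuous (f i)) -> continuous (fun z : T => \sum_(i < n) f i z).
Proof.
elim: n f => [|n IH] f cf z.
  by under eq_fun do rewrite big_ord0; exact: cvg_cst.
under eq_fun do rewrite big_ord_recr/=.
apply: cvgD; last exact: cf.
exact: (IH (fun i => f (widen_ord (leqnSn n) i))).
Qed.

(** The hull is the continuous image of the compact simplex of weights. *)
Lemma hull_compact n (v : 'I_n -> R * R) : compact (convex_hull v).
Proof.
pose S := [set w : 'rV[R]_n | forall i, `[0, 1]%classic (w ord0 i)] `&`
  (fun w : 'rV[R]_n => \sum_(i < n) w ord0 i) @^-1` [set 1].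
have cS : compact S.
  apply: compact_closedI.
    by apply: (@rV_compact R n (fun=> `[0, 1]%classic)) => i; exact: segment_compact.
  apply: preimage_closed; last by apply: closed_eq.
  by move=> w _; apply: continuous_sum_ord => i; exact: coord_continuous.
pose f (w : 'rV[R]_n) := barycenter (w ord0) v.
have -> : convex_hull v = f @` S.
  rewrite eqEsubset; split=> [x [w [w0 w1 ->]]|_ [w [w01 w1] <-]]; last first.
    exists (w ord0); split => // i.
    by have := w01 i; rewrite /= in_itv/= => /andP[].
  exists (\row_i w i); last by rewrite /f/barycenter; congr (_, _); apply: eq_bigr => i _; rewrite mxE.
  split=> /= [i|]; last by rewrite -[RHS]w1; apply: eq_bigr => i _; rewrite mxE.
  rewrite mxE in_itv/= w0/= -w1 (bigD1 i)//= lerDl; exact: sumr_ge0.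
apply: continuous_compact => //; apply: continuous_subspaceT => w.
have cg (a : 'I_n -> R) : continuous (fun w : 'rV[R]_n => \sum_(i < n) w ord0 i * a i).
  apply: continuous_sum_ord => i u.
  apply: continuousM; last exact: cst_continuous.
  exact: (@coord_continuous R 1 n ord0 i u).
exact: (cvg_pair (cg (fun i => (v i).1) w) (cg (fun i => (v i).2) w)).
Qed.

Lemma hull_closed n (v : 'I_n -> R * R) : closed (convex_hull v).
Proof.
by apply: compact_closed; [exact: norm_hausdorff|exact: hull_compact].
Qed.

Lemma hull_measurable n (v : 'I_n -> R * R) : measurable (convex_hull v).
Proof. exact: (closed_measurable2 (@hull_closed n v)). Qed.

End Hulls.

(** * Point configurations of maximal hull area *)

Section Maximizer.
Variable R : realType.
Local Notation leb := (@lebesgue_measure R).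
Local Notation mu2 := (leb \x leb)%E.
Implicit Types (A B : set (R * R)) (p q x : R * R).

Definition affmap (a b c d e f : R) (p : R * R) : R * R :=
  (a * p.1 + b * p.2 + e, c * p.1 + d * p.2 + f).

Lemma hull_affmap n (v : 'I_n -> R * R) a b c d e f x : convex_hull v x ->
  convex_hull (affmap a b c d e f \o v) (affmap a b c d e f x).
Proof.
move=> [w [w0 w1 ->]]; exists w; split => //; rewrite /affmap/=.
have E k l m : k * \sum_(i < n) w i * (v i).1 + l * \sum_(i < n) w i * (v i).2 + m
    = \sum_(i < n) w i * (k * (v i).1 + l * (v i).2 + m).
  rewrite -[m in LHS]mul1r -w1 mulr_suml !mulr_sumr -!big_split/=.
  by apply: eq_bigr => i _; ring.
by rewrite !E.
Qed.

Lemma area_hull_affmap n (v : 'I_n -> R * R) a b c d e f :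
  0 < a -> 0 < a * d - b * c ->
  area (convex_hull (affmap a b c d e f \o v))
  = (a * d - b * c) * area (convex_hull v).
Proof.
move=> a0 D0; set D := a * d - b * c in D0 *.
have D0' : D != 0 by rewrite gt_eqF.
pose inv := affmap (d / D) (- b / D) (- c / D) (a / D)
  ((b * f - d * e) / D) ((c * e - a * f) / D).
have invK x : inv (affmap a b c d e f x) = x.
  by case: x => x y; rewrite /inv /affmap/=; congr (_, _); rewrite /D; field.
have -> : convex_hull v = affmap a b c d e f @^-1` convex_hull (affmap a b c d e f \o v).
  rewrite eqEsubset; split=> x; first exact: hull_affmap.
  move=> /= /(hull_affmap (d / D) (- b / D) (- c / D) (a / D)
    ((b * f - d * e) / D) ((c * e - a * f) / D)).
  rewrite -/inv invK; congr (convex_hull _ x).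
  by apply/funext => i /=; rewrite invK.
rewrite area_affine//; last exact: hull_measurable.
by rewrite mulrA divff ?mul1r.
Qed.

Definition small n (c : 'I_n -> R * R) := forall i j, sqd (c i) (c j) <= 1.

Lemma hull_in_square_max n (v : 'I_n -> R * R) : exists M, in_square M (convex_hull v).
Proof.
pose M := \sum_(i < n) (`|(v i).1| + `|(v i).2|).
exists M; apply: hull_in_square => i.
rewrite /M (bigD1 i)//=; set S := \sum_(j < n | _) _.
have S0 : 0 <= S by apply: sumr_ge0 => j _; rewrite addr_ge0.
have := normr_ge0 (v i).1; have := normr_ge0 (v i).2; split; lra.
Qed.

Definition thicken (r : R) A : set (R * R) :=
  \bigcup_(h in A) (ball h.1 r `*` ball h.2 r).

Lemma thicken_open r A : open (thicken r A).
Proof.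
apply: bigcup_open => h _.
have -> : ball h.1 r `*` ball h.2 r = (fst @^-1` ball h.1 r) `&` (snd @^-1` ball h.2 r).
  by [].
apply: openI; apply: open_comp; try exact: ball_open.
  by move=> p _; exact: cvg_fst.
by move=> p _; exact: cvg_snd.
Qed.

Lemma thicken_hull n (v u : 'I_n -> R * R) (r : R) :
  (forall i, `|(v i).1 - (u i).1| < r /\ `|(v i).2 - (u i).2| < r) ->
  convex_hull u `<=` thicken (2 * r) (convex_hull v).
Proof.
case: n v u => [|n] v u vu x [w [w0 w1 ->]].
  by move: w1; rewrite big_ord0 => /esym/eqP; rewrite oner_eq0.
have r0 : 0 < r by apply: le_lt_trans (vu ord0).1.
have close (a b : 'I_n.+1 -> R) : (forall i, `|a i - b i| < r) ->
    `|\sum_(i < n.+1) w i * a i - \sum_(i < n.+1) w i * b i| < 2 * r.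
  move=> ab; rewrite -sumrB; apply: (@le_lt_trans _ _ (\sum_(i < n.+1) w i * r)).
    apply: le_trans (ler_norm_sum _ _ _) _; apply: ler_sum => i _.
    by rewrite -mulrBr normrM (ger0_norm (w0 i)) ler_wpM2l// ltW.
  by rewrite -mulr_suml w1 mul1r; lra.
exists (\sum_(i < n.+1) w i * (v i).1, \sum_(i < n.+1) w i * (v i).2).
  by exists w.
by split; rewrite /ball/=; apply: close => i; case: (vu i).
Qed.

(** Continuity of the measure from above: the shrinking open neighbourhoods of the closed hull
    intersect in the hull itself, and the hull of a nearby configuration lies in one of them. *)
Lemma area_hull_usc n (v : 'I_n -> R * R) (m : R) : area (convex_hull v) < m ->
  exists2 r : R, 0 < r & forall u : 'I_n -> R * R,
    (forall i, `|(v i).1 - (u i).1| < r /\ `|(v i).2 - (u i).2| < r) ->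
    area (convex_hull u) < m.
Proof.
move=> vm; have [M HM] := hull_in_square_max v; set H := convex_hull v in vm HM *.
pose N k := thicken (k.+1%:R^-1) H.
have mN k : measurable (N k) by exact: (open_measurable2 (@thicken_open _ _)).
have NM k : in_square (M + 1) (N k).
  have k1 : k.+1%:R^-1 <= 1 :> R by rewrite invf_le1// ler1n.
  rewrite /N; move: (k.+1%:R^-1) k1 => r k1 p [h /HM[h1 h2]] [/= p1 p2].
  move: h1 h2 p1 p2; rewrite /ball/= !ler_norml !ltr_norml.
  by move=> /andP[? ?] /andP[? ?] /andP[? ?] /andP[? ?]; split; apply/andP; split; lra.
have capN : \bigcap_k N k = H.
  rewrite eqEsubset; split=> [x Nx|x Hx k _]; last first.
    by exists x => //; split; rewrite /=; apply: ballxx; rewrite invr_gt0.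
  have /closure_id clH : closed H by exact: hull_closed.
  rewrite clH => B /nbhs_ballP[e /= e0 eB].
  have [h Hh [x1 x2]] := Nx (Num.bound e^-1) I.
  have ke : ((Num.bound e^-1).+1%:R)^-1 < e :> R.
    rewrite invf_plt ?posrE//; apply: lt_trans (archi_boundP _) _.
      by rewrite invr_ge0 ltW.
    by rewrite ltr_nat.
  exists h; split => //; apply: eB; split; rewrite /= ?/ball/= distrC.
    exact: lt_trans x1 ke.
  exact: lt_trans x2 ke.
have finN k : mu2 (N k) \is a fin_num by exact: in_square_mu2_fin (NM k).
have mH : measurable H by exact: hull_measurable.
have finH : mu2 H \is a fin_num by exact: in_square_mu2_fin HM.
have Ncvg : (mu2 \o N) k @[k --> \oo] --> mu2 H.
  rewrite -capN; apply: nonincreasing_cvg_mu => //.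
  - by rewrite -ge0_fin_numE ?measure_ge0//; exact: finN.
  - by rewrite capN.
  - move=> i j ij; apply/subsetPset => p [h Hh [p1 p2]]; exists h => //.
    have le : j.+1%:R^-1 <= i.+1%:R^-1 :> R by rewrite lef_pV2 ?posrE// ler_nat.
    by split; rewrite /= /ball/=; [exact: lt_le_trans p1 le|exact: lt_le_trans p2 le].
have : (fine \o (mu2 \o N)) k @[k --> \oo] --> area H.
  by apply: fine_cvg; rewrite /area fineK.
move=> /cvgr_lt/(_ m vm)[k _ /(_ k (leqnn k))/= Nkm].
exists (k.+1%:R^-1 / 2); first by rewrite divr_gt0.
move=> u uv; apply: le_lt_trans Nkm; apply: (@area_le _ (M + 1)) => //.
  exact: hull_measurable.
have := thicken_hull uv; rewrite /N; congr (_ `<=` thicken _ _).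
by rewrite mulrC -mulrA mulVf ?mulr1.
Qed.

(* Upper semicontinuity suffices for a maximum on the compact set of configurations. *)
Lemma max_area_hull n : exists2 c : 'I_n -> R * R, small c &
  forall c' : 'I_n -> R * R, small c' -> area (convex_hull c') <= area (convex_hull c).
Proof.
pose pt (z : 'rV[R]_n * 'rV[R]_n) (i : 'I_n) : R * R := (z.1 ord0 i, z.2 ord0 i).
pose box := [set v : 'rV[R]_n | forall i, `[-1, 1]%classic (v ord0 i)].
pose K := (box `*` box) `&` [set z | small (pt z)].
have cbox : compact box.
  by apply: (@rV_compact R n (fun=> `[-1, 1]%classic)) => i; exact: segment_compact.
have cK : compact K.
  apply: compact_closedI; first exact: compact_setX.
  have -> : [set z | small (pt z)] = \bigcap_(i in [set: 'I_n]) \bigcap_(j in [set: 'I_n])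
      ((fun z => sqd (pt z i) (pt z j)) @^-1` [set x | x <= 1]).
    rewrite eqEsubset; split=> z h; last by move=> i j; apply: h.
    by move=> i _ j _; apply: h.
  apply: closed_bigI => i _; apply: closed_bigI => j _.
  apply: (@preimage_closed _ _ (fun z => sqd (pt z i) (pt z j)) [set x | x <= 1]); last first.
    exact: closed_le.
  move=> z _.
  have c1 k : continuous_at z (fun z : 'rV[R]_n * 'rV[R]_n => z.1 ord0 k).
    apply: (@continuous_comp _ _ _ fst (fun u : 'rV[R]_n => u ord0 k)); first exact: cvg_fst.
    exact: (@coord_continuous R 1 n ord0 k z.1).
  have c2 k : continuous_at z (fun z : 'rV[R]_n * 'rV[R]_n => z.2 ord0 k).
    apply: (@continuous_comp _ _ _ snd (fun u : 'rV[R]_n => u ord0 k)); first exact: cvg_snd.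
    exact: (@coord_continuous R 1 n ord0 k z.2).
  have cB (f g : 'rV[R]_n * 'rV[R]_n -> R) : continuous_at z f -> continuous_at z g ->
      continuous_at z (fun z => (f z - g z) ^+ 2).
    move=> cf cg; have cfg : continuous_at z (fun z => f z - g z).
      by apply: (@continuousB _ _ _ f g).
    exact: (continuousM cfg cfg).
  by apply: (continuousD (cB _ _ (c1 i) (c1 j)) (cB _ _ (c2 i) (c2 j))).
have toK (c : 'I_n -> R * R) : small c ->
    exists2 z, K z & area (convex_hull (pt z)) = area (convex_hull c).
  case: (pselect (exists i0 : 'I_n, True)) => [[i0 _]|ni] sc; last first.
    exists (0, 0).
      by split; [split => i|move=> i]; exfalso; apply: ni; exists i.
    by congr (area (convex_hull _)); apply/funext => i; exfalso; apply: ni; exists i.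
  (* Translating one point to the origin brings a small configuration into the box without changing
     the area. *)
  have [T [Tc TA]] : exists T, (forall i, T (c i) = ((c i).1 - (c i0).1, (c i).2 - (c i0).2))
      /\ area (convex_hull (T \o c)) = area (convex_hull c).
    exists (affmap 1 0 0 1 (- (c i0).1) (- (c i0).2)); split=> [i|].
      by rewrite /affmap !mul1r !mul0r addr0 add0r.
    by rewrite area_hull_affmap ?mulr1 ?mul0r ?subr0 ?mul1r.
  exists (\row_i (T (c i)).1, \row_i (T (c i)).2).
    split; first split => i /=; rewrite ?mxE ?Tc/= ?in_itv/= -?ler_norml.
    - rewrite -ler_sqr ?nnegrE// expr1n real_normK ?num_real//.
      by apply: le_trans (sc i i0); rewrite /sqd lerDl sqr_ge0.
    - rewrite -ler_sqr ?nnegrE// expr1n real_normK ?num_real//.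
      by apply: le_trans (sc i i0); rewrite /sqd lerDr sqr_ge0.
    - move=> i j; rewrite /pt/= !mxE !Tc; apply: le_trans (sc i j).
      by rewrite /sqd/= le_eqVlt; apply/orP; left; apply/eqP; ring.
  rewrite -TA; congr (area (convex_hull _)); apply/funext => i.
  by rewrite /pt/= !mxE; case: (T _).
have K0 : exists z, K z.
  have [|z Kz _] := toK (fun=> (0, 0)); last by exists z.
  by move=> i j; rewrite /sqd !subrr expr0n addr0.
pose S := [set area (convex_hull (pt z)) | z in K].
have bS : has_sup S.
  split; first by have [z Kz] := K0; exists (area (convex_hull (pt z))), z.
  pose sq : set (R * R) := `[-1, 1] `*` `[-1, 1].
  exists (area sq) => _ [z [[z1 z2] _] <-].
  have msq : measurable sq by apply: measurableX; exact: measurable_itv.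
  apply: (@area_le _ 1) => //; first exact: hull_measurable.
    by move=> p [/=]; rewrite !in_itv/= -!ler_norml.
  have : in_square 1 (convex_hull (pt z)).
    by apply: hull_in_square => i; have := z1 i; have := z2 i; rewrite /= !in_itv/= -!ler_norml.
  by move=> h p /h[h1 h2]; split; rewrite /= in_itv/= -ler_norml.
suff [z Kz zM] : exists2 z, K z & forall z', K z' ->
    area (convex_hull (pt z')) <= area (convex_hull (pt z)).
  exists (pt z); first by case: Kz.
  by move=> c' /toK[z' Kz' <-]; exact: zM.
apply: contrapT => nmax.
have ltS z : K z -> area (convex_hull (pt z)) < sup S.
  move=> Kz; rewrite lt_neqAle; apply/andP; split; last first.
    by apply: sup_upper_bound => //; exists z.
  apply/negP => /eqP zS; apply: nmax; exists z => // z' Kz'; rewrite zS.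
  by apply: sup_upper_bound => //; exists z'.
(* If the supremum is not attained, every configuration has a neighbourhood on which the area stays
   below some m < sup. The covering form of compactness makes a single m work on all of [K], which
   contradicts the definition of the supremum. *)
have cov := (compact_near_coveringP _).1 cK R (at_left (sup S))
  (fun m z => area (convex_hull (pt z)) < m) (at_left_proper_filter (sup S)).
have : \forall m \near (sup S)^'-, K `<=` (fun z => area (convex_hull (pt z)) < m).
  apply: cov => z Kz.
  have [r r0 Hr] := @area_hull_usc _ _ ((area (convex_hull (pt z)) + sup S) / 2) (midf_lt (ltS z Kz)).1.
  exists (ball z r, [set m | (area (convex_hull (pt z)) + sup S) / 2 < m]).
    split; first exact: nbhsx_ballx.
    by apply: nbhs_left_gt; exact: (midf_lt (ltS z Kz)).2.
  move=> [z' m] [/= [b1 b2] hm]; apply: lt_trans hm; apply: Hr => i.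
  by split; [case: b1 => _; apply|case: b2 => _; apply].
move=> H; have [m [Km mS]] : exists m, (K `<=` fun z => area (convex_hull (pt z)) < m) /\ m < sup S.
  have H2 : \forall m \near (sup S)^'-, m < sup S by exact: nbhs_left_lt.
  have /filter_ex[m [h1 h2]] := @filterI _ (at_left (sup S)) (at_left_proper_filter (sup S)) _ _ H H2.
  by exists m.
suff : sup S <= m by rewrite leNgt mS.
apply: ge_sup; first by case: bS.
by move=> _ [z Kz <-]; exact/ltW/Km.
Qed.

End Maximizer.

Section MaximizerShape.
Variable R : realType.
Local Notation leb := (@lebesgue_measure R).
Local Notation mu2 := (leb \x leb)%E.
Implicit Types (A B : set (R * R)) (p q x : R * R).

Lemma area_vertical_line n (v : 'I_n -> R * R) (x0 : R) : (forall i, (v i).1 = x0) ->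
  area (convex_hull v) = 0.
Proof.
move=> vx; have [M HM] := hull_in_square_max v.
pose B : set (R * R) := `[x0, x0] `*` `[- M, M].
have mB : measurable B by apply: measurableX; exact: measurable_itv.
have B0 : mu2 B = 0%E.
  rewrite /B product_measure1E; [|exact: measurable_itv|exact: measurable_itv].
  have E : leb `[x0, x0]%classic = 0%E by rewrite lebesgue_measure_itv/= ltxx.
  transitivity (0 * leb `[(- M)%R, M]%classic)%E; last by rewrite mul0e.
  by rewrite -E.
apply/eqP; rewrite eq_le area_ge0 andbT.
have -> : 0 = area B by rewrite /area B0.
apply: (@area_le _ (`|x0| + `|M|)) => //; first exact: hull_measurable.
  move=> p [/=]; rewrite !in_itv/= => /andP[h1 h2] /andP[h3 h4].
  have -> : p.1 = x0 by lra.
  split; first by rewrite lerDl.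
  apply: (@le_trans _ _ `|M|); last by rewrite lerDr.
  apply: le_trans (ler_norm M).
  by rewrite ler_norml h3 h4.
move=> p Hp; split; rewrite /= in_itv/=; last first.
  by have [_] := HM _ Hp; rewrite ler_norml.
have := @hull_halfplane R n v 1 0 x0 _ p Hp.
have := @hull_halfplane R n v (-1) 0 (- x0) _ p Hp.
rewrite !mul0r !addr0 mul1r mulN1r lerN2 => h1 h2; apply/andP; split.
  by apply: h2 => i; rewrite vx; lra.
by apply: h1 => i; rewrite vx; lra.
Qed.

(** Shrinking the smaller hull towards [q] by a small ratio [s] gives a copy inside the larger hull.
    It is disjoint from the smaller hull, which is closed and misses [q], and it has positive
    area. *)
Lemma area_hull_lt n m (v : 'I_n -> R * R) (u : 'I_m -> R * R) q :
  0 < area (convex_hull v) -> convex_hull v `<=` convex_hull u ->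
  ~ convex_hull v q -> convex_hull u q ->
  area (convex_hull v) < area (convex_hull u).
Proof.
move=> v0 vu nq uq; set H := convex_hull v in v0 vu nq *.
have [M HM] := hull_in_square_max v.
have [M' HM'] := hull_in_square_max u.
have : nbhs q (~` H) by apply: open_nbhs_nbhs; split => //; apply: closed_openC; exact: hull_closed.
move=> /nbhs_ballP[r /= r0 qr].
(* Points of the hull differ from [q] by less than 2 D in each coordinate, so ratio [s] with s * 2 D
   <= r keeps the copy in the ball around [q]. *)
pose D := `|q.1| + `|q.2| + `|M| + 1.
have D0 : 1 <= D by rewrite lerDr !addr_ge0.
have q1D : `|q.1| + `|M| + 1 <= D by rewrite /D lerD2r lerD2r lerDl.
have q2D : `|q.2| + `|M| + 1 <= D by rewrite /D lerD2r lerD2r lerDr.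
clearbody D.
pose s := Num.min (1 / 2) (r / (2 * D)).
have s0 : 0 < s by rewrite lt_min !divr_gt0//; lra.
have s1 : s <= 1 / 2 by rewrite ge_min lexx.
have sr : s * (2 * D) <= r by rewrite -ler_pdivlMr ?ge_min ?lexx ?orbT//; lra.
clearbody s.
pose T := affmap s 0 0 s ((1 - s) * q.1) ((1 - s) * q.2).
have AT : area (convex_hull (T \o v)) = s ^+ 2 * area H.
  by rewrite area_hull_affmap ?mul0r ?subr0 ?expr2// mulr_gt0.
have TH p : H p -> T p = ((1 - s) * q.1 + s * p.1, (1 - s) * q.2 + s * p.2).
  by move=> _; rewrite /T/affmap; congr (_, _); ring.
have sub_copy : convex_hull (T \o v) `<=` convex_hull u.
  apply: hull_subP => i; rewrite /= TH; last exact: hull_vertex.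
  apply: hull_convex => //; last by rewrite ltW//= (le_trans s1)// ler_pdivrMr// mul1r ler1n.
  exact/vu/hull_vertex.
have copyq p : convex_hull (T \o v) p -> `|q.1 - p.1| < r /\ `|q.2 - p.2| < r.
  move=> hp.
  have bd (a b k : R) : `|a| + `|M| + 1 <= D -> `|b| <= M -> k = (1 - s) * a + s * b ->
      (a - r < k) /\ (k < a + r).
    move=> aD bM ->.
    have : `|b - a| < 2 * D.
      clear - aD bM D0; apply: le_lt_trans (ler_normB _ _) _.
      have := ler_norm M; have := normr_ge0 a; have := normr_ge0 M; lra.
    rewrite ltr_norml => /andP[h1 h2].
    clear - h1 h2 s0 sr r0.
    have sb1 : s * (b - a) < r by apply: lt_le_trans sr; rewrite ltr_pM2l.
    have sb2 : s * (a - b) < r by apply: lt_le_trans sr; rewrite ltr_pM2l//; lra.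
    by split; lra.
  have [h Hh ph] : exists2 h, H h & p = T h.
    case: hp => [w [w0 w1 ->]]; exists (barycenter w v); first by exists w.
    rewrite /T /affmap/barycenter/=.
    have E (f : 'I_n -> R) (a : R) : \sum_(i < n) w i * (s * f i + (1 - s) * a)
        = s * \sum_(i < n) w i * f i + (1 - s) * a.
      rewrite -[X in _ = _ + X]mul1r -w1 mulr_suml mulr_sumr -big_split/=.
      by apply: eq_bigr => i _; ring.
    by congr (_, _); rewrite !mul0r ?addr0 ?add0r -E; apply: eq_bigr => i _; ring.
  have [h1 h2] := HM _ Hh; rewrite ph TH//=.
  have [e1 e2] := bd _ _ _ q1D h1 erefl; have [e3 e4] := bd _ _ _ q2D h2 erefl.
  by clear - e1 e2 e3 e4; rewrite !ltr_norml; split; apply/andP; split; lra.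
have disj : H `&` convex_hull (T \o v) = set0.
  rewrite -subset0 => p [Hp /copyq[h1 h2]].
  by apply: (qr p _ Hp); split.
have mT : in_square M' (convex_hull (T \o v)) by move=> p /sub_copy/HM'.
have mH : in_square M' H by move=> p /vu/HM'.
have mm1 : measurable H by exact: hull_measurable.
have mm2 : measurable (convex_hull (T \o v)) by exact: hull_measurable.
apply: (@lt_le_trans _ _ (area (H `|` convex_hull (T \o v)))).
  by rewrite (areaU mm1 mm2 mH mT disj) AT ltrDl mulr_gt0// exprn_gt0.
apply: (@area_le _ M') => //; first exact: measurableU.
  exact: hull_measurable.
by move=> p [/vu|/sub_copy].
Qed.

Section Max.
Variables (n : nat) (c : 'I_n -> R * R).
Hypotheses (n2 : (2 < n)%N) (sc : small c).
Hypothesis cmax : forall c' : 'I_n -> R * R, small c' ->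
  area (convex_hull c') <= area (convex_hull c).

(** Comparison with the right triangle with legs 1/2, all further points placed at the origin; it
    contains a square of side 1/4. *)
Lemma max_area_gt0 : 0 < area (convex_hull c).
Proof.
pose i0 : 'I_n := Ordinal (ltn_trans (isT : 0 < 2)%N n2).
pose i1 : 'I_n := Ordinal (ltn_trans (isT : 1 < 2)%N n2).
pose i2 : 'I_n := Ordinal n2.
pose d (i : 'I_n) : R * R :=
  if i == i1 then (1 / 2, 0) else if i == i2 then (0, 1 / 2) else (0, 0).
have d0 : convex_hull d (0, 0).
  by have := hull_vertex d i0; rewrite /d.
have d1 : convex_hull d (1 / 2, 0) by have := hull_vertex d i1; rewrite /d eqxx.
have d2 : convex_hull d (0, 1 / 2) by have := hull_vertex d i2; rewrite /d eqxx.
have sd : small d.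
  by move=> i j; rewrite /sqd /d; case: (i == i1); case: (i == i2);
    case: (j == i1); case: (j == i2) => /=; lra.
apply: lt_le_trans (cmax sd).
pose B : set (R * R) := `[0, 1 / 4] `*` `[0, 1 / 4].
have mB : measurable B by apply: measurableX; exact: measurable_itv.
have B0 : mu2 B = (1 / 16)%:E.
  rewrite /B product_measure1E; [|exact: measurable_itv|exact: measurable_itv].
  have E : leb `[0, 1 / 4]%classic = (1 / 4)%:E.
    by rewrite lebesgue_measure_itv/= lte_fin divr_gt0// -EFinB subr0.
  transitivity ((1 / 4 : R)%R%:E * (1 / 4 : R)%R%:E)%E; first by rewrite -E.
  by rewrite -EFinM; congr (_%:E); lra.
apply: (@lt_le_trans _ _ (area B)); first by rewrite /area B0/=; lra.
have [M HM] := hull_in_square_max d.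
apply: (area_le _ _ HM) => //; first exact: hull_measurable.
move=> p [/=]; rewrite !in_itv/= => /andP[h1 h2] /andP[h3 h4].
have A1 : convex_hull d (2 * p.1, 0).
  have := hull_convex d0 d1 (_ : 0 <= 4 * p.1 <= 1); rewrite /= !mulr0 !addr0 add0r.
  have -> : 4 * p.1 * (1 / 2) = 2 * p.1 by lra.
  by apply; apply/andP; split; lra.
have A2 : convex_hull d (0, 2 * p.2).
  have := hull_convex d0 d2 (_ : 0 <= 4 * p.2 <= 1); rewrite /= !mulr0 !addr0 add0r.
  have -> : 4 * p.2 * (1 / 2) = 2 * p.2 by lra.
  by apply; apply/andP; split; lra.
have := hull_convex A1 A2 (_ : 0 <= 1 / 2 <= 1); rewrite /= !mulr0 addr0 add0r.
have -> : (1 - 1 / 2) * (2 * p.1) = p.1 by lra.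
have -> : 1 / 2 * (2 * p.2) = p.2 by lra.
by rewrite -surjective_pairing; apply; apply/andP; split; lra.
Qed.

Lemma max_diam : exists i j, sqd (c i) (c j) = 1.
Proof.
apply: contrapT => nd.
pose i0 : 'I_n := Ordinal (ltn_trans (isT : 0 < 2)%N n2).
have lt1 i j : sqd (c i) (c j) < 1.
  rewrite lt_neqAle sc andbT; apply/negP => /eqP h; apply: nd; by exists i, j.
have [[a b] _ Hd] := @arg_maxP _ _ _ (i0, i0) xpredT
  (fun ij : 'I_n * 'I_n => sqd (c ij.1) (c ij.2)) isT.
set d := sqd _ _ in Hd; have d1 : d < 1 by exact: lt1.
have d0 : 0 <= d by exact: sqd_ge0.
(* If the largest squared distance [d] is below 1, magnifying by this factor keeps the configuration
   small, because 4 d <= (1 + d)^2, and increases the area. *)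
pose k := 2 / (1 + d).
have k1 : 1 < k by rewrite ltr_pdivlMr; lra.
have kd : k ^+ 2 * d <= 1.
  rewrite /k expr_div_n mulrAC ler_pdivrMr ?mul1r; last by rewrite exprn_gt0//; lra.
  have := sqr_ge0 (1 - d); rewrite !expr2; lra.
have sk : small (affmap k 0 0 k 0 0 \o c).
  move=> i j; apply: le_trans kd; have /= := Hd (i, j) isT.
  have -> : sqd (affmap k 0 0 k 0 0 (c i)) (affmap k 0 0 k 0 0 (c j))
      = k ^+ 2 * sqd (c i) (c j) by rewrite /sqd/affmap/=; ring.
  by apply: ler_wpM2l; exact: sqr_ge0.
have k0 : 0 < k by apply: lt_trans k1.
have kk0 : 0 < k * k - 0 * 0 by rewrite mul0r subr0 mulr_gt0.
have := cmax sk; rewrite area_hull_affmap// mul0r subr0.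
rewrite leNgt -[X in X < _]mul1r ltr_pM2r ?max_area_gt0//.
have k2 : 1 < k * k by apply: (lt_trans k1); rewrite -[X in X < _]mulr1 ltr_pM2l.
by rewrite k2.
Qed.

(* On a vertical line missing all the vertices, the topmost point of the hull is at
   distance less than 1 from every vertex, so it can be pushed out of the hull. *)
Lemma max_can_extend : exists2 q, ~ convex_hull c q & forall i, sqd (c i) q <= 1.
Proof.
have c0 := max_area_gt0.
pose i0 : 'I_n := Ordinal (ltn_trans (isT : 0 < 2)%N n2).
have [a [b ab]] : exists a b, (c a).1 < (c b).1.
  apply: contrapT => nab; move: c0; rewrite (@area_vertical_line _ _ (c i0).1) ?ltxx//.
  move=> i; apply/eqP; rewrite eq_le !leNgt; apply/andP; split; apply/negP => h.
    by apply: nab; exists i0, i.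
  by apply: nab; exists i, i0.
(* [b'] has the next abscissa to the right of that of [a], so no vertex lies on the vertical line
   halfway between them. *)
have [b' ab' bmin] := @arg_minP _ _ _ b (fun k => (c a).1 < (c k).1) (fun k => (c k).1) ab.
set x0 := ((c a).1 + (c b').1) / 2.
have x0v k : (c k).1 != x0.
  apply/eqP => kx0; have : (c a).1 < (c k).1 by rewrite kx0 /x0; lra.
  by move=> /bmin /=; rewrite kx0 /x0; lra.
pose Y := [set y | convex_hull c (x0, y)].
have Y0 : Y !=set0.
  exists (((c a).2 + (c b').2) / 2).
  have := hull_convex (hull_vertex c a) (hull_vertex c b') (_ : 0 <= 1 / 2 <= 1).
  have -> : (1 - 1 / 2) * (c a).1 + 1 / 2 * (c b').1 = x0 by rewrite /x0; lra.
  have -> : (1 - 1 / 2) * (c a).2 + 1 / 2 * (c b').2 = ((c a).2 + (c b').2) / 2 by lra.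
  by apply; apply/andP; split; lra.
have [M HM] := hull_in_square_max c.
have bY : has_ubound Y by exists M => y /HM[_ /=]; rewrite ler_norml => /andP[].
have cY : closed Y.
  apply: (@preimage_closed _ _ (fun y : R => (x0, y)) (convex_hull c)); last exact: hull_closed.
  by move=> y _; apply: (@cvg_pair _ _ _ _ (nbhs x0) (nbhs y)); [exact: cvg_cst|exact: cvg_id].
have Ysup : Y (sup Y) by have := closure_sup Y0 bY; rewrite -((closure_id Y).1 cY).
set y1 := sup Y in Ysup.
have slt j : sqd (c j) (x0, y1) < 1.
  have [u [u0 u1 mE]] := Ysup.
  have := sqd_barycenter c (c j) u1; rewrite /barycenter -mE => E.
  rewrite sqdC; apply: (@lt_le_trans _ _ (\sum_(i < n) u i * sqd (c i) (c j))); last first.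
    rewrite -[leRHS]u1; apply: ler_sum => i _; rewrite -[leRHS]mulr1.
    by rewrite ler_wpM2l.
  rewrite E ltrDl lt_neqAle eq_sym sumr_ge0 ?andbT; last first.
    by move=> i _; rewrite mulr_ge0// sqd_ge0.
  apply/eqP => S0; have := u1; rewrite big1 => [/esym/eqP|k _]; first by rewrite oner_eq0.
  have := psumr_eq0P (fun k _ => mulr_ge0 (u0 k) (sqd_ge0 (c k) (x0, y1))) S0 (i := k) isT.
  move=> /eqP; rewrite mulf_eq0 => /orP[/eqP //|]; rewrite /sqd/= gt_eqF//.
  by rewrite ltr_wpDr ?sqr_ge0// lt_neqAle sqr_ge0 andbT eq_sym sqrf_eq0 subr_eq0.
have [j0 _ jmax] := @arg_maxP _ _ _ i0 xpredT (fun j => sqd (c j) (x0, y1)) isT.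
set s := sqd _ _ in jmax; have s1 : s < 1 by exact: slt.
have s0 : 0 <= s by exact: sqd_ge0.
(* Moving up by [e] changes a squared distance by at most 2 e + e^2 <= 3 e, since vertical
   differences are at most 1. *)
pose e := (1 - s) / 3.
have e0 : 0 < e by rewrite divr_gt0// subr_gt0.
exists (x0, y1 + e).
  move=> h; have : y1 + e <= y1 by apply: sup_upper_bound.
  by rewrite leNgt ltrDl e0.
move=> j; have := jmax j isT => /= js.
have d1 : `|(c j).2 - y1| <= 1.
  rewrite -ler_sqr ?nnegrE// expr1n real_normK ?num_real//.
  by apply: le_trans (ltW (slt j)); rewrite /sqd/= lerDr sqr_ge0.
move: d1 js; rewrite ler_norml /sqd/= => /andP[d1 d2] js.
have ee : e * ((c j).2 - y1) >= - e by rewrite -(mulrN1 e) ler_pM2l.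
have e2 : e ^+ 2 <= e by rewrite expr2 -[leRHS]mulr1 ler_pM2l// /e ler_pdivrMr//; lra.
have -> : ((c j).2 - (y1 + e)) ^+ 2 = ((c j).2 - y1) ^+ 2 - 2 * (e * ((c j).2 - y1)) + e ^+ 2 by ring.
have es : 3 * e = 1 - s by rewrite /e; lra.
by lra.
Qed.

(** A redundant point could be moved to the point [q] outside the hull: the old hull would be kept
    and the area strictly increased. *)
Lemma max_irredundant i (w : 'I_n -> R) : (forall j, 0 <= w j) -> w i = 0 ->
  \sum_(j < n) w j = 1 -> barycenter w c <> c i.
Proof.
move=> w0 wi w1 wc; have [q nq qc] := max_can_extend.
pose c' j := if j == i then q else c j.
have sc' : small c'.
  move=> j k; rewrite /c'; case: ifPn => _; case: ifPn => _ //.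
  - by rewrite /sqd !subrr expr0n addr0.
  - by rewrite sqdC.
have q' : convex_hull c' q by have := hull_vertex c' i; rewrite /c' eqxx.
have wc' : barycenter w c' = c i.
  rewrite -wc; congr (_, _); apply: eq_bigr => j _; rewrite /c'; case: eqP => // ->;
  by rewrite wi !mul0r.
have sub : convex_hull c `<=` convex_hull c'.
  apply: hull_subP => j; case: (eqVneq j i) => [->|ji]; first by exists w.
  by have := hull_vertex c' j; rewrite /c' (negbTE ji).
have := area_hull_lt max_area_gt0 sub nq q'.
by rewrite ltNge cmax.
Qed.

End Max.
End MaximizerShape.

(** * Strictly convex polygons *)

Section ConvexPosition.
Variable R : realType.
Implicit Types (p q x : R * R).

Definition orient p q x : R :=
  (q.1 - p.1) * (x.2 - p.2) - (q.2 - p.2) * (x.1 - p.1).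

(** Counterclockwise order. All increasing triples are required, since consecutive triples alone
    would allow the line to wind several times. *)
Definition strictly_convex n (p : 'I_n -> R * R) :=
  forall i j k : 'I_n, (i < j < k)%N -> 0 < orient (p i) (p j) (p k).

Definition irredundant n (c : 'I_n -> R * R) := forall i (w : 'I_n -> R),
  (forall j, 0 <= w j) -> w i = 0 -> \sum_(j < n) w j = 1 -> barycenter w c <> c i.

Section Sorting.
Variables (n : nat) (c : 'I_n -> R * R).
Hypothesis irr : irredundant c.

Lemma irredundant_triangle i a b d (s t u : R) : a != i -> b != i -> d != i ->
  0 <= s -> 0 <= t -> 0 <= u -> s + t + u = 1 ->
  c i <> (s * (c a).1 + t * (c b).1 + u * (c d).1,
          s * (c a).2 + t * (c b).2 + u * (c d).2).
Proof.
move=> ai bi di s0 t0 u0 stu E.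
pose w j := s * (j == a)%:R + t * (j == b)%:R + u * (j == d)%:R.
have sumw (f : 'I_n -> R) : \sum_(j < n) w j * f j = s * f a + t * f b + u * f d.
  have one k : \sum_(j < n) (j == k)%:R * f j = f k.
    by rewrite (bigD1 k)//= eqxx mul1r big1 ?addr0// => j /negbTE ->; rewrite mul0r.
  rewrite -(one a) -(one b) -(one d) !mulr_sumr -!big_split/=.
  by apply: eq_bigr => j _; rewrite /w; ring.
apply: (irr (i := i) (w := w)).
- by move=> j; rewrite !addr_ge0// mulr_ge0// ler0n.
- by rewrite /w !(eq_sym i) (negbTE ai) (negbTE bi) (negbTE di) !mulr0 !addr0.
- by rewrite -stu -[s]mulr1 -[t]mulr1 -[u]mulr1 -(sumw (fun=> 1)); apply: eq_bigr => j _; rewrite mulr1.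
- by rewrite E /barycenter !sumw.
Qed.

Lemma irredundant_inj : injective c.
Proof.
move=> i j cij; apply/eqP/negP => /negP ij.
have ji : j != i by rewrite eq_sym.
apply: (irredundant_triangle ji ji ji (s := 1) (t := 0) (u := 0)) => //.
  by rewrite !addr0.
by rewrite cij !mul1r !mul0r !addr0; case: (c j).
Qed.

Lemma lowest_point : (0 < n)%N -> exists i0, forall j, j != i0 ->
  (c i0).2 < (c j).2 \/ ((c j).2 = (c i0).2 /\ (c i0).1 < (c j).1).
Proof.
move=> n0.
have [i1 _ min1] := @arg_minP _ _ _ (Ordinal n0) xpredT (fun j => (c j).2) isT.
have [i0 /eqP e0 min0] := @arg_minP _ _ _ i1 (fun j => (c j).2 == (c i1).2) (fun j => (c j).1) (eqxx _).
exists i0 => j ji; have := min1 j isT; rewrite le_eqVlt => /orP[/eqP h|h]; last first.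
  by left; rewrite e0.
right; split; first by rewrite e0.
have := min0 j; rewrite -h eqxx => /(_ isT); rewrite le_eqVlt => /orP[/eqP h1|//].
exfalso; move/eqP: ji; apply; apply: irredundant_inj.
by rewrite (surjective_pairing (c j)) (surjective_pairing (c i0)) h1 e0 h.
Qed.

(** Sorting by angle around the lowest, then leftmost, point. The other points lie in a half-plane
    seen from there, so the sign of the cross product is a transitive relation; irredundancy
    excludes equal angles and non-convex triples. *)
Lemma convex_position_sort : (0 < n)%N ->
  exists2 sg : 'I_n -> 'I_n, injective sg & strictly_convex (c \o sg).
Proof.
move=> n0; have [i0 low] := lowest_point n0.
pose v j : R * R := ((c j).1 - (c i0).1, (c j).2 - (c i0).2).
pose cr j k := (v j).1 * (v k).2 - (v j).2 * (v k).1.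
have vpos j : j != i0 -> 0 < (v j).2 \/ ((v j).2 = 0 /\ 0 < (v j).1).
  by move=> /low [h|[h1 h2]]; [left|right]; rewrite /v/= ?h1 ?subrr ?subr_gt0.
have v2ge0 j : j != i0 -> 0 <= (v j).2.
  by move=> /vpos[/ltW|[-> _]].
have crA j k : cr k j = - cr j k by rewrite /cr; ring.
have cr_neq0 j k : j != i0 -> k != i0 -> j != k -> cr j k != 0.
  move=> ji ki jk; apply/eqP => crjk.
  (* Two points on the same ray from [c i0]: by symmetry [c k] may be taken as the nearer one, so
     that it lies on the segment from [c i0] to [c j]. *)
  wlog [t [/andP[t0 t1] t2]] : j k ji ki jk crjk / exists t : R, 0 <= t <= 1 /\
      v k = (t * (v j).1, t * (v j).2).
    move=> wl.
    have [t [t0 vk]] : exists t : R, 0 < t /\ v k = (t * (v j).1, t * (v j).2).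
      move: crjk; rewrite /cr => /subr0_eq E.
      have [vj|[vj1 vj2]] := vpos _ ji.
        exists ((v k).2 / (v j).2); split.
          rewrite divr_gt0//; have [//|[k1 k2]] := vpos _ ki.
          by move: E; rewrite k1 mulr0 => /esym/eqP; rewrite mulf_eq0 !gt_eqF.
        rewrite [LHS]surjective_pairing; congr (_, _).
          by rewrite mulrAC -[X in _ = X / _]mulrC E mulrAC divff ?gt_eqF// mul1r.
        by rewrite divfK// gt_eqF.
      exists ((v k).1 / (v j).1); split.
        rewrite divr_gt0//; have [k1|[//]] := vpos _ ki.
        by move: E; rewrite vj1 mul0r => /eqP; rewrite mulf_eq0 !gt_eqF.
      rewrite [LHS]surjective_pairing; congr (_, _); first by rewrite divfK// gt_eqF.
      move: E; rewrite vj1 mul0r mulr0 => /eqP; rewrite mulf_eq0 gt_eqF//= => /eqP.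
      by [].
    have [t1|t1] := leP t 1.
      by apply: (wl j k) => //; exists t; rewrite ltW.
    apply: (wl k j) => //; first by rewrite eq_sym.
      by rewrite crA crjk oppr0.
    exists t^-1; split; first by rewrite invr_ge0 ltW//= invf_le1// ltW.
    by rewrite vk [LHS]surjective_pairing; congr (_, _); rewrite /= mulKf// gt_eqF.
  apply: (@irredundant_triangle k j i0 i0 t (1 - t) 0) => //; try by rewrite eq_sym.
  - by rewrite subr_ge0.
  - by rewrite addr0; ring.
  move: t2; rewrite /v => -[h1 h2].
  by rewrite (surjective_pairing (c k)); congr (_, _); [move: h1|move: h2]; lra.
pose r j k := (j == i0) || ((k != i0) && ((j == k) || (0 < cr j k))).
have rtot : total r.
  move=> j k; rewrite /r; case: (eqVneq j i0) => //= ji; case: (eqVneq k i0) => //= ki.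
  case: (eqVneq j k) => //= jk; rewrite (crA j k) oppr_gt0.
  by have := cr_neq0 _ _ ji ki jk; case: (ltgtP 0 (cr j k)).
have rtr : transitive r.
  move=> k j l; rewrite /r; case: (eqVneq j i0) => //= ji.
  move=> /andP[ki]; rewrite (negbTE ki)/=.
  case: (eqVneq j k) => [-> _ //|jk /= jk0].
  move=> /andP[li]; rewrite li/=; case: (eqVneq k l) => [<- _|kl /= kl0].
    by rewrite jk0 orbT.
  apply/orP; right.
  have E1 : cr j l * (v k).2 = cr j k * (v l).2 + cr k l * (v j).2 by rewrite /cr; ring.
  move: jk0 kl0; have [vk|[vk1 vk2]] := vpos _ ki => jk0 kl0.
    rewrite -(pmulr_lgt0 _ vk) E1.
    have [vl|[vl1 vl2]] := vpos _ li.
      by rewrite ltr_wpDr ?mulr_gt0// mulr_ge0 ?v2ge0// ltW.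
    rewrite vl1 mulr0 add0r mulr_gt0//; have [//|[vj1 vj2]] := vpos _ ji.
    by move: kl0; rewrite /cr vl1 mulr0 sub0r oppr_gt0 ltNge mulr_ge0 ?v2ge0// ltW.
  move: jk0; rewrite /cr vk1 mulr0 sub0r oppr_gt0 ltNge mulr_ge0 ?v2ge0//; exact: ltW.
pose s := sort r (enum 'I_n).
have ss : size s = n by rewrite size_sort -cardE card_ord.
have us : uniq s by rewrite sort_uniq enum_uniq.
have sorts : sorted r s by exact: sort_sorted.
have nthr j k : (j < k < n)%N -> r (nth i0 s j) (nth i0 s k).
  move=> /andP[jk kn]; apply: (sorted_ltn_nth rtr) => //; rewrite inE ss //.
  exact: ltn_trans jk kn.
have s0 : nth i0 s 0 = i0.
  have i0s : i0 \in s by rewrite mem_sort mem_enum.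
  case E : (index i0 s) => [|k]; first by rewrite -E nth_index.
  have kn : (k.+1 < n)%N by rewrite -E -[X in (_ < X)%N]ss index_mem.
  have := nthr 0%N k.+1 kn; rewrite -E.
  by rewrite nth_index// /r eqxx/= orbF => /eqP.
pose sg (k : 'I_n) := nth i0 s k.
have sgI : injective sg.
  move=> j k /eqP; rewrite nth_uniq ?ss ?ltn_ord// => /eqP; exact: val_inj.
have sgi0 (k : 'I_n) : (0 < k)%N -> sg k != i0.
  by move=> k0; rewrite /sg -[X in _ != X]s0 nth_uniq ?ss ?ltn_ord// -lt0n.
have crs (j k : 'I_n) : (0 < j < k)%N -> 0 < cr (sg j) (sg k).
  move=> /andP[j0 jk]; have := nthr j k; rewrite jk ltn_ord => /(_ isT).
  rewrite /r -!/(sg _) (negbTE (sgi0 _ j0))/= (inj_eq sgI) => /andP[_].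
  by case: eqVneq => [jk'|_ //]; rewrite jk' ltnn in jk.
exists sg => // i j k /andP[ij jk] /=.
have j0 : (0 < j)%N by apply: leq_ltn_trans ij.
have k0 : (0 < k)%N by apply: ltn_trans jk.
have cjk : 0 < cr (sg j) (sg k) by apply: crs; rewrite j0.
case: (posnP i) => i_0.
  have -> : sg i = i0 by rewrite /sg i_0.
  by move: cjk; rewrite /cr /v/orient/=.
have cij : 0 < cr (sg i) (sg j) by apply: crs; rewrite i_0.
have cik : 0 < cr (sg i) (sg k) by apply: crs; rewrite i_0 (ltn_trans ij).
rewrite ltNge; apply/negP => ol.
have oE : orient (c (sg i)) (c (sg j)) (c (sg k))
    = cr (sg i) (sg j) + cr (sg j) (sg k) - cr (sg i) (sg k).
  by rewrite /orient/cr/v/=; ring.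
rewrite oE subr_le0 in ol.
pose D := cr (sg i) (sg k); have D0 : D != 0 by rewrite gt_eqF.
(* If the triple is not a left turn, the middle point lies in the triangle formed by [c i0] and the
   outer two; the weights are its barycentric coordinates by Cramer's rule. *)
apply: (@irredundant_triangle (sg j) i0 (sg i) (sg k)
  (1 - (cr (sg i) (sg j) + cr (sg j) (sg k)) / D) (cr (sg j) (sg k) / D) (cr (sg i) (sg j) / D)).
- by rewrite eq_sym sgi0.
- by rewrite (inj_eq sgI) neq_ltn ij.
- by rewrite (inj_eq sgI) neq_ltn jk orbT.
- by rewrite subr_ge0 ler_pdivrMr// mul1r.
- by rewrite divr_ge0// ltW.
- by rewrite divr_ge0// ltW.
- by field.
- rewrite (surjective_pairing (c (sg j))); congr (_, _).
    by move: D0; rewrite /D/cr/v/= => D0; field.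
  by move: D0; rewrite /D/cr/v/= => D0; field.
Qed.

End Sorting.

Lemma hull_reindex n (c : 'I_n -> R * R) (sg : 'I_n -> 'I_n) : injective sg ->
  convex_hull (c \o sg) = convex_hull c.
Proof.
move=> sgI; rewrite eqEsubset; split; apply: hull_subP => i; first exact: hull_vertex.
by have := hull_vertex (c \o sg) (invF sgI i); rewrite /= f_invF.
Qed.

End ConvexPosition.

(** * Regions enclosed by polygonal lines *)

Section Enclosed.
Variable R : realType.
Implicit Types (A C : set (R * R)) (p q x : R * R).

Lemma bounded_setP A : bounded_set A <-> exists M, in_square M A.
Proof.
split=> [[M [Mr HM]]|[M HM]].
  exists (`|M| + 1) => p Ap.
  have : Num.max `|p.1| `|p.2| <= `|M| + 1.
    by apply: (HM (`|M| + 1)) => //; rewrite ltr_pwDr// ler_norm.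
  by rewrite ge_max => /andP[].
exists M; split; first exact: num_real.
move=> r Mr p Ap; have [h1 h2] := HM p Ap.
suff : Num.max `|p.1| `|p.2| <= r by [].
by rewrite ge_max (le_trans h1) ?(le_trans h2)// ltW.
Qed.

Lemma segment_sub A p q : convex A -> A p -> A q -> segment p q `<=` A.
Proof. by move=> cA Ap Aq _ [t /= t01 <-]; apply: cA; rewrite // in_itv/= in t01. Qed.

Definition seg_map p q (t : R) : R * R :=
  ((1 - t) * p.1 + t * q.1, (1 - t) * p.2 + t * q.2).

Lemma continuous_seg_map p q : continuous (seg_map p q).
Proof.
move=> t; have c (a b : R) : continuous (fun t : R => (1 - t) * a + t * b).
  move=> u; apply: cvgD; (apply: cvgM; last exact: cvg_cst).
    by apply: cvgB; [exact: cvg_cst|exact: cvg_id].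
  exact: cvg_id.
exact: (cvg_pair (c p.1 q.1 t) (c p.2 q.2 t)).
Qed.

Lemma segment_closed p q : closed (segment p q).
Proof.
apply: compact_closed; first exact: norm_hausdorff.
apply: (@continuous_compact _ _ (seg_map p q)); last exact: segment_compact.
exact/continuous_subspaceT/continuous_seg_map.
Qed.

Lemma connected_segment p q : connected (segment p q).
Proof.
apply: (@connected_continuous_connected _ _ _ (seg_map p q)); first exact: segment_connected.
exact/continuous_subspaceT/continuous_seg_map.
Qed.

Lemma polygonal_line_closed n (p : 'I_n -> R * R) : closed (polygonal_line p).
Proof.
by apply: closed_bigcup; [exact: finite_finset|move=> i _; exact: segment_closed].
Qed.

Lemma polygonal_line_sub_hull n (p : 'I_n -> R * R) : polygonal_line p `<=` convex_hull p.
Proof.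
move=> x [i _]; apply: segment_sub; [exact: hull_convex|exact: hull_vertex|exact: hull_vertex].
Qed.

(** For measurability. An unbounded connected set that avoids the line and contains [x] can be
    joined by a short segment to every point near [x], so the complement is open. *)
Lemma enclosed_closed n (p : 'I_n -> R * R) : closed (enclosed (polygonal_line p)).
Proof.
set L := polygonal_line p; rewrite -[X in closed X]setCK; apply: open_closedC.
rewrite openE => x /= /existsNP[C /not_implyP[cC /not_implyP[Cx /not_implyP[CL nbC]]]].
have xL : (~` L) x by move=> Lx; have : (C `&` L) x by []; rewrite CL.
have : nbhs x (~` L) by apply: open_nbhs_nbhs; split => //; apply/closed_openC/polygonal_line_closed.
move=> /nbhs_ballP[r /= r0 xr]; apply/nbhs_ballP; exists r => // y xy.
apply/existsNP; exists (C `|` segment x y); apply/not_implyP; split.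
  apply: connectedU => //; last exact: connected_segment.
  exists x; split => //; exists 0; first by rewrite /= in_itv/= lexx ler01.
  by rewrite subr0 !mul1r !mul0r !addr0 -surjective_pairing.
apply/not_implyP; split.
  right; exists 1; first by rewrite /= in_itv/= lexx ler01.
  by rewrite subrr !mul1r !mul0r !add0r -surjective_pairing.
apply/not_implyP; split; last first.
  move=> /bounded_setP[M HM]; apply: nbC; apply/bounded_setP; exists M => z Cz.
  by apply: HM; left.
rewrite -subset0 => z [[Cz|xyz] Lz]; first by rewrite -CL.
apply: (xr z _ Lz).
have cB : convex (ball x r).
  move=> a b t [a1 a2] [b1 b2] /andP[t0 t1].
  have bd (u v w : R) : `|u - v| < r -> `|u - w| < r -> `|u - ((1 - t) * v + t * w)| < r.
    move=> h1 h2.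
    have -> : u - ((1 - t) * v + t * w) = (1 - t) * (u - v) + t * (u - w) by ring.
    pose m := Num.max `|u - v| `|u - w|.
    have mr : m < r by rewrite /m gt_max h1.
    apply: le_lt_trans mr; apply: le_trans (ler_normD _ _) _.
    have t1' : 0 <= 1 - t by rewrite subr_ge0.
    have -> : m = (1 - t) * m + t * m by ring.
    rewrite !normrM (ger0_norm t0) (ger0_norm t1').
    by apply: lerD; apply: ler_wpM2l; rewrite // /m le_max lexx ?orbT.
  by split; rewrite /=; apply: bd.
apply: (segment_sub cB) xyz => //; exact: ballxx.
Qed.

(** From a point [x] outside the hull, the ray pointing away from a vertex [h] is unbounded and
    never meets the hull: otherwise [x] would lie between [h] and a point of the hull. *)
Lemma enclosed_sub_hull n (p : 'I_n -> R * R) : (0 < n)%N ->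
  enclosed (polygonal_line p) `<=` convex_hull p.
Proof.
move=> n0 x ex; apply: contrapT => nx.
pose h := p (Ordinal n0); have Hh : convex_hull p h by exact: hull_vertex.
pose f (t : R) : R * R := seg_map x h (- t).
pose C := f @` `[0, +oo[.
have fE t : f t = (x.1 + t * (x.1 - h.1), x.2 + t * (x.2 - h.2)).
  by rewrite /f/seg_map; congr (_, _); ring.
have cC : connected C.
  apply: connected_continuous_connected.
    by apply/connected_intervalP; exact: interval_is_interval.
  apply: continuous_subspaceT => t.
  apply: (@continuous_comp _ _ _ (fun t => - t) (seg_map x h)); first exact: continuousN.
  exact: continuous_seg_map.
have Cx : C x.
  exists 0; first by rewrite /= in_itv/= lexx.
  by rewrite fE !mul0r !addr0 -surjective_pairing.
have CL : C `&` polygonal_line p = set0.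
  rewrite -subset0 => z [[t]]; rewrite /= in_itv/= andbT => t0 <- /polygonal_line_sub_hull H.
  have t1 : 0 < 1 + t by lra.
  apply: nx; have := hull_convex H Hh (_ : 0 <= t / (1 + t) <= 1).
  have -> : 1 - t / (1 + t) = (1 + t)^-1 by field; rewrite gt_eqF.
  rewrite fE /=.
  have E (a b : R) : (1 + t)^-1 * (a + t * (a - b)) + t / (1 + t) * b = a.
    by field; rewrite gt_eqF.
  rewrite !E -surjective_pairing; apply; rewrite divr_ge0 ?(ltW t1)//= ler_pdivrMr//; lra.
have /bounded_setP[M HM] := ex C cC Cx CL.
have unb (a b : R) : (forall t, 0 <= t -> `|a + t * (a - b)| <= M) -> a = b.
  move=> H; apply: contrapT => /eqP; rewrite -subr_eq0 => ab.
  have M0 : 0 <= M by apply: le_trans (H 0 _).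
  have ab0 : 0 < `|a - b| by rewrite normr_gt0.
  pose t := (M + `|a| + 1) / `|a - b|.
  have t0 : 0 <= t by rewrite divr_ge0// addr_ge0// addr_ge0.
  have := H t t0; have : `|t * (a - b)| = M + `|a| + 1.
    by rewrite normrM (ger0_norm t0) /t divfK// gt_eqF.
  have := ler_normB (a + t * (a - b)) a; rewrite addrAC subrr add0r; lra.
apply: nx; suff -> : x = h by [].
rewrite (surjective_pairing x) (surjective_pairing h); congr (_, _); apply: unb => t t0.
  have [] := HM (f t); last by rewrite fE.
  by exists t => //; rewrite /= in_itv/= t0.
have [] := HM (f t); last by rewrite fE.
by exists t => //; rewrite /= in_itv/= t0.
Qed.

Section StrictlyConvex.
Variables (n : nat) (p : 'I_n -> R * R).
Hypotheses (n2 : (2 < n)%N) (cp : strictly_convex p).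

Lemma orient_rot a b c : orient a b c = orient b c a :> R.
Proof. by rewrite /orient; ring. Qed.

Lemma ordS_val (i : 'I_n) : (i.+1 < n)%N -> ordS i = i.+1 :> nat.
Proof. by move=> h; rewrite /= modn_small. Qed.

Lemma ordS_last (i : 'I_n) : i.+1 = n -> ordS i = 0%N :> nat.
Proof. by move=> h; rewrite /= h modnn. Qed.

(** Orientation is invariant under cyclic rotation, so each position of [j], and the edge that
    closes the line, reduces to an increasing triple. *)
Lemma edge_orient_gt0 (i j : 'I_n) : j != i -> j != ordS i ->
  0 < orient (p i) (p (ordS i)) (p j).
Proof.
move=> ji jsi; have := ltn_ord i; rewrite leq_eqVlt => /orP[/eqP li|li].
  have s0 := ordS_last li; rewrite orient_rot; apply: cp.
  have jn := ltn_ord j; apply/andP; split.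
    rewrite s0 lt0n; apply: contra_neq jsi => e; apply: val_inj.
    by rewrite [RHS]s0.
  rewrite ltn_neqAle -ltnS li jn andbT; apply: contra_neq ji => e; exact: val_inj.
have s1 := ordS_val li.
case: (ltngtP j i) => [h|h|h].
- by rewrite orient_rot orient_rot; apply: cp; rewrite h s1 /=.
- apply: cp; rewrite s1 ltnSn/= ltn_neqAle h andbT.
  by apply: contra_neq jsi => e; apply: val_inj; rewrite [RHS]s1.
- by move/eqP: ji; case; apply: val_inj.
Qed.

Lemma edge_orient_ge0 (i j : 'I_n) : 0 <= orient (p i) (p (ordS i)) (p j).
Proof.
case: (eqVneq j i) => [->|ji]; first by rewrite /orient !subrr !mulr0 subrr.
case: (eqVneq j (ordS i)) => [->|jsi]; last exact/ltW/edge_orient_gt0.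
by rewrite /orient mulrC subrr.
Qed.

Lemma ordS_neq (i : 'I_n) : ordS i != i.
Proof.
apply/eqP => /(congr1 val) /= h; have := ltn_ord i; rewrite leq_eqVlt => /orP[/eqP e|e].
  by move: h; rewrite e modnn => h; move: e n2; rewrite -h => <-.
by move: h; rewrite modn_small// => /esym/n_Sn.
Qed.

Lemma ordS_inj (i j : 'I_n) : ordS i = ordS j -> i = j.
Proof.
move=> /(congr1 val) /= h; apply: val_inj => /=.
have := ltn_ord i; rewrite leq_eqVlt => /orP[/eqP ei|ei];
  have := ltn_ord j; rewrite leq_eqVlt => /orP[/eqP ej|ej]; move: h;
  rewrite ?ei ?ej ?modnn ?(modn_small ei) ?(modn_small ej) => //; lia.
Qed.

Lemma ordS2_neq (i : 'I_n) : ordS (ordS i) != i.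
Proof.
apply/eqP => /(congr1 val) /= h; have := ltn_ord i; rewrite leq_eqVlt => /orP[/eqP e|e].
  by move: h; rewrite e modnn modn_small; lia.
move: h; rewrite (modn_small e); move: e; rewrite leq_eqVlt => /orP[/eqP e|e].
  by rewrite e modnn; lia.
by rewrite modn_small//; lia.
Qed.

Lemma orient_barycenter (w : 'I_n -> R) a b : \sum_(i < n) w i = 1 ->
  orient a b (barycenter w p) = \sum_(i < n) w i * orient a b (p i).
Proof.
move=> w1; rewrite /orient/barycenter/=.
transitivity ((b.1 - a.1) * (\sum_(i < n) w i * (p i).2 - a.2 * \sum_(i < n) w i) -
  (b.2 - a.2) * (\sum_(i < n) w i * (p i).1 - a.1 * \sum_(i < n) w i)).
  by rewrite w1 !mulr1.
rewrite !mulr_sumr -!sumrB !mulr_sumr -sumrB; apply: eq_bigr => i _; ring.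
Qed.

Lemma hull_edge x i : convex_hull p x -> 0 <= orient (p i) (p (ordS i)) x.
Proof.
move=> [w [w0 w1 ->]]; rewrite -/(barycenter w p) orient_barycenter//.
by apply: sumr_ge0 => j _; rewrite mulr_ge0// edge_orient_ge0.
Qed.

(** A vanishing sum of nonnegative terms: every vertex off the edge has positive orientation, hence
    weight 0. *)
Lemma hull_edge_eq0 x i : convex_hull p x -> orient (p i) (p (ordS i)) x = 0 ->
  segment (p i) (p (ordS i)) x.
Proof.
move=> [w [w0 w1 ->]]; rewrite -/(barycenter w p) orient_barycenter// => S0.
have wj j : j != i -> j != ordS i -> w j = 0.
  move=> ji jsi; have := psumr_eq0P (fun k _ => mulr_ge0 (w0 k) (edge_orient_ge0 i k)) S0 (i := j) isT.
  by move/eqP; rewrite mulf_eq0 => /orP[/eqP//|]; rewrite gt_eqF// edge_orient_gt0.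
have sum2 (f : 'I_n -> R) : \sum_(j < n) w j * f j = w i * f i + w (ordS i) * f (ordS i).
  rewrite (bigD1 i)//= (bigD1 (ordS i)) ?ordS_neq//= big1 ?addr0// => j /andP[h1 h2].
  by rewrite wj// mul0r.
have wi : w i = 1 - w (ordS i).
  have := sum2 (fun=> 1); under eq_bigr do rewrite mulr1.
  by rewrite w1 !mulr1 => ->; ring.
exists (w (ordS i)); last by rewrite /barycenter !sum2 wi.
by rewrite /= in_itv/= w0/=; have := w0 i; rewrite wi subr_ge0.
Qed.

(** For a point common to sides [i] and [j], the orientation relative to side [j] vanishes. It is a
    convex combination of the nonnegative values at the two ends of side [i], so the point is an end
    of that side, namely a vertex of side [j]. *)
Lemma strictly_convex_simple : simple_polygon p.
Proof.
have pos i : 0 < orient (p i) (p (ordS i)) (p (ordS (ordS i))).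
  by apply: edge_orient_gt0; [exact: ordS2_neq|exact: ordS_neq].
split => //.
- move=> i j pij; apply/eqP; apply: contraT => ij.
  have [jsi|jsi] := eqVneq j (ordS i).
    have := pos i; rewrite -jsi -pij.
    suff -> : orient (p i) (p i) (p (ordS j)) = 0 by rewrite ltxx.
    by rewrite /orient; ring.
  have := edge_orient_gt0 (_ : j != i) jsi; rewrite eq_sym ij -pij => /(_ isT).
  suff -> : orient (p i) (p (ordS i)) (p i) = 0 by rewrite ltxx.
  by rewrite /orient; ring.
- move=> i j _ ij [t /= t01 <-] [u /= u01].
  rewrite in_itv/= in t01; case/andP: t01 => t0 t1 [E1 E2].
  set A := orient (p j) (p (ordS j)) (p i).
  set B := orient (p j) (p (ordS j)) (p (ordS i)).
  have AB : (1 - t) * A + t * B = 0.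
    transitivity (orient (p j) (p (ordS j))
      ((1 - t) * (p i).1 + t * (p (ordS i)).1, (1 - t) * (p i).2 + t * (p (ordS i)).2)).
      by rewrite /A /B/orient/=; ring.
    by rewrite -E1 -E2 /orient/=; ring.
  have A0 : 0 <= A by exact: edge_orient_ge0.
  have B0 : 0 <= B by exact: edge_orient_ge0.
  have [iSj|iSj] := eqVneq i (ordS j).
    have sij : ordS i != j by rewrite iSj ordS2_neq.
    have sisj : ordS i != ordS j by apply: contra_neq ij; exact: ordS_inj.
    have Bp : 0 < B by exact: edge_orient_gt0.
    have tz : t = 0 by move: AB A0 Bp t0 t1; clear; nra.
    by right; split => //; rewrite tz subr0 !mul1r !mul0r !addr0 -surjective_pairing.
  have Ap : 0 < A by exact: edge_orient_gt0.
  have tz : t = 1 by move: AB Ap B0 t0 t1; clear; nra.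
  left; have jsi : j = ordS i.
    apply/eqP; apply: contraT => jsi; have sisj : ordS i != ordS j by apply: contra_neq ij; exact: ordS_inj.
    have Bp : 0 < B by apply: edge_orient_gt0; rewrite // eq_sym.
    by move: AB Bp; rewrite tz subrr mul0r mul1r add0r => ->; rewrite ltxx.
  by split => //; rewrite tz subrr !mul1r !mul0r !add0r -jsi -surjective_pairing.
- move=> i col; have := pos i; rewrite /orient.
  by move: col; rewrite /collinear => ->; rewrite subrr ltxx.
Qed.

Lemma hull_comb3 m (v : 'I_m -> R * R) a b d (s t u : R) :
  0 <= s -> 0 <= t -> 0 <= u -> s + t + u = 1 ->
  convex_hull v (s * (v a).1 + t * (v b).1 + u * (v d).1,
                 s * (v a).2 + t * (v b).2 + u * (v d).2).
Proof.
move=> s0 t0 u0 stu.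
pose w j := s * (j == a)%:R + t * (j == b)%:R + u * (j == d)%:R.
have sumw (f : 'I_m -> R) : \sum_(j < m) w j * f j = s * f a + t * f b + u * f d.
  have one k : \sum_(j < m) (j == k)%:R * f j = f k.
    by rewrite (bigD1 k)//= eqxx mul1r big1 ?addr0// => j /negbTE ->; rewrite mul0r.
  rewrite -(one a) -(one b) -(one d) !mulr_sumr -!big_split/=.
  by apply: eq_bigr => j _; rewrite /w; ring.
exists w; split.
- by move=> j; rewrite !addr_ge0// mulr_ge0// ler0n.
- by rewrite -stu -[s]mulr1 -[t]mulr1 -[u]mulr1 -(sumw (fun=> 1)); apply: eq_bigr => j _; rewrite mulr1.
- by rewrite !sumw.
Qed.

(** Fan of triangles with apex [P 0]: [x] lies in the triangle on the side from [P k] to [P k.+1],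
    where [k] is the last index whose ray has [x] on its left. Its barycentric coordinates are
    quotients of orientations. *)
Lemma edges_hull x : (forall i, 0 <= orient (p i) (p (ordS i)) x) -> convex_hull p x.
Proof.
move=> hx.
case: n n2 p cp hx => [//|m] m2 q cq hx.
pose P k := q (inord k).
have hxP k : (k.+1 < m.+1)%N -> 0 <= orient (P k) (P k.+1) x.
  move=> km; have := hx (inord k); congr (0 <= orient _ (q _) _).
  by apply: val_inj; rewrite /= !inordK ?modn_small// ltnW.
have hxl : 0 <= orient (P m) (P 0%N) x.
  have := hx (inord m); congr (0 <= orient _ (q _) _).
  by apply: val_inj; rewrite /= !inordK ?modnn.
have cP i j k : (i < j < k)%N -> (k < m.+1)%N -> 0 < orient (P i) (P j) (P k).
  move=> /andP[ij jk] km; apply: cq.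
  by rewrite !inordK ?ij//; [apply: ltn_trans km|apply: ltn_trans km; apply: ltn_trans jk].
have [k [k0 km ok ok1]] : exists k, [/\ (0 < k)%N, (k.+1 < m.+1)%N,
    0 <= orient (P 0%N) (P k) x & orient (P 0%N) (P k.+1) x <= 0].
  pose Q k := (0 < k)%N && (0 <= orient (P 0%N) (P k) x) && (k < m)%N.
  have Q1 : exists k, Q k by exists 1%N; rewrite /Q hxP//=; lia.
  have Qb k : Q k -> (k <= m)%N by move=> /andP[_ /ltnW].
  case: (ex_maxnP Q1 Qb) => k /andP[/andP[k0 ok] km] kmax.
  exists k; split => //; case: (ltnP k.+1 m) => km1; last first.
    have -> : k.+1 = m by lia.
    by rewrite -oppr_ge0; move: hxl; congr (0 <= _); rewrite /orient; ring.
  rewrite leNgt; apply/negP => h; have : (k.+1 <= k)%N.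
    by apply: kmax; rewrite /Q (ltW h) km1.
  by rewrite ltnn.
have D0 : 0 < orient (P 0%N) (P k) (P k.+1) by apply: cP => //; rewrite k0 ltnSn.
have e := hxP k km.
set a := P 0%N in ok ok1 D0 e; set b := P k in ok ok1 D0 e; set d := P k.+1 in ok ok1 D0 e.
set D := orient a b d in D0.
pose s := orient a b x / D; pose t := - orient a d x / D.
have st : 0 <= 1 - s - t.
  have -> : 1 - s - t = orient b d x / D.
    by move: D0; rewrite /s /t /D /orient => D0; field; rewrite gt_eqF.
  by rewrite divr_ge0// ltW.
have := @hull_comb3 _ q (inord 0) (inord k) (inord k.+1) (1 - s - t) t s.
rewrite -!/(P _) -/a -/b -/d.
have -> : ((1 - s - t) * a.1 + t * b.1 + s * d.1, (1 - s - t) * a.2 + t * b.2 + s * d.2) = x.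
  rewrite [RHS]surjective_pairing; move: D0; rewrite /s /t /D /orient => D0.
  by congr (_, _); field; rewrite gt_eqF.
apply => //; last by ring.
  by rewrite divr_ge0 ?oppr_ge0// ltW.
by rewrite divr_ge0// ltW.
Qed.

Lemma closed_orient_ge0 (a b : R * R) : closed [set x : R * R | 0 <= orient a b x].
Proof.
apply: (@preimage_closed _ _ (fun x => orient a b x) [set y | 0 <= y]); last exact: closed_ge.
move=> x _; apply: cvgB; (apply: cvgM; first exact: cvg_cst).
  by apply: cvgB; [exact: cvg_snd|exact: cvg_cst].
by apply: cvgB; [exact: cvg_fst|exact: cvg_cst].
Qed.

Lemma open_orient_gt0 (a b : R * R) : open [set x : R * R | 0 < orient a b x].
Proof.
have -> : [set x | 0 < orient a b x] = ~` [set x | 0 <= orient b a x].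
  rewrite eqEsubset; split => x /=.
    by move=> h; apply/negP; rewrite -ltNge; move: h; rewrite /orient; lra.
  by move/negP; rewrite -ltNge; rewrite /orient; lra.
exact/closed_openC/closed_orient_ge0.
Qed.

(* Off the boundary line, the hull coincides with the open set where all edge
   orientations are positive, so a connected set avoiding the line stays in the hull. *)
Lemma enclosed_strictly_convex : enclosed (polygonal_line p) = convex_hull p.
Proof.
rewrite eqEsubset; split; first by apply: enclosed_sub_hull; apply: ltn_trans n2.
move=> x hx C cC Cx CL.
pose W := \bigcap_(i in [set: 'I_n]) [set x | 0 <= orient (p i) (p (ordS i)) x].
pose U := \bigcap_(i in [set: 'I_n]) [set x | 0 < orient (p i) (p (ordS i)) x].
have WE : W = convex_hull p.
  rewrite eqEsubset; split=> y hy; last by move=> i _; exact: hull_edge.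
  by apply: edges_hull => i; exact: hy.
have CWU : C `&` W = C `&` U.
  rewrite eqEsubset; split=> y [Cy hy]; split => // i _; last by apply: ltW; exact: hy.
  rewrite /= lt_neqAle hy// andbT eq_sym; apply/eqP => o0.
  have : (C `&` polygonal_line p) y.
    by split => //; exists i => //; apply: hull_edge_eq0 => //; rewrite -WE.
  by rewrite CL.
have CW : C `&` W = C.
  apply: cC.
  - by exists x; split => //; rewrite WE.
  - exists U => //.
    have -> : U = ~` \bigcup_(i in [set: 'I_n]) ~` [set x | 0 < orient (p i) (p (ordS i)) x].
      by rewrite setC_bigcup; apply: eq_bigcapr => i _; rewrite setCK.
    apply: closed_openC; apply: closed_bigcup; first exact: finite_finset.
    by move=> i _; apply: open_closedC; exact: open_orient_gt0.
  - by exists W => //; apply: closed_bigI => i _; exact: closed_orient_ge0.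
have [M HM] := hull_in_square_max p.
by apply/bounded_setP; exists M => y; rewrite -CW WE => -[_ /HM].
Qed.

End StrictlyConvex.
End Enclosed.

(** * Optimal small polygons and their compression *)

Section OptimalPolygons.
Variable R : realType.
Implicit Types (A C : set (R * R)) (x y : R * R).

Lemma small_ngon_hull n (p : 'I_n -> R * R) : (2 < n)%N -> strictly_convex p -> small p ->
  (exists i j, sqd (p i) (p j) = 1) -> small_ngon n (convex_hull p).
Proof.
move=> n2 cp sp [i [j pij]]; split.
  by exists p; split; [exact: strictly_convex_simple|rewrite enclosed_strictly_convex].
split; last first.
  exists (p i), (p j); split; [exact: hull_vertex|exact: hull_vertex|].
  exact/edist_eq1.
by move=> x y hx hy; rewrite edist_le1; apply: (hull_diam _ hx hy).
Qed.

Lemma area_enclosed_le_hull n (p : 'I_n -> R * R) : (0 < n)%N ->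
  area (enclosed (polygonal_line p)) <= area (convex_hull p).
Proof.
move=> n0; have [M HM] := hull_in_square_max p.
apply: (area_le _ _ HM).
- exact: (closed_measurable2 (@enclosed_closed _ _ p)).
- exact: hull_measurable.
- exact: enclosed_sub_hull.
Qed.

Lemma vertex_enclosed n (p : 'I_n -> R * R) i : enclosed (polygonal_line p) (p i).
Proof.
move=> C _ Cp CL; exfalso.
have : (C `&` polygonal_line p) (p i).
  split => //; exists i => //; exists 0; first by rewrite /= in_itv/= lexx ler01.
  by rewrite subr0 !mul1r !mul0r !addr0 -surjective_pairing.
by rewrite CL.
Qed.

Lemma optimal_strictly_convex n : (2 < n)%N -> exists p : 'I_n -> R * R,
  [/\ strictly_convex p, small p, exists i j, sqd (p i) (p j) = 1 &
   forall c' : 'I_n -> R * R, small c' -> area (convex_hull c') <= area (convex_hull p)].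
Proof.
move=> n2; have [c sc cmax] := @max_area_hull R n.
have [sg sgI scx] := convex_position_sort (max_irredundant n2 sc cmax) (ltnW (ltnW n2)).
exists (c \o sg); split; first by [].
- by move=> i j; exact: sc.
- have [i [j cij]] := max_diam n2 sc cmax.
  by exists (invF sgI i), (invF sgI j); rewrite /= !f_invF.
- by move=> c' sc'; rewrite hull_reindex//; exact: cmax.
Qed.

(** A competitor may be non-convex; its area is at most that of the hull of its vertices, and these
    form a small configuration. *)
Lemma optimal_hull n (p : 'I_n -> R * R) : (2 < n)%N -> strictly_convex p -> small p ->
  (exists i j, sqd (p i) (p j) = 1) ->
  (forall c' : 'I_n -> R * R, small c' -> area (convex_hull c') <= area (convex_hull p)) ->
  optimal_small_ngon n (convex_hull p).
Proof.
move=> n2 cp sp dp pmax; split; first exact: small_ngon_hull.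
move=> _ [[q [_ ->]] [dq _]]; apply: le_trans (area_enclosed_le_hull _ _) _.
  exact: ltnW (ltnW n2).
apply: pmax => i j; rewrite -edist_le1; apply: dq; exact: vertex_enclosed.
Qed.

(* Compressing orthogonally to a diametral chord keeps the diameter. *)
Lemma compress_hull n (p : 'I_n -> R * R) (s : R) : (2 < n)%N -> strictly_convex p -> small p ->
  (exists i j, sqd (p i) (p j) = 1) -> 0 < s <= 1 ->
  exists2 P, small_ngon n P & area P = s * area (convex_hull p).
Proof.
move=> n2 cp sp [i [j pij]] /andP[s0 s1].
have [nu [nu1 nu0]] : exists nu : R * R, nu.1 ^+ 2 + nu.2 ^+ 2 = 1 /\
    ((p i).1 - (p j).1) * nu.1 + ((p i).2 - (p j).2) * nu.2 = 0.
  exists ((p i).2 - (p j).2, (p j).1 - (p i).1); split => /=; last by ring.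
  by rewrite -pij /sqd; ring.
(* [nu] is the unit normal to the chord and [T] the identity minus 1 - s times the projection onto
   [nu]: it contracts along [nu] only and has determinant [s]. *)
pose T := affmap (1 - (1 - s) * nu.1 ^+ 2) (- (1 - s) * nu.1 * nu.2)
  (- (1 - s) * nu.1 * nu.2) (1 - (1 - s) * nu.2 ^+ 2) 0 0.
have sqdT x y : sqd (T x) (T y) = sqd x y
    - (1 - s ^+ 2) * ((x.1 - y.1) * nu.1 + (x.2 - y.2) * nu.2) ^+ 2.
  transitivity (sqd x y - (2 * (1 - s) - (1 - s) ^+ 2 * (nu.1 ^+ 2 + nu.2 ^+ 2))
      * ((x.1 - y.1) * nu.1 + (x.2 - y.2) * nu.2) ^+ 2).
    by rewrite /T /affmap /sqd /=; ring.
  by rewrite nu1; ring.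
have det : (1 - (1 - s) * nu.1 ^+ 2) * (1 - (1 - s) * nu.2 ^+ 2)
    - (- (1 - s) * nu.1 * nu.2) * (- (1 - s) * nu.1 * nu.2) = s.
  transitivity (1 - (1 - s) * (nu.1 ^+ 2 + nu.2 ^+ 2)); first by ring.
  by rewrite nu1; ring.
have a0 : 0 < 1 - (1 - s) * nu.1 ^+ 2.
  have : nu.1 ^+ 2 <= 1 by rewrite -nu1 lerDl sqr_ge0.
  have := sqr_ge0 nu.1; clear - s0 s1; move: (nu.1 ^+ 2) => q; nra.
have aT : area (convex_hull (T \o p)) = s * area (convex_hull p).
  by rewrite area_hull_affmap ?det.
exists (convex_hull (T \o p)) => //; apply: small_ngon_hull => //.
- move=> k l m klm /=; have := cp _ _ _ klm.
  have -> : orient (T (p k)) (T (p l)) (T (p m)) = s * orient (p k) (p l) (p m).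
    by rewrite -[in RHS]det /orient/T/affmap/=; ring.
  exact: mulr_gt0.
- move=> k l /=; rewrite sqdT; apply: le_trans (sp k l).
  rewrite lerBlDr lerDl mulr_ge0 ?sqr_ge0// subr_ge0 expr_le1//; exact: ltW.
- by exists i, j; rewrite /= sqdT pij nu0 expr0n mulr0 subr0.
Qed.

End OptimalPolygons.

(** * Area of a symmetric convex polygon *)

Section Trapezoid.
Variable R : realType.
Local Notation leb := (@lebesgue_measure R).
Local Notation mu2 := (leb \x leb)%E.

Lemma integral_affine (a b c d : R) : a < b ->
  (\int[leb]_(y in `[a, b]) (2 * (c + d * (y - a)))%:E)%E
  = (2 * c * (b - a) + d * (b - a) ^+ 2)%:E.
Proof.
move=> ab; pose F (y : R) : R := 2 * c * y + d * (y - a) ^+ 2.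
have cF : continuous F.
  move=> y; apply: cvgD; first by apply: cvgM; [exact: cvg_cst|exact: cvg_id].
  apply: cvgM; first exact: cvg_cst.
  by apply: (@cvgM _ _ _ _ (fun y => y - a) (fun y => y - a));
    apply: cvgB; [exact: cvg_id|exact: cvg_cst|exact: cvg_id|exact: cvg_cst].
have dF (y : R) : is_derive y 1 F (2 * (c + d * (y - a))).
  rewrite /F; apply: is_derive_eq.
  by rewrite /GRing.scale/=; ring.
have := @continuous_FTC2 R (fun y => 2 * (c + d * (y - a))) F a b ab.
move=> ->.
- by rewrite -EFinB /F; congr (_%:E); ring.
- apply: continuous_subspaceT => y; apply: cvgM; first exact: cvg_cst.
  apply: cvgD; first exact: cvg_cst.
  by apply: cvgM; [exact: cvg_cst|apply: cvgB; [exact: cvg_id|exact: cvg_cst]].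
- split.
  + by move=> y _; exact: ex_derive.
  + exact/cvg_at_right_filter/cF.
  + exact/cvg_at_left_filter/cF.
- by move=> y _; rewrite derive1E; exact: derive_val.
Qed.

(** For [e] true the top side is left out. Half-open trapezoids are disjoint and give the lower
    bound for the area; closed ones cover the polygon and give the upper bound. *)
Definition trapezoid (e : bool) (a b c d : R) : set (R * R) :=
  [set p | p.2 \in Interval (BLeft a) (BSide e b) /\ `|p.1| <= c + d * (p.2 - a)].

Lemma measurable_trapezoid e a b c d : measurable (trapezoid e a b c d).
Proof.
have -> : trapezoid e a b c d = (setT `*` [set` Interval (BLeft a) (BSide e b)]) `&`
   ((fun p : R * R => (-1 * p.1 + d * p.2 + (c - d * a), 1 * p.1 + d * p.2 + (c - d * a)))
      @^-1` (`[0, +oo[ `*` `[0, +oo[)).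
  rewrite eqEsubset; split=> [p [h1]|p [[_ h1]]].
    rewrite ler_norml => /andP[h2 h3]; split; first by split.
    by split; rewrite /= in_itv/= andbT; lra.
  rewrite /= !in_itv/= !andbT => -[h2 h3]; split => //.
  by rewrite ler_norml; apply/andP; split; lra.
apply: measurableI.
  by apply: measurableX => //; exact: measurable_itv.
by apply: measurable_affine2; apply: measurableX; exact: measurable_itv.
Qed.

Lemma mu2_trapezoid e (a b c d : R) : a < b -> 0 <= c -> 0 <= c + d * (b - a) ->
  mu2 (trapezoid e a b c d) = (2 * c * (b - a) + d * (b - a) ^+ 2)%:E.
Proof.
move=> ab c0 c1; rewrite mu2_ysection; last exact: measurable_trapezoid.
rewrite -(integral_affine c d ab) /product_measure2.
pose f (y : R) : \bar R := (2 * (c + d * (y - a)))%:E.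
have -> : (\int[leb]_(y in `[a, b]) f y = \int[leb]_(y in [set` Interval (BLeft a) (BSide e b)]) f y)%E.
  case: e => //; rewrite integral_itv_bndo_bndc//.
  apply: measurable_funTS; apply/measurable_EFinP.
  apply: measurable_funM => //; apply: measurable_funD => //; apply: measurable_funM => //.
  exact: measurable_funB.
rewrite [in RHS]integral_mkcond; apply: eq_integral => y _ /=.
rewrite patchE; case: ifPn => [|yI].
  rewrite inE/= => yI.
  have ell0 : 0 <= c + d * (y - a).
    have /andP[h1 h2] : a <= y <= b.
      by move: yI; rewrite in_itv/= => /andP[-> h]/=; case: (e) h => //= /ltW.
    have [d0|d0] := leP 0 d.
      by rewrite addr_ge0// mulr_ge0// subr_ge0.
    by apply: le_trans c1 _; rewrite lerD2l ler_nM2l// lerD2r.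
  have -> : ysection (trapezoid e a b c d) y = `[- (c + d * (y - a)), c + d * (y - a)]%classic.
    rewrite eqEsubset; split => x; rewrite /ysection/= inE.
      by move=> [_ h]; rewrite in_itv/= -ler_norml.
    by move=> h; split => //; move: h; rewrite in_itv/= -ler_norml.
  have E (l : R) : 0 <= l -> leb `[(- l)%R, l]%classic = (2 * l)%:E.
    rewrite lebesgue_measure_itv/= lte_fin => l0; case: ifPn => [_|].
      by rewrite -EFinB; congr (_%:E); ring.
    by rewrite -leNgt => h; congr (_%:E); lra.
  exact: (E _ ell0).
rewrite (_ : ysection _ _ = set0) ?measure0//.
rewrite -subset0 => x; rewrite /ysection/= inE /trapezoid/= => -[h _].
by move: yI; rewrite notin_setE /=.
Qed.

End Trapezoid.

Section SymmetricPolygon.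
Variable R : realType.
Local Notation leb := (@lebesgue_measure R).
Local Notation mu2 := (leb \x leb)%E.
Variables (m : nat) (X Y : nat -> R).
Hypothesis X0 : forall i, (i <= m)%N -> 0 <= X i.
Hypothesis Yinc : forall i, (i < m)%N -> Y i < Y i.+1.

Definition sym_area := \sum_(i < m) (X i + X i.+1) * (Y i.+1 - Y i).

Let band e i := trapezoid e (Y i) (Y i.+1) (X i) ((X i.+1 - X i) / (Y i.+1 - Y i)).

Let mu2_band e i : (i < m)%N -> mu2 (band e i) = ((X i + X i.+1) * (Y i.+1 - Y i))%:E.
Proof.
move=> im; have Yi := Yinc im; have d0 : Y i.+1 - Y i != 0 by rewrite subr_eq0 gt_eqF.
rewrite mu2_trapezoid//; last 2 first.
- by apply: X0; exact: ltnW.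
- by rewrite divfK// addrC subrK; exact: X0.
by congr (_%:E); field.
Qed.

Let measurable_bands e k : measurable (\big[setU/set0]_(i < k) band e i).
Proof. by apply: bigsetU_measurable => i _; exact: measurable_trapezoid. Qed.

Lemma le_Y i j : (i <= j <= m)%N -> Y i <= Y j.
Proof.
move=> /andP[ij]; elim: j ij => [|j IH]; first by rewrite leqn0 => /eqP ->.
rewrite leq_eqVlt => /orP[/eqP -> //|ij jm].
by apply: le_trans (IH ij (ltnW jm)) (ltW (Yinc jm)).
Qed.

(** By the convexity hypothesis the slanted sides of each trapezoid lie on supporting lines of the
    hull, so the hull is covered by the closed trapezoids. *)
Lemma area_hull_le_sym n (v : 'I_n -> R * R) : (0 < m)%N ->
  (forall i j, (i < m)%N -> (j <= m)%N ->
    0 <= (X i.+1 - X i) * (Y j - Y i) - (Y i.+1 - Y i) * (X j - X i)) ->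
  (forall k, exists2 j, (j <= m)%N & v k = (X j, Y j) \/ v k = (- X j, Y j)) ->
  area (convex_hull v) <= sym_area.
Proof.
move=> m0 convXY vXY.
have le k : (k <= m)%N -> (mu2 (\big[setU/set0]_(i < k) band false i) <=
    (\sum_(i < k) (X i + X i.+1) * (Y i.+1 - Y i))%:E)%E.
  elim: k => [_|k IH km]; first by rewrite !big_ord0 measure0.
  rewrite !big_ord_recr/= EFinD -(mu2_band false km).
  apply: (@le_trans _ _ (mu2 (\big[setU/set0]_(i < k) band false i) + mu2 (band false k))%E).
    apply: measureU2; first exact: measurable_bands.
    exact: measurable_trapezoid.
  by rewrite leeD2r// IH// ltnW.
have sub : convex_hull v `<=` \big[setU/set0]_(i < m) band false i.
  move=> x hx.
  have y0 : Y 0%N <= x.2.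
    have := @hull_halfplane R n v 0 1 (Y 0%N) _ x hx; rewrite mul0r add0r mul1r; apply => k.
    by have [j jm [->|->]] := vXY k; rewrite mul0r add0r mul1r; apply: le_Y.
  have ym : x.2 <= Y m.
    have := @hull_halfplane R n v 0 (-1) (- Y m) _ x hx; rewrite mul0r add0r mulN1r lerN2; apply => k.
    by have [j jm [->|->]] := vXY k; rewrite mul0r add0r mulN1r lerN2; apply: le_Y; rewrite jm /=.
  pose Q k := (k < m)%N && (Y k <= x.2).
  have Q0 : exists k, Q k by exists 0%N; rewrite /Q m0 y0.
  have Qb k : Q k -> (k <= m)%N by move=> /andP[/ltnW].
  case: (ex_maxnP Q0 Qb) => i /andP[im yi] imax.
  have yi1 : x.2 <= Y i.+1.
    move: im; rewrite leq_eqVlt => /orP[/eqP -> //|i1m].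
    rewrite leNgt; apply/negP => /ltW h; have : (i.+1 <= i)%N by apply: imax; rewrite /Q i1m h.
    by rewrite ltnn.
  rewrite -bigcup_mkord; exists i => //; split; first by rewrite in_itv/= yi yi1.
  have Yi := Yinc im.
  have side (s : R) : `|s| = 1 -> s * x.1 <= X i + (X i.+1 - X i) / (Y i.+1 - Y i) * (x.2 - Y i).
    move=> s1.
    have H := @hull_halfplane R n v (- (Y i.+1 - Y i) * s) (X i.+1 - X i)
      ((X i.+1 - X i) * Y i - (Y i.+1 - Y i) * X i) _ x hx.
    rewrite -lerBlDl mulrAC ler_pdivlMr ?subr_gt0//.
    suff : (X i.+1 - X i) * Y i - (Y i.+1 - Y i) * X i
        <= - (Y i.+1 - Y i) * s * x.1 + (X i.+1 - X i) * x.2 by lra.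
    apply: H => k; have [j jm vk] := vXY k.
    have c0 := convXY i j im jm.
    (* The sign [t] tells the two mirror images of a vertex apart, the sign [s] the two slanted
       sides; only [s * t <= 1] matters. *)
    have [t t1 ->] : exists2 t : R, s * t <= 1 & v k = (t * X j, Y j).
      have s1' : s <= 1 by rewrite -s1 ler_norm.
      have s2' : - s <= 1 by rewrite -s1 -normrN ler_norm.
      case: vk => ->; first by exists 1; rewrite ?mulr1 ?mul1r.
      by exists (-1); rewrite ?mulrN1 ?mulN1r.
    rewrite /=.
    have : 0 <= (Y i.+1 - Y i) * (X j * (1 - s * t)).
      by rewrite mulr_ge0 ?subr_ge0 ?(ltW Yi)// mulr_ge0 ?X0// subr_ge0.
    by move=> h; move: c0; lra.
  rewrite ler_norml; apply/andP; split.
    by have := side (-1); rewrite normrN normr1 => /(_ erefl); rewrite mulN1r; lra.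
  by have := side 1; rewrite normr1 => /(_ erefl); rewrite mul1r.
have [M HM] := hull_in_square_max v.
rewrite -lee_fin /area fineK; last by apply: (in_square_mu2_fin (hull_measurable v) HM).
apply: le_trans (le m (leqnn m)); apply: le_measure; rewrite ?inE//; first exact: hull_measurable.
exact: measurable_bands.
Qed.

(** Each trapezoid lies in the hull of its four corners, and the half-open ones are disjoint. *)
Lemma sym_le_area_hull n (v : 'I_n -> R * R) :
  (forall j, (j <= m)%N -> convex_hull v (X j, Y j) /\ convex_hull v (- X j, Y j)) ->
  sym_area <= area (convex_hull v).
Proof.
move=> hv; have [M HM] := hull_in_square_max v.
have eq k : (k <= m)%N -> mu2 (\big[setU/set0]_(i < k) band true i) =
    (\sum_(i < k) (X i + X i.+1) * (Y i.+1 - Y i))%:E.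
  elim: k => [_|k IH km]; first by rewrite !big_ord0 measure0.
  rewrite !big_ord_recr/= EFinD -(mu2_band true km) -(IH (ltnW km)).
  apply: measureU => //; first exact: measurable_bands.
    exact: measurable_trapezoid.
  rewrite -subset0 => x []; rewrite -bigcup_mkord => -[i /= ik [h1 _]] [h2 _].
  move: h1 h2; rewrite !in_itv/= => /andP[_ h1] /andP[h2 _].
  have : Y i.+1 <= Y k by apply: le_Y; rewrite ik ltnW.
  by rewrite leNgt (le_lt_trans h2 h1).
rewrite -lee_fin -(eq m (leqnn m)) /area fineK; last by apply: (in_square_mu2_fin (hull_measurable v) HM).
apply: le_measure; rewrite ?inE//; first exact: measurable_bands.
  exact: hull_measurable.
rewrite -bigcup_mkord => x [i /= im [yi xi]]; move: yi; rewrite in_itv/= => /andP[y0 /ltW y1].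
have Yi := Yinc im.
have [A1 A2] := hv i (ltnW im); have [B1 B2] := hv i.+1 im.
pose t := (x.2 - Y i) / (Y i.+1 - Y i).
have t0 : 0 <= t by rewrite divr_ge0// subr_ge0// ltW.
have t1 : t <= 1 by rewrite ler_pdivrMr ?subr_gt0// mul1r lerD2r.
have t01 : 0 <= t <= 1 by rewrite t0.
have d0 : Y i.+1 - Y i != 0 by rewrite subr_eq0 gt_eqF.
have C1 := hull_convex A1 B1 t01; have C2 := hull_convex A2 B2 t01; rewrite /= in C1 C2.
have tY : (1 - t) * Y i + t * Y i.+1 = x.2 by rewrite /t; field.
rewrite tY in C1 C2.
set ell := (1 - t) * X i + t * X i.+1 in C1.
have ellE : ell = X i + (X i.+1 - X i) / (Y i.+1 - Y i) * (x.2 - Y i).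
  by rewrite /ell/t; field.
have C2' : convex_hull v (- ell, x.2).
  by move: C2; congr (convex_hull v (_, _)); rewrite /ell; ring.
rewrite -ellE ler_norml in xi; case/andP: xi => x1 x2.
have [ell0|ell0] := eqVneq ell 0.
  move: x1 x2; rewrite ell0 oppr0 => x1 x2.
  have xz : x.1 = ell by apply/eqP; rewrite ell0 eq_le x1 x2.
  by rewrite (surjective_pairing x) xz.
have ellp : 0 < ell.
  by rewrite lt_neqAle eq_sym ell0 addr_ge0// mulr_ge0 ?subr_ge0// X0// ltnW.
pose u := (x.1 + ell) / (2 * ell).
have u01 : 0 <= u <= 1.
  by rewrite divr_ge0 ?ler_pdivrMr ?mulr_gt0//; [lra|lra|rewrite mulr_ge0// ltW].
have := hull_convex C2' C1 u01; rewrite /=.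
have -> : (1 - u) * - ell + u * ell = x.1 by rewrite /u; field.
have -> : (1 - u) * x.2 + u * x.2 = x.2 by ring.
by rewrite -surjective_pairing.
Qed.

End SymmetricPolygon.

(** * Star polygons *)

Section AlternatingSums.
Variable R : realType.

Lemma cos_decr (x y : R) : 0 <= x -> x <= y -> y <= pi -> cos y <= cos x.
Proof.
move=> x0 xy ypi; move: xy; rewrite le_eqVlt => /orP[/eqP ->//|xy].
have y0 : 0 <= y by apply: le_trans x0 (ltW xy).
have xpi : x <= pi by apply: le_trans (ltW xy) ypi.
by apply: ltW; rewrite ltr_cos// in_itv/= ?x0 ?xpi ?y0 ?ypi.
Qed.

Lemma cos_decr_neg (x y : R) : - pi <= x -> x <= y -> y <= 0 -> cos x <= cos y.
Proof.
move=> x0 xy y0; rewrite -(cosN x) -(cosN y); apply: cos_decr; rewrite ?oppr_ge0 ?lerN2//.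
by rewrite lerNl.
Qed.

(* [k] dominates the negative variation of [fun x => cos (x - psi)] on [0, pi]. *)
Lemma negative_variation (psi : R) : - pi <= psi <= pi -> exists k : R -> R,
  [/\ forall a b, 0 <= a -> a <= b -> b <= pi -> k b <= k a,
      forall a b, 0 <= a -> a <= b -> b <= pi ->
        cos (a - psi) - cos (b - psi) <= k a - k b,
      k 0 - k pi <= 1 + cos (0 - psi)
    & forall a b, 0 <= a -> a <= b -> b <= pi -> cos (b - psi) + (k a - k b) <= 1].
Proof.
move=> /andP[psi1 psi2]; have [psi0|psi0] := leP 0 psi.
  (* The cosine increases up to [psi] and decreases afterwards, so [k] is constant up to [psi] and
     equals the cosine from there on. For negative [psi] the decreasing part comes first, and [k]
     becomes constant at psi + pi. *)
  exists (fun x => cos (Num.max (x - psi) 0)).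
  have fk x : 0 <= x -> x <= pi -> cos (x - psi) <= cos (Num.max (x - psi) 0).
    by move=> x0 xpi; case: (lerP (x - psi) 0) => _; rewrite ?cos0 ?cos_le1.
  have mono a b : 0 <= a -> a <= b -> b <= pi ->
      cos (Num.max (b - psi) 0) <= cos (Num.max (a - psi) 0).
    move=> a0 ab bpi; apply: cos_decr; first by rewrite le_max lexx orbT.
      by rewrite ge_max !le_max lexx orbT lerD2r ab.
    by rewrite ge_max pi_ge0 andbT; lra.
  split => //.
  - move=> a b a0 ab bpi.
    case: (lerP (a - psi) 0) => ha; case: (lerP (b - psi) 0) => hb.
    + have : cos (a - psi) <= cos (b - psi) by apply: cos_decr_neg; lra.
      lra.
    + by rewrite cos0; have := cos_le1 (a - psi); lra.
    + lra.
    + exact: lexx.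
  - have -> : Num.max (0 - psi) 0 = 0 by apply/max_idPr; lra.
    have -> : Num.max (pi - psi) 0 = pi - psi by apply/max_idPl; lra.
    by rewrite cos0 (addrC pi) cosDpi sub0r opprK.
  - move=> a b a0 ab bpi; have := fk b (le_trans a0 ab) bpi.
    have := cos_le1 (Num.max (a - psi) 0); lra.
pose p := psi + pi.
have fE x : cos (x - psi) = - cos (x - p).
  by rewrite -cosDpi /p; congr cos; ring.
have p0 : 0 <= p by rewrite /p; lra.
have ppi : p <= pi by rewrite /p; lra.
clearbody p.
exists (fun x => - cos (Num.min (x - p) 0)).
split.
- move=> a b a0 ab bpi; rewrite lerN2; apply: cos_decr_neg.
  + by rewrite le_min; apply/andP; split; have := @pi_ge0 R; lra.
  + by rewrite le_min !ge_min lexx orbT lerD2r ab.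
  + by rewrite ge_min lexx orbT.
- move=> a b a0 ab bpi; rewrite !fE.
  case: (lerP (a - p) 0) => ha; case: (lerP (b - p) 0) => hb; rewrite ?cos0.
  + lra.
  + by have := cos_le1 (b - p); lra.
  + lra.
  + have : cos (b - p) <= cos (a - p) by apply: cos_decr; lra.
    lra.
- have -> : Num.min (0 - p) 0 = 0 - p by apply/min_idPl; lra.
  have -> : Num.min (pi - p) 0 = 0 by apply/min_idPr; lra.
  by rewrite cos0 fE; lra.
- move=> a b a0 ab bpi; rewrite fE.
  case: (lerP (b - p) 0) => hb.
    by have := cos_geN1 (Num.min (a - p) 0); lra.
  rewrite cos0; case: (lerP (a - p) 0) => ha.
    have : 0 <= cos (a - p) + cos (b - p).
      have -> : a - p = (a + b) / 2 - p - (b - a) / 2 by field.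
      have -> : b - p = (a + b) / 2 - p + (b - a) / 2 by field.
      have u0 : - (pi / 2) <= (a + b) / 2 - p <= pi / 2 by apply/andP; split; lra.
      have v0 : - (pi / 2) <= (b - a) / 2 <= pi / 2 by apply/andP; split; lra.
      have := mulr_ge0 (cos_ge0_pihalf u0) (cos_ge0_pihalf v0).
      move: ((a + b) / 2 - p) ((b - a) / 2) => u v.
      by rewrite cosB cosD; lra.
    lra.
  by have := cos_geN1 (b - p); rewrite cos0; lra.
Qed.

Lemma unit_direction (x y : R) : x ^+ 2 + y ^+ 2 = 1 ->
  exists2 psi : R, - pi <= psi <= pi & x = sin psi /\ y = cos psi.
Proof.
move=> xy.
have y1 : -1 <= y <= 1.
  rewrite -ler_norml -ler_sqr ?nnegrE// expr1n real_normK ?num_real//.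
  by rewrite -xy lerDr sqr_ge0.
have a0 := acos_ge0 y1; have api := acos_lepi y1; have ca : cos (acos y) = y by apply: acosK.
have sa : sin (acos y) = `|x|.
  by rewrite sin_acos// -xy addrK sqrtr_sqr.
have [x0|x0] := leP 0 x.
  exists (acos y); first by rewrite api andbT; have := @pi_ge0 R; lra.
  by rewrite sa ca ger0_norm.
exists (- acos y); first by apply/andP; split; have := @pi_ge0 R; lra.
by rewrite sinN cosN sa ca ltr0_norm// opprK.
Qed.

(* The inner product with [V] itself is the norm. *)
Lemma norm_le1_directions (V : R * R) :
  (forall psi, - pi <= psi <= pi -> V.1 * sin psi + V.2 * cos psi <= 1) ->
  V.1 ^+ 2 + V.2 ^+ 2 <= 1.
Proof.
move=> H; have [->|V0] := eqVneq (V.1 ^+ 2 + V.2 ^+ 2) 0; first exact: ler01.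
set N := V.1 ^+ 2 + V.2 ^+ 2 in V0 *.
have N0 : 0 < N by rewrite lt_neqAle eq_sym V0 addr_ge0// sqr_ge0.
pose r := Num.sqrt N; have r0 : 0 < r by rewrite sqrtr_gt0.
have rr : r ^+ 2 = N by rewrite sqr_sqrtr// ltW.
have [|psi psipi [sx cx]] := @unit_direction (V.1 / r) (V.2 / r).
  by rewrite !expr_div_n -mulrDl rr divff.
have := H psi psipi; rewrite -sx -cx.
have -> : V.1 * (V.1 / r) + V.2 * (V.2 / r) = r.
  by rewrite -[RHS](mulfK (lt0r_neq0 r0)) -expr2 rr /N; field; rewrite gt_eqF.
by move=> r1; rewrite -rr expr_le1// ltW.
Qed.

(** The drops of the cosine are dominated by those of [k], which telescope; the last property of [k]
    absorbs the final cosine. In terms of vectors, an alternating sum of an odd number of unit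
    vectors with increasing directions in [0, pi] has component at most 1 in every direction. *)
Lemma alternating_cos_le1 (psi : R) (a : nat -> R) r : - pi <= psi <= pi ->
  0 <= a 0%N -> (forall l, (l < r.*2)%N -> a l <= a l.+1) -> a r.*2 <= pi ->
  \sum_(l < r) (cos (a l.*2 - psi) - cos (a l.*2.+1 - psi)) + cos (a r.*2 - psi) <= 1.
Proof.
move=> /negative_variation[k [k1 k2 _ k4]] a0 ainc api.
have mono i j : (i <= j <= r.*2)%N -> a i <= a j.
  move=> /andP[ij]; elim: j ij => [|j IH]; first by rewrite leqn0 => /eqP ->.
  rewrite leq_eqVlt => /orP[/eqP -> //|ij jm].
  by apply: le_trans (IH ij (ltnW jm)) (ainc _ _).
have a_ge0 i : (i <= r.*2)%N -> 0 <= a i by move=> ir; apply: le_trans a0 (mono _ _ _).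
have a_lepi i : (i <= r.*2)%N -> a i <= pi.
  by move=> ir; apply: le_trans api; apply: mono; rewrite ir leqnn.
have tel s : (s <= r)%N -> \sum_(l < s) (cos (a l.*2 - psi) - cos (a l.*2.+1 - psi))
    <= k (a 0%N) - k (a s.*2).
  elim: s => [_|s IH sr]; first by rewrite big_ord0 subrr.
  rewrite big_ord_recr/= ; have := IH (ltnW sr).
  have h1 : (s.*2.+1 <= r.*2)%N by lia.
  have h2 : (s.*2.+2 <= r.*2)%N by lia.
  have := k2 (a s.*2) (a s.*2.+1) (a_ge0 _ (ltnW h1)) (ainc _ h1) (a_lepi _ h1).
  have := k1 (a s.*2.+1) (a s.*2.+2) (a_ge0 _ h1) (ainc _ h2) (a_lepi _ h2).
  rewrite doubleS; lra.
have := tel r (leqnn r); have := k4 (a 0%N) (a r.*2) a0 (mono _ _ _) api.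
by rewrite leqnn => /(_ isT); lra.
Qed.

End AlternatingSums.

Section StarPolygon.
Variable R : realType.
Variables (m : nat) (phi : nat -> R).

(* Right half of the boundary of the star polygon with path directions [phi]:
   (- starX i, starY i) is the vertex number 2 * i of the unit-length path. *)
Definition starX i : R := \sum_(l < i) (sin (phi l.*2.+1) - sin (phi l.*2)).
Definition starY i : R := \sum_(l < i) (cos (phi l.*2) - cos (phi l.*2.+1)).

Hypothesis m0 : (0 < m)%N.
Hypothesis phi_ge0 : 0 <= phi 0%N.
Hypothesis phi_le : forall j, (j.+1 < m.*2)%N -> phi j <= phi j.+1.
Hypothesis phi_last : phi m.*2.-1 = pi.
Hypotheses (closX : starX m = 0) (closY : starY m = 1).

Let dX i := sin (phi i.*2.+1) - sin (phi i.*2).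
Let dY i := cos (phi i.*2) - cos (phi i.*2.+1).

Lemma starX0 : starX 0 = 0. Proof. exact: big_ord0. Qed.

Lemma starY0 : starY 0 = 0. Proof. exact: big_ord0. Qed.

Lemma starXS i : starX i.+1 = starX i + dX i.
Proof. by rewrite /starX big_ord_recr. Qed.

Lemma starYS i : starY i.+1 = starY i + dY i.
Proof. by rewrite /starY big_ord_recr. Qed.

Lemma le_phi i j : (i <= j < m.*2)%N -> phi i <= phi j.
Proof.
move=> /andP[ij]; elim: j ij => [|j IH]; first by rewrite leqn0 => /eqP ->.
rewrite leq_eqVlt => /orP[/eqP -> //|ij jm].
exact: le_trans (IH ij (ltnW jm)) (phi_le jm).
Qed.

Lemma phi_bounds j : (j < m.*2)%N -> 0 <= phi j /\ phi j <= pi.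
Proof.
move=> jm; split; first by apply: le_trans phi_ge0 (le_phi _); rewrite jm.
rewrite -phi_last; apply: le_phi; lia.
Qed.

Lemma starY_inc i : (i < m)%N -> phi i.*2 < phi i.*2.+1 -> starY i < starY i.+1.
Proof.
move=> im phi_i; rewrite starYS ltrDl subr_gt0.
have h1 : (i.*2 < m.*2)%N by lia.
have h2 : (i.*2.+1 < m.*2)%N by lia.
have [a0 a1] := phi_bounds h1; have [b0 b1] := phi_bounds h2.
by rewrite ltr_cos ?in_itv/= ?a0 ?a1 ?b0 ?b1.
Qed.

(** Edge [l] has length 2 sin ([h l]) and makes the angle [om l] with the horizontal axis; these
    angles increase within [0, pi]. *)
Lemma cross_edges i j : (i <= j < m)%N -> 0 <= dX i * dY j - dY i * dX j.
Proof.
move=> /andP[ij jm].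
pose om l := (phi l.*2 + phi l.*2.+1) / 2; pose h l := (phi l.*2.+1 - phi l.*2) / 2.
have dXE l : dX l = 2 * (sin (h l) * cos (om l)).
  rewrite /dX; have -> : phi l.*2.+1 = om l + h l by rewrite /om /h; field.
  have -> : phi l.*2 = om l - h l by rewrite /om /h; field.
  by move: (om l) (h l) => u v; rewrite sinB sinD; ring.
have dYE l : dY l = 2 * (sin (h l) * sin (om l)).
  rewrite /dY; have -> : phi l.*2.+1 = om l + h l by rewrite /om /h; field.
  have -> : phi l.*2 = om l - h l by rewrite /om /h; field.
  by move: (om l) (h l) => u v; rewrite cosB cosD; ring.
have -> : dX i * dY j - dY i * dX j = 4 * (sin (h i) * sin (h j) * sin (om j - om i)).
  by rewrite !dXE !dYE sinB; ring.
have i1 : (i.*2 < m.*2)%N by lia.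
have i2 : (i.*2.+1 < m.*2)%N by lia.
have j1 : (j.*2 < m.*2)%N by lia.
have j2 : (j.*2.+1 < m.*2)%N by lia.
have [a0 a1] := phi_bounds i1; have [b0 b1] := phi_bounds i2.
have [c0 c1] := phi_bounds j1; have [d0 d1] := phi_bounds j2.
have ei := phi_le i2; have ej := phi_le j2.
have ij1 : phi i.*2 <= phi j.*2 by apply: le_phi; clear - ij jm; lia.
have ij2 : phi i.*2.+1 <= phi j.*2.+1 by apply: le_phi; clear - ij jm; lia.
rewrite mulr_ge0// !mulr_ge0//; apply: sin_ge0_pi; rewrite /h/om; apply/andP; split; lra.
Qed.

Lemma star_edge_sum (u v : R) j k : (j <= k)%N ->
  u * (starY k - starY j) - v * (starX k - starX j)
  = \sum_(j <= l < k) (u * dY l - v * dX l).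
Proof.
move=> jk; rewrite -(subnKC jk); elim: (k - j)%N => [|d IH].
  by rewrite addn0 big_geq// !subrr !mulr0 subrr.
by rewrite addnS big_nat_recr ?leq_addr//= -IH starXS starYS; ring.
Qed.

Lemma star_convex i j : (i < m)%N -> (j <= m)%N ->
  0 <= (starX i.+1 - starX i) * (starY j - starY i)
     - (starY i.+1 - starY i) * (starX j - starX i).
Proof.
move=> im jm; rewrite starXS starYS addrAC subrr add0r addrAC subrr add0r.
have [ij|ji] := leqP i j.
  rewrite star_edge_sum// big_nat; apply: sumr_ge0 => l /andP[il lj].
  by apply: cross_edges; rewrite il; apply: leq_trans lj jm.
have -> : dX i * (starY j - starY i) - dY i * (starX j - starX i)
    = - (dX i * (starY i - starY j) - dY i * (starX i - starX j)) by ring.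
rewrite star_edge_sum ?(ltnW ji)// big_nat -sumrN; apply: sumr_ge0 => l /andP[jl li].
by rewrite opprB mulrC (mulrC (dX i)); apply: cross_edges; rewrite (ltnW li).
Qed.

(** The boundary runs from (0, 0) to (0, 1), so the abscissa of vertex [i] is the cross product of
    the parts before and after it, a double sum of edge cross products. *)
Lemma starX_ge0 i : (i <= m)%N -> 0 <= starX i.
Proof.
move=> im.
have -> : starX i = starX i * (starY m - starY i) - starY i * (starX m - starX i).
  by rewrite closX closY; ring.
rewrite star_edge_sum// big_nat; apply: sumr_ge0 => l /andP[il lm].
have -> : starX i * dY l - starY i * dX l
    = - (dX l * (starY i - starY 0) - dY l * (starX i - starX 0)).
  by rewrite starX0 starY0; ring.
rewrite star_edge_sum// big_nat -sumrN; apply: sumr_ge0 => k /andP[_ ki].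
rewrite opprB mulrC (mulrC (dX l)); apply: cross_edges.
by rewrite lm andbT; apply: leq_trans (ltnW ki) il.
Qed.

Hypothesis phi_sym : forall j, (j < m.*2.-1)%N -> phi (m.*2.-2 - j)%N = pi - phi j.

(** By the mirror symmetry of the directions, the right boundary consists of the odd-numbered path
    vertices: boundary vertex [i] is path vertex 2 q + 1. The case i = 0 says that the path returns
    to the origin before its last edge. *)
Lemma star_flip i q : (i + q = m.-1)%N ->
  starX i = - starX q + sin (phi q.*2) /\ starY i = starY q + cos (phi q.*2).
Proof.
clear phi_ge0 phi_le; elim: i q => [|i IH] q iq.
  have qm : m = q.+1 by lia.
  have pq : phi q.*2.+1 = pi by rewrite -phi_last qm; congr phi; lia.
  have := closX; have := closY; rewrite qm starXS starYS /dX /dY pq sinpi cospi => h1 h2.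
  by rewrite starX0 starY0; split; lra.
have [h1 h2] := IH q.+1 (eq_trans (addnS i q) iq).
have s1 : phi q.+1.*2 = pi - phi i.*2.
  by rewrite -phi_sym; [congr phi; lia|lia].
have s2 : phi q.*2.+1 = pi - phi i.*2.+1.
  by rewrite -phi_sym; [congr phi; lia|lia].
have e1 : sin (phi i.*2) = sin (phi q.+1.*2) by rewrite s1 sinB sinpi cospi; ring.
have e2 : sin (phi i.*2.+1) = sin (phi q.*2.+1) by rewrite s2 sinB sinpi cospi; ring.
have e3 : cos (phi i.*2) = - cos (phi q.+1.*2) by rewrite s1 cosB sinpi cospi; ring.
have e4 : cos (phi i.*2.+1) = - cos (phi q.*2.+1) by rewrite s2 cosB sinpi cospi; ring.
rewrite !starXS !starYS h1 h2 !starXS !starYS /dX /dY e1 e2 e3 e4; split; ring.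
Qed.

(* For two vertices on the same side, walk around the rest of the closed path. *)
Lemma star_same_side i j : (i <= j <= m)%N ->
  (starX i - starX j) ^+ 2 + (starY i - starY j) ^+ 2 <= 1.
Proof.
move=> /andP[ij jm].
have -> : (starX i - starX j) ^+ 2 = (starX j - starX i) ^+ 2 by ring.
apply: (@norm_le1_directions R (starX j - starX i, starY i - starY j)) => psi psipi /=.
have [k [k1 k2 k3 _]] := negative_variation psipi.
pose D l := cos (phi l.*2 - psi) - cos (phi l.*2.+1 - psi).
have DE l : - dX l * sin psi + dY l * cos psi = D l.
  by rewrite /D /dX /dY !cosB; ring.
have VD s t : (s <= t)%N ->
    - (starX t - starX s) * sin psi + (starY t - starY s) * cos psi = \sum_(s <= l < t) D l.
  move=> st; transitivity (cos psi * (starY t - starY s) - sin psi * (starX t - starX s)).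
    by ring.
  by rewrite star_edge_sum//; apply: eq_bigr => l _; rewrite -DE; ring.
pose E l := k (phi l.*2) - k (phi l.*2.+1).
have bnd l : (l < m)%N -> [/\ 0 <= phi l.*2, phi l.*2 <= phi l.*2.+1 & phi l.*2.+1 <= pi].
  move=> lm; have h1 : (l.*2 < m.*2)%N by rewrite ltn_double.
  have h2 : (l.*2.+1 < m.*2)%N by rewrite ltn_Sdouble.
  by split; [case: (phi_bounds h1)|exact: phi_le|case: (phi_bounds h2)].
have DlE l : (l < m)%N -> D l <= E l by move=> /bnd[? ? ?]; exact: k2.
have E0 l : (l < m)%N -> 0 <= E l by move=> /bnd[? ? ?]; rewrite subr_ge0; exact: k1.
have tel t : (0 < t <= m)%N -> \sum_(0 <= l < t) E l <= k 0 - k (phi t.*2.-1).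
  elim: t => [//|t IH] /andP[_ tm].
  rewrite big_nat_recr//=; case: (posnP t) => t0.
    rewrite t0 big_geq// add0r /E lerD2r; apply: k1 => //.
    have h0 : (0 < m.*2)%N by rewrite double_gt0.
    exact: (phi_bounds h0).2.
  have tm' : (0 < t <= m)%N by rewrite t0 ltnW.
  have := IH tm'.
  have h1 : (t.*2.-1 < m.*2)%N by clear - tm t0; lia.
  have h2 : (t.*2 < m.*2)%N by clear - tm t0; lia.
  have : k (phi t.*2) <= k (phi t.*2.-1).
    apply: k1; [exact: (phi_bounds h1).1| |exact: (phi_bounds h2).2].
    by apply: le_phi; clear - tm t0; lia.
  by rewrite /E; lra.
have := tel m; rewrite m0 leqnn phi_last => /(_ isT) telm.
have all : - (starX m - starX 0) * sin psi + (starY m - starY 0) * cos psi = cos psi.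
  by rewrite closX closY starX0 starY0; ring.
(* The component in question is the sum of [D] outside [i, j) minus cos psi. The sums of [D] are
   bounded by those of [E], whose total is at most 1 + cos psi. *)
have split3 : \sum_(0 <= l < m) E l
    = \sum_(0 <= l < i) E l + \sum_(i <= l < j) E l + \sum_(j <= l < m) E l.
  by rewrite -big_cat_nat//= -big_cat_nat//=; apply: leq_trans ij _.
have b1 : \sum_(0 <= l < i) D l <= \sum_(0 <= l < i) E l.
  rewrite !big_nat; apply: ler_sum => l /andP[_ li]; apply: DlE.
  by apply: leq_trans li _; apply: leq_trans ij jm.
have b2 : 0 <= \sum_(i <= l < j) E l.
  rewrite big_nat; apply: sumr_ge0 => l /andP[_ lj]; apply: E0; exact: leq_trans lj jm.
have b3 : \sum_(j <= l < m) D l <= \sum_(j <= l < m) E l.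
  by rewrite !big_nat; apply: ler_sum => l /andP[_ lm]; exact: DlE.
have e1 := VD 0%N i (leq0n i); have e2 := VD j m jm.
move: k3; rewrite sub0r cosN => k3.
rewrite closX closY in e2; rewrite starX0 starY0 in e1.
lra.
Qed.

(** By [star_flip] the vector joins path vertices 2 j and 2 q + 1, so it is, up to sign, an
    alternating sum of an odd number of consecutive unit steps; the two cases tell which of the two
    vertices comes first on the path. *)
Lemma star_opposite i j : (i <= m)%N -> (j <= m)%N ->
  (starX i + starX j) ^+ 2 + (starY i - starY j) ^+ 2 <= 1.
Proof.
move=> im' jm; have [im|mi] := ltnP i m; last first.
  have -> : i = m by clear - im' mi; lia.
  have := @star_same_side j m; rewrite jm leqnn => /(_ isT).
  by rewrite closX; congr (_ <= _); ring.
pose q := (m.-1 - i)%N; have iq : (i + q = m.-1)%N by rewrite /q; lia.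
have [xE yE] := star_flip iq.
apply: (@norm_le1_directions R (starX i + starX j, starY i - starY j)) => psi psipi /=.
rewrite xE yE.
pose D l := cos (phi l.*2 - psi) - cos (phi l.*2.+1 - psi).
have VD s t : (s <= t)%N ->
    - (starX t - starX s) * sin psi + (starY t - starY s) * cos psi = \sum_(s <= l < t) D l.
  move=> st; transitivity (cos psi * (starY t - starY s) - sin psi * (starX t - starX s)).
    by ring.
  by rewrite star_edge_sum//; apply: eq_bigr => l _; rewrite /D /dX /dY !cosB; ring.
have [jq|qj] := leqP j q.
  have -> : (- starX q + sin (phi q.*2) + starX j) * sin psi +
      (starY q + cos (phi q.*2) - starY j) * cos psi
      = \sum_(l < q - j) (cos (phi (j.*2 + l.*2)%N - psi) - cos (phi (j.*2 + l.*2.+1)%N - psi))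
        + cos (phi (j.*2 + (q - j).*2)%N - psi).
    have -> : (j.*2 + (q - j).*2 = q.*2)%N by clear - jq; lia.
    transitivity (\sum_(j <= l < q) D l + cos (phi q.*2 - psi)).
      by rewrite -VD// cosB; ring.
    congr (_ + _); rewrite -{1}[j]add0n big_addn big_mkord; apply: eq_bigr => l _.
    by rewrite /D doubleD addnC addnS.
  apply: (@alternating_cos_le1 R psi (fun l => phi (j.*2 + l)%N)) => //.
  - have h : (j.*2 < m.*2)%N by clear - jq iq im; lia.
    by rewrite addn0; exact: (phi_bounds h).1.
  - by move=> l lq; rewrite addnS; apply: phi_le; clear - jq iq im lq; lia.
  - have h : (j.*2 + (q - j).*2 < m.*2)%N by clear - jq iq im; lia.
    exact: (phi_bounds h).2.
pose g l := cos (phi l - psi).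
have reg r : \sum_(l < r) (g (q.*2.+1 + l.*2)%N - g (q.*2.+1 + l.*2.+1)%N) + g (q.*2.+1 + r.*2)%N
    = - \sum_(l < r.+1) D (q + l)%N + g q.*2.
  elim: r => [|r IHr].
    by rewrite big_ord0 big_ord1 /D /g !addn0; ring.
  rewrite big_ord_recr [in RHS]big_ord_recr/= opprD.
  have -> : D (q + r.+1)%N = g (q.*2.+1 + r.*2.+1)%N - g (q.*2.+1 + r.+1.*2)%N.
    by rewrite /D /g; congr (cos (phi _ - _) - cos (phi _ - _)); lia.
  by move: IHr; lra.
have -> : (- starX q + sin (phi q.*2) + starX j) * sin psi +
    (starY q + cos (phi q.*2) - starY j) * cos psi = - \sum_(l < (j - q.+1).+1) D (q + l)%N + g q.*2.
  transitivity (- \sum_(q <= l < j) D l + g q.*2).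
    by rewrite -VD ?(ltnW qj)// /g cosB; ring.
  congr (- _ + _); rewrite -{1}[q]add0n big_addn big_mkord.
  have -> : (j - q = (j - q.+1).+1)%N by clear - qj; lia.
  by apply: eq_bigr => l _; rewrite addnC.
rewrite -reg.
apply: (@alternating_cos_le1 R psi (fun l => phi (q.*2.+1 + l)%N)) => //.
- have h : (q.*2.+1 < m.*2)%N by clear - qj iq im jm; lia.
  by rewrite addn0; exact: (phi_bounds h).1.
- by move=> l lq; rewrite addnS; apply: phi_le; clear - qj iq im jm lq; lia.
- have h : (q.*2.+1 + (j - q.+1).*2 < m.*2)%N by clear - qj iq im jm; lia.
  exact: (phi_bounds h).2.
Qed.

End StarPolygon.

(** * The unit-length path and its moments *)

Section HalfPath.
Variable R : realType.
Variables (m : nat) (phi : nat -> R).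

Definition pathX k : R := \sum_(j < k) (-1) ^+ j * sin (phi j).
Definition pathY k : R := \sum_(j < k) (-1) ^+ j * cos (phi j).

Lemma pathXS k : pathX k.+1 = pathX k + (-1) ^+ k * sin (phi k).
Proof. by rewrite /pathX big_ord_recr. Qed.

Lemma pathYS k : pathY k.+1 = pathY k + (-1) ^+ k * cos (phi k).
Proof. by rewrite /pathY big_ord_recr. Qed.

Lemma path0 : pathX 0 = 0 /\ pathY 0 = 0.
Proof. by rewrite /pathX /pathY !big_ord0. Qed.

Lemma sign_double k : (-1) ^+ k.*2 = 1 :> R.
Proof. by rewrite -mul2n exprM sqrrN !expr1n. Qed.

Lemma path_even i : pathX i.*2 = - starX phi i /\ pathY i.*2 = starY phi i.
Proof.
elim: i => [|i [IHx IHy]]; first by rewrite starX0 starY0 oppr0; exact: path0.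
rewrite doubleS !pathXS !pathYS IHx IHy starXS starYS !exprS !sign_double; split; ring.
Qed.

Lemma path_odd i : pathX i.*2.+1 = - starX phi i + sin (phi i.*2) /\
  pathY i.*2.+1 = starY phi i + cos (phi i.*2).
Proof.
by have [h1 h2] := path_even i; rewrite pathXS pathYS h1 h2 sign_double !mul1r.
Qed.

Section Closure.
Hypothesis m0 : (0 < m)%N.
Hypothesis phi_last : phi m.*2.-1 = pi.
Hypothesis phi_sym : forall j, (j < m.*2.-1)%N -> phi (m.*2.-2 - j)%N = pi - phi j.
Hypothesis half_close : pathX m.-1 = (-1) ^+ m / 2.

(** The middle edge is horizontal and, by [half_close], centred on the axis; after it the path
    follows the mirror image of its first half backwards. *)
Lemma path_mirror j : (j < m)%N -> pathX (m + j)%N = - pathX (m.-1 - j)%N /\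
  pathY (m + j)%N = pathY (m.-1 - j)%N.
Proof.
elim: j => [_|j IH jm].
  have mid : phi m.-1 = pi / 2.
    have h : (m.-1 < m.*2.-1)%N by clear - m0; lia.
    have := phi_sym h; have -> : (m.*2.-2 - m.-1 = m.-1)%N by clear - m0; lia.
    by lra.
  rewrite addn0 subn0; have := pathXS m.-1; have := pathYS m.-1.
  rewrite !prednK// mid cos_pihalf sin_pihalf mulr0 addr0 mulr1 half_close => -> ->.
  have e : (-1) ^+ m = - (-1) ^+ m.-1 :> R by rewrite -[in LHS](prednK m0) exprS mulN1r.
  by split => //; rewrite e; field.
have [IHx IHy] := IH (ltnW jm).
have e : (m.-1 - j = (m.-1 - j.+1).+1)%N by clear - jm; lia.
rewrite addnS pathXS pathYS IHx IHy e pathXS pathYS.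
have h : (m.-1 - j.+1 < m.*2.-1)%N by clear - jm; lia.
have -> : phi (m + j)%N = pi - phi (m.-1 - j.+1)%N.
  by rewrite -phi_sym//; congr phi; clear - jm; lia.
have -> : (-1) ^+ (m + j)%N = (-1) ^+ (m.-1 - j.+1)%N :> R.
  have -> : (m + j = (m.-1 - j.+1) + j.+1.*2)%N by clear - jm; lia.
  by rewrite exprD sign_double mulr1.
by rewrite sinB cosB sinpi cospi; split; ring.
Qed.

Lemma half_path_closes : starX phi m = 0 /\ starY phi m = 1.
Proof.
have m1 : (m.-1 < m)%N by clear - m0; lia.
have [h1 h2] := path_mirror m1; rewrite subnn (path0).1 (path0).2 oppr0 in h1 h2.
have e1 : (m + m.-1)%N = m.*2.-1 by clear - m0; lia.
rewrite e1 in h1 h2.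
have [e3 e4] := path_even m.
have e2 : m.*2 = m.*2.-1.+1 by clear - m0; lia.
have := pathXS m.*2.-1; have := pathYS m.*2.-1.
rewrite -e2 h1 h2 phi_last sinpi cospi e3 e4.
have -> : (-1) ^+ m.*2.-1 = -1 :> R.
  have -> : m.*2.-1 = m.-1.*2.+1 by clear - m0; lia.
  by rewrite exprS sign_double mulr1.
by move=> -> /eqP; rewrite mulr0 addr0 oppr_eq0 => /eqP ->; split; ring.
Qed.

End Closure.

Section Area.
Variable c : R.

(* Moments of the edge from path vertex [j] about the point (0, c): with r and s the
   relative position of the vertex and the unit step leaving it, [armP j = - <r, s>]
   and [armC j = r x s]. *)
Definition armP j : R :=
  - ((-1) ^+ j * (pathX j * sin (phi j) + (pathY j - c) * cos (phi j))).
Definition armC j : R :=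
  (-1) ^+ j * (pathX j * cos (phi j) - (pathY j - c) * sin (phi j)).

(** Twice the signed area of the triangle with apex (0, c) on the polygon side joining path vertices
    j - 1 and j + 1; for j = 0, on the side joining (0, 1) to path vertex 1. *)
Definition edge_area j : R :=
  if j is k.+1 then sin (phi k.+1 - phi k) - armC k - armC k.+1 else sin (phi 0%N) - armC 0.

Lemma sqr_sign j : (-1) ^+ j * (-1) ^+ j = 1 :> R.
Proof. by rewrite -expr2 sqrr_sign. Qed.

Lemma armC_back j : armC j = armP j.+1 * sin (phi j.+1 - phi j) - armC j.+1 * cos (phi j.+1 - phi j).
Proof.
rewrite /armC /armP pathXS pathYS exprS sinB cosB.
move: (cos2Dsin2 (phi j.+1)) (sqr_sign j); set s' := sin (phi j.+1); set c' := cos (phi j.+1).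
set s := sin (phi j); set co := cos (phi j); set e := (-1) ^+ j; set x := pathX j; set y := pathY j.
move=> H E.
transitivity (e * (x * co - (y - c) * s) * (c' ^+ 2 + s' ^+ 2)); first by rewrite H mulr1.
by ring: E.
Qed.

Lemma armP_back j : armP j = 1 - armP j.+1 * cos (phi j.+1 - phi j) - armC j.+1 * sin (phi j.+1 - phi j).
Proof.
rewrite /armC /armP pathXS pathYS exprS sinB cosB.
move: (cos2Dsin2 (phi j.+1)) (cos2Dsin2 (phi j)) (sqr_sign j).
set s' := sin (phi j.+1); set c' := cos (phi j.+1).
set s := sin (phi j); set co := cos (phi j); set e := (-1) ^+ j; set x := pathX j; set y := pathY j.
move=> H1 H2 E.
transitivity (1 - (e * (x * s + (y - c) * co) + e * e * (co ^+ 2 + s ^+ 2)) * (c' ^+ 2 + s' ^+ 2)).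
  by rewrite H1 H2 E; ring.
by ring.
Qed.

Section StarArea.
Hypothesis m0 : (0 < m)%N.
Hypothesis phi_last : phi m.*2.-1 = pi.
Hypothesis phi_sym : forall j, (j < m.*2.-1)%N -> phi (m.*2.-2 - j)%N = pi - phi j.
Hypotheses (closX : starX phi m = 0) (closY : starY phi m = 1).

Let T i := starX phi i * (starY phi i.+1 - c) - starX phi i.+1 * (starY phi i - c).

Let T_odd i : T i = edge_area i.*2.+1.
Proof.
have [x0 y0] := path_even i; have [x1 y1] := path_odd i.
rewrite /T /edge_area /armC x0 y0 x1 y1 exprS sign_double starXS starYS sinB; ring.
Qed.

Let T_even i q : (i + q = m.-1)%N -> T i = edge_area q.*2.
Proof.
move=> iq; have [fx fy] := star_flip m0 phi_last closX closY phi_sym iq.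
case: q iq fx fy => [|q] iq fx fy.
  have -> : edge_area 0.*2 = sin (phi 0%N) - armC 0 by [].
  rewrite /T /armC; have -> : i.+1 = m by clear - iq m0; lia.
  by rewrite closX closY fx (path0).1 (path0).2 starX0; ring.
have iq' : (i.+1 + q = m.-1)%N by rewrite addSnnS.
have [gx gy] := star_flip m0 phi_last closX closY phi_sym iq'.
have [x0 y0] := path_even q.+1; have [x1 y1] := path_odd q.
have x2 := pathXS q.*2.+1; have y2 := pathYS q.*2.+1.
rewrite -doubleS in x2 y2.
have -> : edge_area q.+1.*2 = sin (phi q.+1.*2 - phi q.*2.+1) - armC q.*2.+1 - armC q.+1.*2 by [].
have sg1 : (-1) ^+ q.*2.+1 = -1 :> R by rewrite exprS sign_double mulr1.
rewrite sg1 in x2 y2.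
have ex : starX phi q.+1 = - pathX q.+1.*2 by rewrite x0; ring.
rewrite /T fx fy gx gy -x1 -y1 ex -y0 /armC sg1 sign_double x2 y2 sinB; ring.
Qed.

(** Shoelace formula about (0, c). Side [i] of the right boundary is the mirror image of side 2 i +
    1 of the path by [T_odd], and is itself an even-numbered side by [T_even]. Hence sides j and 2 m
    - 1 - j have equal terms, and the first m of them give the whole area. *)
Lemma star_area : sym_area m (starX phi) (starY phi) = \sum_(j < m) edge_area j.
Proof.
have -> : sym_area m (starX phi) (starY phi) = \sum_(i < m) T i.
  suff H k : sym_area k (starX phi) (starY phi) = \sum_(i < k) T i
      + starX phi k * starY phi k - 0 + c * (starX phi 0%N - starX phi k).
    by rewrite H closX starX0; ring.
  elim: k => [|k IH]; first by rewrite /sym_area !big_ord0 starX0; ring.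
  by rewrite /sym_area in IH *; rewrite !big_ord_recr/= IH /T; ring.
have sym j : (j < m.*2)%N -> edge_area (m.*2.-1 - j)%N = edge_area j.
  have [[i ->]|[i ->]] : (exists i, j = i.*2.+1) \/ (exists i, j = i.*2).
    by case E : (odd j); [left|right]; exists j./2; rewrite -[LHS]odd_double_half E.
  - move=> im; have iq : (i + (m.-1 - i) = m.-1)%N by clear - im; lia.
    by rewrite -T_odd (T_even iq); congr edge_area; clear - im; lia.
  - move=> im; have iq : ((m.-1 - i) + i = m.-1)%N by clear - im; lia.
    by rewrite -(T_even iq) T_odd; congr edge_area; clear - im; lia.
have fold : \sum_(j < m.*2) edge_area j = 2 * \sum_(j < m) edge_area j.
  rewrite -addnn big_split_ord/= mulr2n mulrDl mul1r; congr (_ + _).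
  rewrite (reindex_inj rev_ord_inj)/=; apply: eq_bigr => j _.
  rewrite -sym; last by have := ltn_ord j; clear; lia.
  by congr edge_area; have := ltn_ord j; clear; lia.
have both : \sum_(j < m.*2) edge_area j = 2 * \sum_(i < m) T i.
  have dbl (f : nat -> R) k : \sum_(j < k.*2) f j = \sum_(i < k) (f i.*2 + f i.*2.+1).
    by elim: k => [|k IH]; rewrite ?big_ord0// doubleS !big_ord_recr/= IH addrA.
  rewrite dbl big_split/= [X in X + _](reindex_inj rev_ord_inj)/= mulr2n mulrDl mul1r.
  congr (_ + _); apply: eq_bigr => i _; last by rewrite T_odd.
  by rewrite -(@T_even i)//; have := ltn_ord i; clear; lia.
by move: both; rewrite fold => /(mulfI _) ->//; rewrite pnatr_eq0.
Qed.

End StarArea.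

End Area.
End HalfPath.

(** * Star polygons from half of their directions *)

Section HalfStar.
Variable R : realType.
Variables (m : nat) (phi : nat -> R).
Hypothesis m1 : (1 < m)%N.
Hypothesis phi_ge0 : 0 <= phi 0%N.
Hypothesis phi_inc : forall j, (j.+1 < m)%N -> phi j < phi j.+1.
Hypothesis phi_mid : phi m.-1 = pi / 2.
Hypothesis half_close : pathX phi m.-1 = (-1) ^+ m / 2.

(** All 2 m directions: the half path, its reflection leading back to the origin, and the vertical
    edge from there to (0, 1). *)
Let ext j := if (j < m)%N then phi j
  else if (j < m.*2.-1)%N then pi - phi (m.*2.-2 - j)%N else pi.

Let m0 : (0 < m)%N := ltnW m1.

Let ext_lt j : (j < m)%N -> ext j = phi j.
Proof. by rewrite /ext => ->. Qed.

Let ext_ge j : (m <= j < m.*2.-1)%N -> ext j = pi - phi (m.*2.-2 - j)%N.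
Proof. by rewrite /ext leqNgt => /andP[/negbTE -> ->]. Qed.

Let ext_last : ext m.*2.-1 = pi.
Proof. by rewrite /ext ltnn; case: ifP => // h; exfalso; clear - h m1; lia. Qed.

Let ext_sym j : (j < m.*2.-1)%N -> ext (m.*2.-2 - j)%N = pi - ext j.
Proof.
move=> jm; case: (ltngtP j m.-1) => h.
- rewrite ext_ge; last by clear - h jm m1; lia.
  by rewrite ext_lt; [congr (_ - phi _)|]; clear - h jm m1; lia.
- rewrite [in RHS]ext_ge; last by clear - h jm m1; lia.
  by rewrite ext_lt; [ring|clear - h jm m1; lia].
- have -> : (m.*2.-2 - j = m.-1)%N by clear - h jm m1; lia.
  by rewrite h ext_lt ?phi_mid; [field|clear - m1; lia].
Qed.

Let ext_inc j : (j.+1 < m.*2.-1)%N -> ext j < ext j.+1.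
Proof.
move=> jm; case: (ltngtP j m.-1) => h.
- have h1 : (j.+1 < m)%N by clear - h m1; lia.
  by rewrite !ext_lt//; [exact: phi_inc|exact: ltnW].
- rewrite !ext_ge; try (clear - h jm m1; lia).
  rewrite ltrD2l ltrN2; have -> : (m.*2.-2 - j = (m.*2.-2 - j.+1).+1)%N by clear - jm; lia.
  by apply: phi_inc; clear - h jm m1; lia.
- rewrite h prednK// ext_lt; last by clear - m1; lia.
  rewrite ext_ge; last by clear - jm h m1; lia.
  have -> : (m.*2.-2 - m = m.-2)%N by clear - m1; lia.
  have := phi_inc (_ : m.-2.+1 < m)%N; have -> : (m.-2.+1 = m.-1)%N by clear - m1; lia.
  rewrite phi_mid => H; have := H (_ : m.-1 < m)%N; have -> : (m.-1 < m)%N by clear - m1; lia.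
  by move=> /(_ isT); lra.
Qed.

Let ext_lastbut : ext m.*2.-2 = pi - phi 0%N.
Proof.
rewrite ext_ge; last by clear - m1; lia.
by rewrite subnn.
Qed.

Let ext_le j : (j.+1 < m.*2)%N -> ext j <= ext j.+1.
Proof.
move=> jm; have [h|h] := ltnP j.+1 m.*2.-1; first exact/ltW/ext_inc.
have -> : j = m.*2.-2 by clear - h jm m1; lia.
have -> : m.*2.-2.+1 = m.*2.-1 by clear - m1; lia.
by rewrite ext_last ext_lastbut gerBl.
Qed.

Let ext0 : 0 <= ext 0%N.
Proof. by rewrite ext_lt. Qed.

Let path_ext k : (k <= m)%N -> pathX ext k = pathX phi k /\ pathY ext k = pathY phi k.
Proof.
move=> km; rewrite /pathX /pathY; split; apply: eq_bigr => j _;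
  by rewrite ext_lt//; apply: leq_trans (ltn_ord j) km.
Qed.

Let closes : starX ext m = 0 /\ starY ext m = 1.
Proof.
apply: half_path_closes => //; rewrite (path_ext _).1//; clear - m1; lia.
Qed.

Let edge_area_ext c j : (j < m)%N -> edge_area ext c j = edge_area phi c j.
Proof.
case: j => [|j] jm; rewrite /edge_area /armC !ext_lt//; try exact: ltnW.
  by rewrite (path_ext _).1// (path_ext _).2.
have j1 := ltnW jm; have j2 := ltnW j1.
by rewrite !(path_ext _).1// !(path_ext _).2.
Qed.

Let area_ext c : sym_area m (starX ext) (starY ext) = \sum_(j < m) edge_area phi c j.
Proof.
rewrite (star_area c m0 ext_last ext_sym closes.1 closes.2).
by apply: eq_bigr => j _; exact: edge_area_ext.
Qed.

Let starY_incr i : (i < m)%N -> (i < m.-1)%N || (0 < phi 0%N) -> starY ext i < starY ext i.+1.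
Proof.
move=> im h; apply: (starY_inc m0 ext0 ext_le ext_last) => //.
have [i1|i1] := ltnP i m.-1; first by apply: ext_inc; clear - i1; lia.
have -> : i.*2 = m.*2.-2 by clear - i1 im m1; lia.
have -> : m.*2.-2.+1 = m.*2.-1 by clear - m1; lia.
rewrite ext_last ext_lastbut gtrBl.
by move: h; rewrite ltnNge i1.
Qed.

Let vertex_star j : (j < m)%N -> exists2 i, (i < m)%N &
  (pathX phi j, pathY phi j) = (starX ext i, starY ext i) \/
  (pathX phi j, pathY phi j) = (- starX ext i, starY ext i).
Proof.
move=> jm; rewrite -(path_ext (ltnW jm)).1 -(path_ext (ltnW jm)).2.
have [[i ji]|[i ji]] : (exists i, j = i.*2.+1) \/ (exists i, j = i.*2).
  by case E : (odd j); [left|right]; exists j./2; rewrite -[LHS]odd_double_half E.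
  have iq : ((m.-1 - i) + i = m.-1)%N by clear - ji jm; lia.
  exists (m.-1 - i)%N; first by clear - m1; lia.
  left; have [-> ->] := star_flip m0 ext_last closes.1 closes.2 ext_sym iq.
  by have [h1 h2] := path_odd ext i; rewrite ji h1 h2.
exists i; first by clear - ji jm; lia.
by right; have [h1 h2] := path_even ext i; rewrite ji h1 h2.
Qed.

Lemma half_star_upper n (v : 'I_n -> R * R) c :
  (forall k, (exists2 j, (j < m)%N & v k = (pathX phi j, pathY phi j) \/
                                    v k = (- pathX phi j, pathY phi j))
             \/ v k = (0, 1)) ->
  area (convex_hull v) <= \sum_(j < m) edge_area phi c j.
Proof.
move=> vk; rewrite -area_ext.
have [cX cY] := closes.
have vstar k : exists2 i, (i <= m)%N & v k = (starX ext i, starY ext i) \/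
    v k = (- starX ext i, starY ext i).
  case: (vk k) => [[j jm]|->]; last by exists m; rewrite // cX cY; left.
  have [i im vi] := vertex_star jm; case=> ->; exists i; rewrite ?(ltnW im)//.
  by case: vi => -[-> ->]; [right|left; rewrite opprK].
(* When the first direction is vertical, the last two boundary vertices coincide; one is dropped so
   that the heights increase strictly. *)
pose m' := if 0 < phi 0%N then m else m.-1.
have m'm : (m' <= m)%N by rewrite /m'; case: ifP => // _; exact: leq_pred.
have m'0 : (0 < m')%N by rewrite /m'; case: ifP => // _; clear - m1; lia.
have degenerate : phi 0%N = 0 -> starX ext m.-1 = starX ext m /\ starY ext m.-1 = starY ext m.
  move=> p0; rewrite -{2 4}(prednK m0) starXS starYS.
  have -> : m.-1.*2 = m.*2.-2 by clear - m1; lia.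
  have -> : m.*2.-2.+1 = m.*2.-1 by clear - m1; lia.
  by rewrite ext_last ext_lastbut p0 subr0 !subrr !addr0.
have phi00 : 0 < phi 0%N = false -> phi 0%N = 0.
  by move=> h; apply/eqP; rewrite eq_le phi_ge0 leNgt h.
have -> : sym_area m (starX ext) (starY ext) = sym_area m' (starX ext) (starY ext).
  rewrite /m'; case: ifP => // /phi00/degenerate[eX eY].
  by rewrite -{1}(prednK m0) /sym_area big_ord_recr/= prednK// eY subrr mulr0 addr0.
apply: area_hull_le_sym => //.
- by move=> i im; apply: (starX_ge0 m0 ext0 ext_le ext_last cX cY); exact: leq_trans im m'm.
- move=> i im; apply: starY_incr; first exact: leq_trans im m'm.
  by move: im; rewrite /m'; case: ifP => _ h; rewrite ?orbT// h.
- move=> i j im jm; apply: (star_convex m0 ext0 ext_le ext_last).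
    exact: leq_trans im m'm.
  exact: leq_trans jm m'm.
- move=> k; have [i im vi] := vstar k.
  have [im'|m'i] := leqP i m'; first by exists i.
  move: m'i m'0; rewrite /m'; case: ifP => [_ h|/phi00/degenerate[eX eY] h _].
    by rewrite ltnNge im in h.
  have ei : i = m by clear - h im; lia.
  by exists m.-1 => //; rewrite eX eY -ei.
Qed.

Lemma half_star_lower c : 0 < phi 0%N -> exists2 v : 'I_m.*2 -> R * R,
  small v & \sum_(j < m) edge_area phi c j <= area (convex_hull v).
Proof.
move=> p0; have [cX cY] := closes.
(* The m + 1 vertices of the right boundary, two of them on the axis, and the mirror images of the m
   - 1 others. *)
pose v (k : 'I_m.*2) : R * R := if (k <= m)%N then (starX ext k, starY ext k)
  else (- starX ext (k - m)%N, starY ext (k - m)%N).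
have same := star_same_side m0 ext0 ext_le ext_last cX cY.
have opp := star_opposite m0 ext0 ext_le ext_last cX cY ext_sym.
have same' i j : (i <= m)%N -> (j <= m)%N ->
    (starX ext i - starX ext j) ^+ 2 + (starY ext i - starY ext j) ^+ 2 <= 1.
  move=> im jm; have [ij|/ltnW ji] := leqP i j; first by apply: same; rewrite ij.
  by have := same j i; rewrite ji im => /(_ isT); congr (_ <= _); ring.
exists v.
  move=> i j; rewrite /sqd /v; have im := ltn_ord i; have jm := ltn_ord j.
  case: ifPn => hi; case: ifPn => hj /=.
  - exact: same'.
  - by rewrite opprK; apply: opp => //; clear - jm; lia.
  - have : ((i - m)%N <= m)%N by clear - im; lia.
    by move=> h; have := opp _ _ h hj; congr (_ <= _); ring.
  - have : ((i - m)%N <= m)%N by clear - im; lia.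
    have : ((j - m)%N <= m)%N by clear - jm; lia.
    by move=> h1 h2; have := same' _ _ h2 h1; congr (_ <= _); ring.
rewrite -area_ext; apply: sym_le_area_hull.
- by move=> i; exact: (starX_ge0 m0 ext0 ext_le ext_last cX cY).
- by move=> i im; apply: starY_incr; rewrite // p0 orbT.
- move=> j jm; have jm2 : (j < m.*2)%N by clear - jm m1; lia.
  have hj : convex_hull v (starX ext j, starY ext j).
    by have := hull_vertex v (Ordinal jm2); rewrite /v /= jm.
  split => //; have [j0|j0] := posnP j.
    by move: hj; rewrite j0 starX0 oppr0.
  move: jm; rewrite leq_eqVlt => /orP[/eqP ej|jm']; first by move: hj; rewrite ej cX oppr0.
  have jm3 : (m + j < m.*2)%N by clear - jm'; lia.
  have := hull_vertex v (Ordinal jm3); rewrite /v /= addKn.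
  by have -> : (m + j <= m)%N = false by clear - j0; lia.
Qed.

End HalfStar.

Section Tail.
Variable R : realType.
Variables (m K : nat) (phi : nat -> R) (beta : R).
Hypothesis Km : (K < m)%N.
Hypothesis tailE : forall j, (K <= j < m)%N -> phi j = pi / 2 - (m.-1 - j)%:R * beta.
Hypothesis cb : cos (beta / 2) != 0.
Hypothesis tail_close :
  2 * cos (beta / 2) * pathX phi K + (-1) ^+ K * sin (phi K - beta / 2) = 0.

(* The tail vertices lie on the circle of radius 1 / (2 cos (beta / 2)) about (0, star_center). *)
Definition star_center : R := pathY phi K + (-1) ^+ K * cos (phi K - beta / 2) / (2 * cos (beta / 2)).

(** The stated pair is the fixed point of the moment recursion with turn [beta]. At vertex K it is
    attained because [tail_close] puts the centre of the circle on the axis. *)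
Lemma tail_arm j : (K <= j < m)%N -> armP phi star_center j = 1 / 2 /\
  armC phi star_center j = tan (beta / 2) / 2.
Proof.
move=> /andP[Kj jm]; rewrite -(subnKC Kj); move: (subnKC Kj) => jE.
have cs := cos2Dsin2 (beta / 2).
have dj : (K + (j - K) < m)%N by rewrite jE.
elim: (j - K)%N dj => [_|d IH dm].
  have xE : pathX phi K = - (-1) ^+ K * sin (phi K - beta / 2) / (2 * cos (beta / 2)).
    have c2 : 2 * cos (beta / 2) != 0 by rewrite mulf_neq0 ?pnatr_eq0.
    by apply: (mulfI c2); rewrite [RHS]mulrC divfK//; move: tail_close; lra.
  have yE : pathY phi K - star_center = - (-1) ^+ K * cos (phi K - beta / 2) / (2 * cos (beta / 2)).
    by rewrite /star_center; ring.
  have e2 := sqr_sign R K; have cs' := cos2Dsin2 (phi K).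
  rewrite addn0 /armP /armC xE yE sinB cosB /tan.
  move: cb e2 cs'; set e := (-1) ^+ K; set ch := cos (beta / 2); set sh := sin (beta / 2).
  set co := cos (phi K); set s := sin (phi K) => ch0 e2 cs'.
  split.
    transitivity (e * e * ((co ^+ 2 + s ^+ 2) * ch) / (2 * ch)); first by field.
    by rewrite e2 cs'; field.
  transitivity (e * e * ((co ^+ 2 + s ^+ 2) * sh) / (2 * ch)); first by field.
  by rewrite e2 cs'; field.
have dm' : (K + d < m)%N by clear - dm; lia.
have [P0 C0] := IH dm'; rewrite addnS.
have th : phi (K + d).+1 - phi (K + d) = beta.
  rewrite !tailE; try (clear - dm; lia).
  have -> : (m.-1 - (K + d) = (m.-1 - (K + d).+1).+1)%N by clear - dm; lia.
  by rewrite -[in X in _ - X]natr1; ring.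
have := armP_back phi star_center (K + d); have := armC_back phi star_center (K + d).
rewrite th P0 C0.
have -> : beta = beta / 2 + beta / 2 by field.
have -> : (beta / 2 + beta / 2) / 2 = beta / 2 by field.
rewrite sinD cosD /tan; move: cb cs.
set ch := cos (beta / 2); set sh := sin (beta / 2); set P := armP _ _ _; set C := armC _ _ _.
move=> ch0 cs hC hP.
have c2 : (ch * ch - sh * sh) ^+ 2 + (sh * ch + ch * sh) ^+ 2 = 1.
  by transitivity ((ch ^+ 2 + sh ^+ 2) ^+ 2); [ring|rewrite cs expr1n].
split.
  (* The recursion is solved for the later moments by inverting an orthogonal matrix of angle
     beta. *)
  transitivity (P * ((ch * ch - sh * sh) ^+ 2 + (sh * ch + ch * sh) ^+ 2)); first by rewrite c2 mulr1.
  transitivity ((1 - 1 / 2) * (ch * ch - sh * sh) + sh / ch / 2 * (sh * ch + ch * sh)).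
    by rewrite {1}hP hC; ring.
  transitivity ((ch ^+ 2 + sh ^+ 2) / 2); first by field.
  by rewrite cs.
transitivity (C * ((ch * ch - sh * sh) ^+ 2 + (sh * ch + ch * sh) ^+ 2)); first by rewrite c2 mulr1.
transitivity ((1 - 1 / 2) * (sh * ch + ch * sh) - sh / ch / 2 * (ch * ch - sh * sh)).
  by rewrite {1}hP hC; ring.
transitivity (sh / ch * (ch ^+ 2 + sh ^+ 2) / 2); first by field.
by rewrite cs mulr1.
Qed.

(** The direction at m - 1 is horizontal, so [armP] there is the abscissa up to sign. *)
Lemma tail_half_close : pathX phi m.-1 = (-1) ^+ m / 2.
Proof.
have m0 : (0 < m)%N by apply: leq_ltn_trans Km.
have h : (K <= m.-1 < m)%N by clear - Km; lia.
have [] := tail_arm h; rewrite /armP tailE// subnn mul0r subr0 sin_pihalf cos_pihalf mulr0 addr0 mulr1.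
have -> : (-1) ^+ m = - (-1) ^+ m.-1 :> R by rewrite -[in LHS](prednK m0) exprS mulN1r.
move=> H _; have E : (-1) ^+ m.-1 * pathX phi m.-1 = - (1 / 2) by rewrite -H opprK.
transitivity ((-1) ^+ m.-1 * (-1) ^+ m.-1 * pathX phi m.-1); first by rewrite sqr_sign mul1r.
by rewrite -mulrA E; field.
Qed.

End Tail.

(** * Expansion of the area *)

Section TrigBounds.
Variable R : realType.
Implicit Types x y z : R.

(** Mean value theorem; applied repeatedly, it yields each Taylor bound of sine and cosine from the
    preceding one. *)
Lemma nonneg_of_derive (f df : R -> R) : (forall x : R, is_derive x (1 : R) f (df x)) ->
  f 0 = 0 -> (forall x, 0 <= x -> 0 <= df x) -> forall x, 0 <= x -> 0 <= f x.
Proof.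
move=> fd f0 df0 x; rewrite le_eqVlt => /orP[/eqP <-|x0]; first by rewrite f0.
have cf : {within `[0, x], continuous f}.
  apply: continuous_subspaceT => y; apply: differentiable_continuous.
  by apply/derivable1_diffP; have := fd y; case.
have [c] := MVT x0 (fun y _ => fd y) cf.
rewrite in_itv/= f0 !subr0 => /andP[c0 _] ->.
by rewrite mulr_ge0 ?df0 ?ltW.
Qed.

Lemma sin_le x : 0 <= x -> sin x <= x :> R.
Proof.
move=> x0; rewrite -subr_ge0.
apply: (@nonneg_of_derive (fun x => x - sin x) (fun x => 1 - cos x)) => //.
by rewrite sin0 subr0.
Qed.

Lemma cos_ge x : 0 <= x -> 1 - x ^+ 2 / 2 <= cos x :> R.
Proof.
move=> x0; rewrite -subr_ge0.
apply: (@nonneg_of_derive (fun x => cos x - (1 - x ^+ 2 / 2)) (fun x => x - sin x)) => //.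
- by move=> y; apply: is_derive_eq; rewrite /GRing.scale/=; field.
- by rewrite cos0; ring.
- by move=> y y0; rewrite subr_ge0 sin_le.
Qed.

Lemma sin_ge x : 0 <= x -> x - x ^+ 3 / 6 <= sin x :> R.
Proof.
move=> x0; rewrite -subr_ge0.
apply: (@nonneg_of_derive (fun x => sin x - (x - x ^+ 3 / 6))
  (fun x => cos x - (1 - x ^+ 2 / 2))) => //.
- by move=> y; apply: is_derive_eq; rewrite /GRing.scale/=; field.
- by rewrite sin0; ring.
- by move=> y y0; rewrite subr_ge0 cos_ge.
Qed.

Lemma cos_le x : 0 <= x -> cos x <= 1 - x ^+ 2 / 2 + x ^+ 4 / 24 :> R.
Proof.
move=> x0; rewrite -subr_ge0.
apply: (@nonneg_of_derive (fun x => 1 - x ^+ 2 / 2 + x ^+ 4 / 24 - cos x)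
  (fun x => sin x - (x - x ^+ 3 / 6))) => //.
- by move=> y; apply: is_derive_eq; rewrite /GRing.scale/=; field.
- by rewrite cos0; ring.
- by move=> y y0; rewrite subr_ge0 sin_ge.
Qed.

Lemma sin_le5 x : 0 <= x -> sin x <= x - x ^+ 3 / 6 + x ^+ 5 / 120 :> R.
Proof.
move=> x0; rewrite -subr_ge0.
apply: (@nonneg_of_derive (fun x => x - x ^+ 3 / 6 + x ^+ 5 / 120 - sin x)
  (fun x => 1 - x ^+ 2 / 2 + x ^+ 4 / 24 - cos x)) => //.
- by move=> y; apply: is_derive_eq; rewrite /GRing.scale/=; field.
- by rewrite sin0; ring.
- by move=> y y0; rewrite subr_ge0 cos_le.
Qed.

Lemma norm_odd_bound (f : R -> R) (k : nat) : (forall x, f (- x) = - f x) \/ (forall x, f (- x) = f x) ->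
  (forall x, 0 <= x -> `|f x| <= x ^+ k) -> forall x, `|f x| <= `|x| ^+ k.
Proof.
move=> par H x; have [x0|x0] := leP 0 x; first by rewrite (ger0_norm x0) H.
have -> : `|f x| = `|f (- x)| by case: par => ->; rewrite ?normrN.
by rewrite (ltr0_norm x0) H// oppr_ge0 ltW.
Qed.

Lemma sin_bound1 x : `|sin x| <= `|x| ^+ 1 :> R.
Proof.
apply: norm_odd_bound; first by left => y; rewrite sinN.
move=> y y0; rewrite expr1 ler_norml; apply/andP; split; last exact: sin_le.
have [y1|y1] := leP y 1; last by have := sin_geN1 y; lra.
have := sin_ge y0; have : y ^+ 3 <= y.
  by rewrite exprSr -[leRHS]mul1r ler_wpM2r// expr_le1.
lra.
Qed.

Lemma sin_bound3 x : `|sin x - x| <= `|x| ^+ 3 :> R.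
Proof.
apply: (norm_odd_bound (f := fun x => sin x - x)); first by left => y; rewrite sinN; ring.
move=> y y0; have y3 : 0 <= y ^+ 3 by rewrite exprn_ge0.
by rewrite ler_norml; apply/andP; split; have := sin_le y0; have := sin_ge y0; lra.
Qed.

Lemma sin_bound5 x : `|sin x - x + x ^+ 3 / 6| <= `|x| ^+ 5 :> R.
Proof.
apply: (norm_odd_bound (f := fun x => sin x - x + x ^+ 3 / 6)).
  by left => y; rewrite sinN; ring.
move=> y y0; have y5 : 0 <= y ^+ 5 by rewrite exprn_ge0.
by rewrite ler_norml; apply/andP; split; have := sin_le5 y0; have := sin_ge y0; lra.
Qed.

Lemma cos_bound2 x : `|cos x - 1| <= `|x| ^+ 2 :> R.
Proof.
apply: (norm_odd_bound (f := fun x => cos x - 1)); first by right => y; rewrite cosN.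
move=> y y0; have y2 : 0 <= y ^+ 2 by rewrite exprn_ge0.
by rewrite ler_norml; apply/andP; split; have := cos_ge y0; have := cos_le1 y; lra.
Qed.

Lemma cos_bound4 x : `|cos x - 1 + x ^+ 2 / 2| <= `|x| ^+ 4 :> R.
Proof.
apply: (norm_odd_bound (f := fun x => cos x - 1 + x ^+ 2 / 2)).
  by right => y; rewrite cosN; ring.
move=> y y0; have y4 : 0 <= y ^+ 4 by rewrite exprn_ge0.
by rewrite ler_norml; apply/andP; split; have := cos_ge y0; have := cos_le y0; lra.
Qed.

Lemma asin_bound x : `|x| <= 1 -> `|asin x| <= 3 * `|x| :> R.
Proof.
move=> x1; have x1' : -1 <= x <= 1 by rewrite -ler_norml.
have a1 := asin_geNpi2 x1'; have a2 := asin_lepi2 x1'.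
have E : sin (asin x) = x by apply: asinK; rewrite in_itv.
have p2 := @pihalf_lt2 R.
rewrite -{2}E; move: (asin x) a1 a2 => y a1 a2.
(* On [0, 2] the cubic bound gives sin z >= z - z^3/6 >= z/3, and pi/2 < 2. *)
have pos (z : R) : 0 <= z -> z <= 2 -> z <= 3 * sin z.
  move=> z0 z2; have := sin_ge z0.
  have : z ^+ 3 <= 4 * z.
    have -> : z ^+ 3 = z ^+ 2 * z by ring.
    by rewrite ler_wpM2r//; nra.
  lra.
have [y0|y0] := leP 0 y.
  rewrite (ger0_norm y0) (le_trans (pos y y0 _)) ?ler_wpM2l ?ler_norm//; lra.
have ny0 : 0 <= - y by lra.
have ny2 : - y <= 2 by lra.
rewrite (ltr0_norm y0); apply: le_trans (pos _ ny0 ny2) _.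
by rewrite ler_wpM2l// sinN -normrN ler_norm.
Qed.

Lemma cos_ge_half x : `|x| <= 1 -> 1 / 2 <= cos x.
Proof.
move=> x1; have := cos_ge (normr_ge0 x); rewrite real_normK ?num_real//.
have -> : cos `|x| = cos x by case: ger0P => _; rewrite ?cosN.
have : x ^+ 2 <= 1 by rewrite -real_normK ?num_real// expr_le1.
by lra.
Qed.

Lemma cos_half_neq0 x : 0 <= x <= 1 -> cos (x / 2) != 0.
Proof.
move=> /andP[x0 x1]; have x2 : `|x / 2| <= 1 by rewrite ger0_norm; lra.
by have := cos_ge_half x2 => c2; rewrite gt_eqF//; lra.
Qed.

(** Multiplication by cos x >= 1/2 reduces the remainder to those of sine and cosine. *)
Lemma tan_bound x : `|x| <= 1 -> `|tan x - x - x ^+ 3 / 3| <= 5 * `|x| ^+ 5.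
Proof.
move=> x1; have c2 := cos_ge_half x1.
have c0 : 0 < cos x by lra.
have -> : tan x - x - x ^+ 3 / 3 = (cos x)^-1 *
    ((sin x - x + x ^+ 3 / 6) - (x + x ^+ 3 / 3) * (cos x - 1 + x ^+ 2 / 2) + x ^+ 5 / 6).
  by rewrite /tan; field; rewrite gt_eqF.
rewrite normrM ger0_norm ?invr_ge0 ?(ltW c0)//.
have -> : 5 * `|x| ^+ 5 = 2 * (5 / 2 * `|x| ^+ 5) by field.
apply: ler_pM => //; first by rewrite invr_ge0 ltW.
  by rewrite -[leRHS]invrK lef_pV2 ?posrE; lra.
have x0 := normr_ge0 x.
have h5 : `|x ^+ 5 / 6| <= `|x| ^+ 5 / 6 by rewrite normrM normrX (@ger0_norm _ (6^-1)).
have h3 : `|x + x ^+ 3 / 3| <= 4 / 3 * `|x|.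
  apply: le_trans (ler_normD _ _) _; rewrite normrM normrX (@ger0_norm _ (3^-1))//.
  have : `|x| ^+ 3 <= `|x| by rewrite exprS -[leRHS]mulr1 ler_wpM2l// expr_le1.
  lra.
have hM : `|(x + x ^+ 3 / 3) * (cos x - 1 + x ^+ 2 / 2)| <= 4 / 3 * `|x| ^+ 5.
  by rewrite normrM (exprS _ 4) mulrA ler_pM// cos_bound4.
apply: le_trans (ler_normD _ _) _.
have := ler_normB (sin x - x + x ^+ 3 / 6) ((x + x ^+ 3 / 3) * (cos x - 1 + x ^+ 2 / 2)).
have := sin_bound5 x; lra.
Qed.

Lemma inv_cos_bound x : `|x| <= 1 -> `|1 / (2 * cos x) - 1 / 2| <= `|x| ^+ 2.
Proof.
move=> x1; have c2 := cos_ge_half x1.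
have c0 : 0 < cos x by lra.
have -> : 1 / (2 * cos x) - 1 / 2 = - (2 * cos x)^-1 * (cos x - 1).
  by field; rewrite gt_eqF.
rewrite normrM normrN -[leRHS]mul1r ler_pM ?cos_bound2// ger0_norm ?invr_ge0 ?mulr_ge0 ?(ltW c0)//.
by rewrite -[leRHS]invr1 lef_pV2 ?posrE; lra.
Qed.

Lemma asin_sub_bound x : `|x| <= 1 -> `|asin x - x| <= 27 * `|x| ^+ 3.
Proof.
move=> x1; have E : sin (asin x) = x by apply: asinK; rewrite in_itv/= -ler_norml.
have := sin_bound3 (asin x); rewrite E -normrN opprB => h; apply: le_trans h _.
have -> : 27 * `|x| ^+ 3 = (3 * `|x|) ^+ 3 by ring.
by rewrite lerXn2r ?nnegrE ?mulr_ge0 ?asin_bound.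
Qed.

End TrigBounds.

(** * Uniform orders of magnitude *)

Section OrdO.
Variable R : realType.
Variables (I : Type) (D : I -> Prop) (b : I -> R).
Hypothesis b01 : forall i, D i -> 0 <= b i <= 1.
Implicit Types (E F : I -> R).

(** Big-O with one constant for the whole family: an index may carry a continuous parameter besides
    the number of vertices, as alpha for B_n. *)
Definition ordO k E := exists C, forall i, D i -> `|E i| <= C * b i ^+ k.

Lemma ordO_ge0 k E : ordO k E -> exists2 C, 0 <= C & forall i, D i -> `|E i| <= C * b i ^+ k.
Proof.
move=> [C HC]; exists `|C| => // i Di; apply: le_trans (HC i Di) _.
by rewrite ler_wpM2r ?ler_norm// exprn_ge0//; have /andP[] := b01 Di.
Qed.

Lemma ordO_ext k E F : (forall i, D i -> E i = F i) -> ordO k E -> ordO k F.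
Proof. by move=> EF [C HC]; exists C => i Di; rewrite -EF// HC. Qed.

Lemma ordO_le k E F : (forall i, D i -> `|F i| <= `|E i|) -> ordO k E -> ordO k F.
Proof. by move=> EF [C HC]; exists C => i Di; apply: le_trans (EF i Di) (HC i Di). Qed.

Lemma ordOD k E F : ordO k E -> ordO k F -> ordO k (fun i => E i + F i).
Proof.
move=> [C HC] [C' HC']; exists (C + C') => i Di; rewrite mulrDl.
by apply: le_trans (ler_normD _ _) _; rewrite lerD ?HC ?HC'.
Qed.

Lemma ordON k E : ordO k E -> ordO k (fun i => - E i).
Proof. by apply: ordO_le => i _; rewrite normrN. Qed.

Lemma ordOB k E F : ordO k E -> ordO k F -> ordO k (fun i => E i - F i).
Proof. by move=> hE hF; apply: ordOD hE (ordON hF). Qed.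

Lemma ordOM k l E F : ordO k E -> ordO l F -> ordO (k + l) (fun i => E i * F i).
Proof.
move=> /ordO_ge0[C C0 HC] /ordO_ge0[C' C'0 HC']; exists (C * C') => i Di.
by rewrite normrM exprD mulrACA ler_pM ?HC ?HC'.
Qed.

Lemma ordO_weak k l E : (k <= l)%N -> ordO l E -> ordO k E.
Proof.
move=> kl /ordO_ge0[C C0 HC]; exists C => i Di; apply: le_trans (HC i Di) _.
have /andP[b0 b1] := b01 Di; rewrite ler_wpM2l// -(subnKC kl) exprD.
by rewrite -[leRHS]mulr1 ler_wpM2l ?exprn_ge0// exprn_ile1.
Qed.

Lemma ordOMw n k l E F : (n <= k + l)%N -> ordO k E -> ordO l F -> ordO n (fun i => E i * F i).
Proof. by move=> nkl hE hF; apply: (ordO_weak nkl); apply: ordOM. Qed.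

Lemma ordO_cst (c : R) : ordO 0 (fun=> c).
Proof. by exists `|c| => i _; rewrite mulr1. Qed.

Lemma ordO_id : ordO 1 b.
Proof. by exists 1 => i Di; rewrite mul1r expr1 ger0_norm//; have /andP[] := b01 Di. Qed.

Lemma ordOX k E n : ordO k E -> ordO (n * k) (fun i => E i ^+ n).
Proof.
move=> hE; elim: n => [|n IH]; first by apply: ordO_ext (ordO_cst 1).
by rewrite mulSn; apply: ordO_ext (ordOM hE IH) => i _; rewrite exprS.
Qed.

Lemma ordO_comp k l E F : (forall i, D i -> `|F i| <= `|E i| ^+ l) -> ordO k E -> ordO (l * k) F.
Proof.
move=> FE hE; apply: ordO_le (ordOX l hE) => i Di.
by rewrite normrX FE.
Qed.

Lemma ordO_sum k n (E : 'I_n -> I -> R) : (forall j, ordO k (E j)) ->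
  ordO k (fun i => \sum_(j < n) E j i).
Proof.
elim: n E => [|n IH] E hE.
  by exists 0 => i _; rewrite big_ord0 normr0 mul0r.
apply: ordO_ext (ordOD (IH _ (fun j => hE (widen_ord (leqnSn n) j))) (hE ord_max)) => i _.
by rewrite big_ord_recr.
Qed.

End OrdO.

(** * Paths with a free head and an equally spaced tail *)

Section Direction.
Variables (R : realType) (K m : nat) (g : nat -> R) (b : R).

(* Direction 1 is chosen so that the path closes up; the directions from [K] on have
   constant step [b]. *)
Definition closing_sin : R :=
  pathX (fun j => if j == 1%N then 0 else g j * b) K
  + (-1) ^+ K * (sin (g K * b - b / 2) / (2 * cos (b / 2))).

Definition direction j : R :=
  if j == 1%N then asin closing_sin
  else if (j <= K)%N then g j * b else pi / 2 - (m.-1 - j)%:R * b.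

Hypothesis K1 : (1 < K)%N.
Hypothesis Km : (K < m)%N.
Hypothesis gK : g K * b = pi / 2 - (m.-1 - K)%:R * b.
Hypothesis cb : cos (b / 2) != 0.
Hypothesis closing_le1 : `|closing_sin| <= 1.

Lemma direction_tail j : (K <= j < m)%N -> direction j = pi / 2 - (m.-1 - j)%:R * b.
Proof.
move=> /andP[Kj jm]; rewrite /direction gtn_eqF ?(leq_trans K1 Kj)//.
case: leqP => // jK; have -> : j = K by apply/eqP; rewrite eqn_leq jK.
exact: gK.
Qed.

Lemma direction_close :
  2 * cos (b / 2) * pathX direction K + (-1) ^+ K * sin (direction K - b / 2) = 0.
Proof.
have -> : direction K = g K * b by rewrite /direction gtn_eqF// leqnn.
have s1 : sin (direction 1) = closing_sin.
  by rewrite /direction/= asinK// in_itv/= -ler_norml.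
have E k : (k.+2 <= K)%N ->
    pathX direction k.+2 = pathX (fun j => if j == 1%N then 0 else g j * b) k.+2 - closing_sin.
  elim: k => [_|k IH kK].
    by rewrite !pathXS s1 /direction/= sin0 !(path0 _).1; ring.
  by rewrite pathXS IH 1?ltnW// [in RHS]pathXS {1}/direction/= (ltnW kK); ring.
have := E (K - 2)%N; rewrite -addn2 subnK// => -> //; rewrite /closing_sin.
by field.
Qed.

Lemma direction_inc j : 0 < b -> g 0%N * b < direction 1 -> direction 1 < g 2 * b ->
  (forall l, (2 <= l < K)%N -> g l < g l.+1) ->
  (j.+1 < m)%N -> direction j < direction j.+1.
Proof.
move=> b0 d01 d12 g_inc jm; have [Kj|jK] := leqP K j.
  rewrite !direction_tail ?Kj ?(leqW Kj) ?(ltnW jm)//.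
  rewrite ltrD2l ltrN2 ltr_pM2r// ltr_nat; clear - jm; lia.
have dE l : l != 1%N -> (l <= K)%N -> direction l = g l * b.
  by rewrite /direction => /negPf -> ->.
case: j jm jK => [|[|j]] jm jK; first by rewrite dE.
  by rewrite (dE 2%N).
by rewrite !dE ?(ltnW jK)// ltr_pM2r// g_inc.
Qed.

Lemma direction_mid : direction m.-1 = pi / 2.
Proof.
rewrite direction_tail ?subnn ?mul0r ?subr0//.
by clear - Km; lia.
Qed.

(** The backward recursion for ([armP], [armC]), started from the constant values on the tail, for
    arbitrary turns [Th]. *)
Fixpoint arms (Th : nat -> R) k : R * R :=
  if k is k'.+1 then
    (1 - (arms Th k').1 * cos (Th k') - (arms Th k').2 * sin (Th k'),
     (arms Th k').1 * sin (Th k') - (arms Th k').2 * cos (Th k'))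
  else (1 / 2, tan (b / 2) / 2).

(* [turn k] is the turn at path index [K - k]. *)
Definition turn k : R :=
  if k == K then direction 0 else direction (K - k)%N - direction (K - k.+1)%N.

(** In this form of the triangle term, an error O(b^4) requires the first moment only up to O(b^3)
    and the second only up to O(b^2). *)
Definition arm_area k : R := (arms turn k.+1).1 * sin (turn k)
  - (arms turn k.+1).2 * (1 - cos (turn k)).

Lemma arms_turn k : (k <= K)%N ->
  arms turn k = (armP direction (star_center K direction b) (K - k)%N,
                 armC direction (star_center K direction b) (K - k)%N).
Proof.
elim: k => [_|k IH kK].
  have [|h1 h2] := tail_arm direction_tail cb direction_close (j := K).
    by rewrite leqnn.
  by rewrite subn0 h1 h2.
rewrite /= IH 1?ltnW// /turn ltn_eqF//=.
have E : (K - k = (K - k.+1).+1)%N by clear - kK; lia.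
by rewrite E -armP_back -armC_back.
Qed.

Lemma arm_areaE k : arm_area k = sin (turn k) - (arms turn k).2 - (arms turn k.+1).2.
Proof.
rewrite /arm_area /=; have := cos2Dsin2 (turn k).
move: (arms turn k).1 (arms turn k).2 => p c.
set s := sin _; set co := cos _ => H.
transitivity (s - c * (co ^+ 2 + s ^+ 2) - (p * s - c * co)); first by ring.
by rewrite H mulr1.
Qed.

(** On the tail the moments and the turn are constant, so its m - 1 - K terms are all equal; the
    others are listed backwards from K. *)
Lemma direction_area : \sum_(j < m) edge_area direction (star_center K direction b) j =
  \sum_(k < K.+1) arm_area k + (m.-1 - K)%:R * (sin b - tan (b / 2)).
Proof.
have mE : m = (K.+1 + (m.-1 - K))%N by clear - Km; lia.
have -> (F : nat -> R) : \sum_(j < m) F j =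
    \sum_(j < K.+1) F j + \sum_(j < m.-1 - K) F (K.+1 + j)%N.
  by rewrite [in LHS]mE big_split_ord.
congr (_ + _); last first.
  rewrite (eq_bigr (fun=> sin b - tan (b / 2))) => [|i _].
    by rewrite sumr_const card_ord mulr_natl.
  have im : (K + i < m.-1)%N by have := ltn_ord i; clear - Km; lia.
  have h1 : (K <= K + i < m)%N by clear - im; lia.
  have h2 : (K <= (K + i).+1 < m)%N by clear - im; lia.
  rewrite addSn /=.
  have [_ ->] := tail_arm direction_tail cb direction_close h1.
  have [_ ->] := tail_arm direction_tail cb direction_close h2.
  rewrite !direction_tail//.
  have -> : (m.-1 - (K + i) = (m.-1 - (K + i).+1).+1)%N by clear - im; lia.
  rewrite -(natr1 (m.-1 - (K + i).+1)); have -> (x y : R) : x - y * b - (x - (y + 1) * b) = b by ring.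
  by field.
rewrite (reindex_inj rev_ord_inj)/=; apply: eq_bigr => k _.
have kK := ltn_ord k; rewrite subSS arm_areaE.
have [kK'|Kk] := ltnP k K.
  have E : (K - k = (K - k.+1).+1)%N by clear - kK'; lia.
  by rewrite !arms_turn ?(ltnW kK')// /turn ltn_eqF//= [in LHS]E /= -E; ring.
have kE : k = K :> nat by apply/eqP; rewrite eqn_leq Kk -ltnS kK.
rewrite kE subnn /= arms_turn// subnn /turn eqxx /armP /armC /= !(path0 _).1 !(path0 _).2.
by ring.
Qed.

End Direction.

Section AreaExpansion.
Variable R : realType.

(** For turns [t k * b] to first order, [arms] is (1/2 + [arm_curv] b^2, [arm_slope] b / 2) to
    leading orders. *)
Fixpoint arm_slope (t : nat -> R) k : R :=
  if k is k'.+1 then t k' - arm_slope t k' else 1 / 2.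

Fixpoint arm_curv (t : nat -> R) k : R :=
  if k is k'.+1 then - arm_curv t k' + (arm_slope t k ^+ 2 - arm_slope t k' ^+ 2) / 4 else 0.

Definition arm_defect (t : nat -> R) k : R :=
  arm_curv t k.+1 * t k - t k ^+ 3 / 12 - arm_slope t k.+1 * t k ^+ 2 / 4.

(** Coefficient of b in [closing_sin], hence in direction 1. *)
Definition head_slope K (g : nat -> R) : R :=
  \sum_(j < K) (-1) ^+ j * (if j == 1%N :> nat then 0 else g j) + (-1) ^+ K * (g K - 1 / 2) / 2.

Definition slope K (g : nat -> R) j : R := if j == 1%N then head_slope K g else g j.

Definition turn_slope K (g : nat -> R) k : R :=
  if k == K then slope K g 0 else slope K g (K - k)%N - slope K g (K - k.+1)%N.

Variables (I : Type) (D : I -> Prop) (b : I -> R).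
Hypothesis b01 : forall i, D i -> 0 <= b i <= 1.
Local Notation ordO := (ordO D b).

Let hb : ordO 1 b := ordO_id b01.

Lemma ordO_sin E : ordO 1 E -> ordO 1 (fun i => sin (E i)) /\ ordO 3 (fun i => sin (E i) - E i).
Proof.
move=> hE; split.
  by apply: (ordO_comp (l := 1) b01 _ hE) => i _; exact: sin_bound1.
by apply: (ordO_comp (l := 3) b01 _ hE) => i _; exact: sin_bound3.
Qed.

Lemma ordO_cos E : ordO 1 E -> ordO 2 (fun i => cos (E i) - 1) /\
  ordO 4 (fun i => cos (E i) - 1 + E i ^+ 2 / 2).
Proof.
move=> hE; split.
  by apply: (ordO_comp (l := 2) b01 _ hE) => i _; exact: cos_bound2.
by apply: (ordO_comp (l := 4) b01 _ hE) => i _; exact: cos_bound4.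
Qed.

Lemma ordOZ k c E : ordO k E -> ordO k (fun i => c * E i).
Proof. by move=> hE; apply: (ordOMw b01 (k := 0) (leqnn _) (ordO_cst D b c) hE). Qed.

Lemma ordO_half_b : ordO 1 (fun i => b i / 2).
Proof. by apply: ordO_ext (ordOZ (1 / 2) hb) => i _; field. Qed.

Lemma ordO_tan_half : ordO 5 (fun i => tan (b i / 2) - b i / 2 - b i ^+ 3 / 24).
Proof.
have := ordOZ 5 (ordOX b01 5 ordO_half_b); apply: ordO_le => i Di.
have -> : tan (b i / 2) - b i / 2 - b i ^+ 3 / 24 =
  tan (b i / 2) - b i / 2 - (b i / 2) ^+ 3 / 3 by field.
have /andP[b0 b1] := b01 Di; have b2 : `|b i / 2| <= 1.
  by rewrite ger0_norm; lra.
by rewrite normrM normrX (@ger0_norm _ 5)// tan_bound.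
Qed.

Variables t Th : I -> nat -> R.
Hypothesis t_bounded : forall k, ordO 0 (fun i => t i k).
Hypothesis ThE : forall k, ordO 2 (fun i => Th i k - t i k * b i).

Let slope_bounded k : ordO 0 (fun i => arm_slope (t i) k).
Proof. by elim: k => [|k IH]; [exact: ordO_cst|exact: ordOB]. Qed.

Let curv_bounded k : ordO 0 (fun i => arm_curv (t i) k).
Proof.
elim: k => [|k IH]; first exact: ordO_cst.
apply: ordOD (ordON IH) _; apply: (ordOMw b01 (k := 0) (l := 0)) (ordO_cst D b (4^-1)) => //.
by apply: ordOB; apply: (ordOX b01 2 (slope_bounded _)).
Qed.

Let tb k : ordO 1 (fun i => t i k * b i).
Proof. exact: (ordOMw b01 (k := 0) (l := 1)). Qed.

Let Th1 k : ordO 1 (fun i => Th i k).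
Proof.
apply: ordO_ext (ordOD (ordO_weak b01 (leqnSn 1) (ThE k)) (tb k)) => i _; ring.
Qed.

Let Th2 k : ordO 3 (fun i => Th i k ^+ 2 - (t i k * b i) ^+ 2).
Proof.
apply: ordO_ext (ordOMw b01 (n := 3) _ (ThE k) (ordOD (Th1 k) (tb k))) => // i _; ring.
Qed.

Let Th3 k : ordO 4 (fun i => Th i k ^+ 3 - (t i k * b i) ^+ 3).
Proof.
apply: ordO_ext (ordOD (ordOMw b01 (n := 4) _ (Th2 k) (Th1 k))
  (ordOMw b01 (n := 4) _ (ordOX b01 2 (tb k)) (ThE k))) => // i _; ring.
Qed.

Lemma arms_expansion k :
  ordO 3 (fun i => (arms (b i) (Th i) k).1 - 1 / 2 - arm_curv (t i) k * b i ^+ 2) /\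
  ordO 2 (fun i => (arms (b i) (Th i) k).2 - arm_slope (t i) k * b i / 2).
Proof.
elim: k => [|k [hP hC]].
  split; first by apply: ordO_ext (ordOZ 0 (ordOX b01 3 hb)) => i _ /=; ring.
  by apply: ordO_ext (ordOD (ordOZ (1 / 2) (ordO_weak b01 (isT : 2 <= 5)%N ordO_tan_half))
     (ordOZ (1 / 48) (ordO_weak b01 (isT : 2 <= 3)%N (ordOX b01 3 hb)))) => i _ /=; field.
have [hs hs3] := ordO_sin (Th1 k); have [hc hc4] := ordO_cos (Th1 k).
have hc1 := ordOD (ordO_weak b01 (isT : (0 <= 2)%N) hc) (ordO_cst D b 1).
have hw := ordOMw b01 (leqnn _) (curv_bounded k) (ordOX b01 2 hb).
have he := ordOMw b01 (leqnn _) (slope_bounded k) hb.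
split.
- have T1 := ordON (ordOMw b01 (isT : (3 <= 3 + 0)%N) hP hc1).
  have T2 := ordON (ordOMw b01 (isT : (3 <= 2 + 2)%N) hw hc).
  have T3 := ordOZ (- (1 / 2)) (ordO_weak b01 (isT : (3 <= 4)%N) hc4).
  have T4 := ordOZ (1 / 4) (Th2 k).
  have T5 := ordON (ordOMw b01 (isT : (3 <= 2 + 1)%N) hC hs).
  have T6 := ordOZ (- (1 / 2)) (ordOMw b01 (isT : (3 <= 1 + 3)%N) he hs3).
  have T7 := ordOZ (- (1 / 2)) (ordOMw b01 (isT : (3 <= 1 + 2)%N) he (ThE k)).
  apply: ordO_ext (ordOD (ordOD (ordOD T1 T2) (ordOD T3 T4)) (ordOD T5 (ordOD T6 T7))) => i _ /=.
  by field.
- have T1 := ordOMw b01 (isT : (2 <= 2 + 1)%N) hw hs.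
  have T2 := ordOMw b01 (isT : (2 <= 3 + 1)%N) hP hs.
  have T3 := ordOZ (1 / 2) (ordO_weak b01 (isT : (2 <= 3)%N) hs3).
  have T4 := ordOZ (1 / 2) (ThE k).
  have T5 := ordON (ordOMw b01 (isT : (2 <= 2 + 0)%N) hC hc1).
  have T6 := ordOZ (- (1 / 2)) (ordOMw b01 (isT : (2 <= 1 + 2)%N) he hc).
  apply: ordO_ext (ordOD (ordOD (ordOD T1 T2) (ordOD T3 T4)) (ordOD T5 T6)) => i _ /=.
  by field.
Qed.

(** The turn is known only up to O(b^2), so its linear contribution [Th i k / 2] is kept exact; it
    disappears in the sum, where the turns telescope to a known angle. *)
Lemma arm_area_expansion k :
  ordO 4 (fun i => (arms (b i) (Th i) k.+1).1 * sin (Th i k)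
    - (arms (b i) (Th i) k.+1).2 * (1 - cos (Th i k))
    - (Th i k / 2 + b i ^+ 3 * arm_defect (t i) k)).
Proof.
have [hP hC] := arms_expansion k.+1.
have [hs hs3] := ordO_sin (Th1 k); have [hc hc4] := ordO_cos (Th1 k).
have hw := ordOMw b01 (leqnn _) (curv_bounded k.+1) (ordOX b01 2 hb).
have he := ordOMw b01 (leqnn _) (slope_bounded k.+1) hb.
have hs5 : ordO 5 (fun i => sin (Th i k) - Th i k + Th i k ^+ 3 / 6).
  by apply: (ordO_comp (l := 5) b01 _ (Th1 k)) => i _; exact: sin_bound5.
have T1 := ordOMw b01 (isT : (4 <= 3 + 1)%N) hP hs.
have T2 := ordOMw b01 (isT : (4 <= 2 + 3)%N) hw hs3.
have T3 := ordOMw b01 (isT : (4 <= 2 + 2)%N) hw (ThE k).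
have T4 := ordOZ (1 / 2) (ordO_weak b01 (isT : (4 <= 5)%N) hs5).
have T5 := ordOZ (- (1 / 12)) (Th3 k).
have T6 := ordOMw b01 (isT : (4 <= 2 + 2)%N) hC hc.
have T7 := ordOZ (1 / 2) (ordOMw b01 (isT : (4 <= 1 + 4)%N) he hc4).
have T8 := ordOZ (- (1 / 4)) (ordOMw b01 (isT : (4 <= 1 + 3)%N) he (Th2 k)).
apply: ordO_ext (ordOD (ordOD (ordOD T1 T2) (ordOD T3 T4)) (ordOD (ordOD T5 T6) (ordOD T7 T8))) => i _.
rewrite /arm_defect; move: (arms _ _ _).1 (arms _ _ _).2 (sin _) (cos _) => p c s co.
by move: (arm_slope _ _) (arm_curv _ _) => e w; field.
Qed.

Lemma arm_defect_bounded k : ordO 0 (fun i => arm_defect (t i) k).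
Proof.
apply: ordOB; first apply: ordOB; first by apply: (ordOMw b01 (k := 0) (l := 0)) (curv_bounded _) _.
  apply: ordO_ext (ordOZ (12^-1) (ordOX b01 3 (t_bounded k))) => i _; exact: mulrC.
apply: ordO_ext (ordOZ (4^-1) (ordOMw b01 (isT : (0 <= 0 + 0)%N) (slope_bounded k.+1)
  (ordOX b01 2 (t_bounded k)))) => i _; exact: mulrC.
Qed.

End AreaExpansion.

Section UpperArea.
Variable R : realType.

Lemma upper_area_expansion n : (4 <= n)%N ->
  `|upper_area R n - (pi / 4 - 5 * pi / 48 * (pi / n%:R) ^+ 2 - (pi / n%:R) ^+ 3 / 24)|
  <= 20 * (pi / n%:R) ^+ 4.
Proof.
move=> n4; have n0 : 4 <= n%:R :> R by rewrite ler_nat.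
have p0 := pi_gt0 R; have p2 := pi_ge2 R; have p4 := @pihalf_lt2 R.
pose x : R := pi / n%:R; pose y : R := pi / (2 * n%:R - 2).
have nx : n%:R * x = pi by rewrite /x mulrC divfK// gt_eqF//; lra.
have ny : (n%:R - 1) * y = pi / 2 by rewrite /y; field; rewrite gt_eqF//; lra.
have x0 : 0 < x by rewrite divr_gt0//; lra.
have y0 : 0 < y by rewrite divr_gt0//; lra.
have x1 : x <= 1 by rewrite ler_pdivrMr; lra.
have yx : y <= x by rewrite ler_pdivrMr ?mulrBr; lra.
(* The cubic term comes from n - 1 in place of n and produces the term - x^3/24 of the expansion. *)
have y2 : y ^+ 2 = x ^+ 2 / 4 + x ^+ 3 / (2 * pi) + x ^+ 2 * y * (x + y) / pi ^+ 2.
  by rewrite /x /y; field; rewrite ?gt_eqF//; lra.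
have xx : `|n%:R / 2 * (sin x - x + x ^+ 3 / 6)| <= 2 * x ^+ 4.
  have -> : 2 * x ^+ 4 = n%:R / 2 * (4 / pi * x ^+ 5).
    by rewrite -nx; field; rewrite !gt_eqF//; lra.
  rewrite normrM (@ger0_norm _ (n%:R / 2)) ?divr_ge0// ler_wpM2l ?divr_ge0//.
  have := sin_bound5 x; rewrite (gtr0_norm x0) => /le_trans; apply.
  rewrite -[leLHS]mul1r ler_wpM2r ?exprn_ge0 ?(ltW x0)// ler_pdivlMr//; lra.
have yy : `|(n%:R - 1) / 2 * (tan y - y - y ^+ 3 / 3)| <= 5 * x ^+ 4.
  have h : (n%:R - 1) / 2 * (5 * y ^+ 5) <= 5 * x ^+ 4.
    have -> : (n%:R - 1) / 2 * (5 * y ^+ 5) = 5 * pi / 4 * y ^+ 4.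
      by transitivity (5 / 2 * ((n%:R - 1) * y) * y ^+ 4); [field|rewrite ny; field].
    apply: ler_pM; [lra|by rewrite exprn_ge0 ?(ltW y0)|lra|].
    by rewrite lerXn2r ?nnegrE ?(ltW x0) ?(ltW y0).
  apply: le_trans h; rewrite normrM ger0_norm ?ler_wpM2l//; try lra.
  have := @tan_bound _ y; rewrite (gtr0_norm y0); apply; lra.
have yz : `|pi / 12 * (x ^+ 2 * y * (x + y) / pi ^+ 2)| <= x ^+ 4.
  have xy0 : 0 <= x + y by lra.
  rewrite ger0_norm; last first.
    apply: mulr_ge0; first by lra.
    apply: divr_ge0; last by rewrite exprn_ge0 ?(ltW p0).
    by apply: mulr_ge0 => //; apply: mulr_ge0; rewrite ?exprn_ge0 ?(ltW x0) ?(ltW y0).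
  have E (p s : R) : p != 0 -> p / 12 * (s / p ^+ 2) = (12 * p)^-1 * s by move=> ?; field.
  rewrite E ?gt_eqF// -(mulrA (x ^+ 2)).
  have h : y * (x + y) <= x * (2 * x) by apply: ler_pM; lra.
  have -> : x ^+ 4 = 2^-1 * (x ^+ 2 * (x * (2 * x))) by field.
  have x2 : 0 <= x ^+ 2 by rewrite exprn_ge0 ?(ltW x0).
  have yp : 0 <= y * (x + y) by rewrite mulr_ge0; lra.
  apply: ler_pM; [by rewrite invr_ge0; lra|by rewrite mulr_ge0| |].
    by rewrite lef_pV2 ?posrE; lra.
  by rewrite ler_wpM2l.
have -> : upper_area R n - (pi / 4 - 5 * pi / 48 * x ^+ 2 - x ^+ 3 / 24) =
  n%:R / 2 * (sin x - x + x ^+ 3 / 6) - (n%:R - 1) / 2 * (tan y - y - y ^+ 3 / 3)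
  - pi / 12 * (x ^+ 2 * y * (x + y) / pi ^+ 2).
  have e1 : pi / 12 * (x ^+ 2 * y * (x + y) / pi ^+ 2) =
      (n%:R - 1) * y * y ^+ 2 / 6 - pi / 48 * x ^+ 2 - x ^+ 3 / 24.
    have E (p a c s : R) : p != 0 -> p / 12 * (s / p ^+ 2) =
        p / 2 * (a / 4 + c / (2 * p) + s / p ^+ 2) / 6 - p / 48 * a - c / 24.
      by move=> ?; field.
    by rewrite ny y2; apply: E; rewrite gt_eqF.
  rewrite e1 /upper_area -/x -/y.
  transitivity (n%:R / 2 * sin x - (n%:R - 1) / 2 * tan y - pi / 2 + (n%:R - 1) * y / 2
    + pi / 12 * x ^+ 2 + pi / 48 * x ^+ 2 + x ^+ 3 / 24); first by rewrite ny; field.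
  by rewrite -{1 2}nx; field.
have x4 : 0 <= x ^+ 4 by rewrite exprn_ge0 ?ltW.
rewrite -/x; apply: le_trans (ler_normB _ _) _; apply: le_trans (lerD (ler_normB _ _) yz) _.
by apply: le_trans (lerD (lerD xx yy) (lexx _)) _; lra.
Qed.

End UpperArea.

Section StarDeficit.
Variables (R : realType) (K : nat).

(** The cubic coefficient D(g). The term in 5/24 comes from the angle taken from the tail by the
    head, the one in 5/12 from passing from b to pi / n in the quadratic term, and 1/24 from the
    upper bound. *)
Definition deficit_coef (g : nat -> R) : R :=
  - (\sum_(k < K.+1) arm_defect (turn_slope K g) k)
  - 5 / 24 * g K - 5 / 12 * (g K - 1 - K%:R) - 1 / 24.

Variables (I : Type) (D : I -> Prop) (b : I -> R) (m : I -> nat) (g : I -> nat -> R).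
Hypothesis b01 : forall i, D i -> 0 <= b i <= 1.
Hypothesis g_bounded : forall j, ordO D b 0 (fun i => g i j).
Local Notation ordO := (ordO D b).

Let hb : ordO 1 b := ordO_id b01.

Let gb j : ordO 1 (fun i => g i j * b i).
Proof. exact: (ordOMw b01 (k := 0) (l := 1)). Qed.

Lemma head_slope_bounded : ordO 0 (fun i => head_slope K (g i)).
Proof.
apply: ordOD.
  apply: ordO_sum => j; apply: ordOZ => //.
  by case: eqP => _; [exact: ordO_cst|exact: g_bounded].
apply: ordO_ext (ordOZ b01 ((-1) ^+ K / 2) (ordOB (g_bounded K) (ordO_cst D b (1 / 2)))) => i _.
by ring.
Qed.

Lemma closing_sin_expansion :
  ordO 3 (fun i => closing_sin K (g i) (b i) - head_slope K (g i) * b i).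
Proof.
have T1 : ordO 3 (fun i => \sum_(j < K) (-1) ^+ j *
    (sin (if j == 1%N :> nat then 0 else g i j * b i) - (if j == 1%N :> nat then 0 else g i j * b i))).
  apply: ordO_sum => j; apply: ordOZ => //; case: eqP => _; last by have [] := ordO_sin b01 (gb j).
  by apply: ordO_ext (ordOZ b01 0 (ordOX b01 3 hb)) => i _; rewrite sin0; ring.
have [hs hs3] := ordO_sin b01 (ordOB (gb K) (ordO_half_b b01)).
have hc : ordO 2 (fun i => 1 / (2 * cos (b i / 2)) - 1 / 2).
  apply: ordO_le (ordOX b01 2 (ordO_half_b b01)) => i Di; rewrite normrX inv_cos_bound//.
  by have /andP[b0 b1] := b01 Di; rewrite ger0_norm; lra.
have T2 := ordOZ b01 ((-1) ^+ K) (ordOMw b01 (isT : (3 <= 1 + 2)%N) hs hc).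
have T3 := ordOZ b01 ((-1) ^+ K / 2) hs3.
apply: ordO_ext (ordOD T1 (ordOD T2 T3)) => i Di.
have c0 := cos_half_neq0 (b01 Di).
rewrite /closing_sin /head_slope /pathX.
have -> : \sum_(j < K) (-1) ^+ j * (sin (if j == 1%N :> nat then 0 else g i j * b i)
    - (if j == 1%N :> nat then 0 else g i j * b i)) =
  \sum_(j < K) (-1) ^+ j * sin (if j == 1%N :> nat then 0 else g i j * b i) -
  (\sum_(j < K) (-1) ^+ j * (if j == 1%N :> nat then 0 else g i j)) * b i.
  by rewrite mulr_suml -sumrB; apply: eq_bigr => j _; case: ifP => _; ring.
by field.
Qed.

Hypothesis K1 : (1 < K)%N.
Hypothesis closing_le1 : forall i, D i -> `|closing_sin K (g i) (b i)| <= 1.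

Lemma direction_expansion j : (j <= K)%N ->
  ordO 2 (fun i => direction K (m i) (g i) (b i) j - slope K (g i) j * b i).
Proof.
move=> jK; rewrite /direction /slope; have [_|_] := eqVneq j 1%N; last first.
  by rewrite jK; apply: ordO_ext (ordOZ b01 0 (ordOX b01 2 hb)) => i _; ring.
have hE := ordO_weak b01 (isT : (2 <= 3)%N) closing_sin_expansion.
have hz : ordO 1 (fun i => closing_sin K (g i) (b i)).
  apply: ordO_ext (ordOD (ordO_weak b01 (isT : (1 <= 2)%N) hE)
    (ordOMw b01 (isT : (1 <= 0 + 1)%N) head_slope_bounded hb)) => i _; ring.
have ha : ordO 3 (fun i => asin (closing_sin K (g i) (b i)) - closing_sin K (g i) (b i)).
  apply: ordO_le (ordOZ b01 27 (ordOX b01 3 hz)) => i Di.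
  by rewrite normrM normrX (@ger0_norm _ 27)// asin_sub_bound ?closing_le1.
apply: ordO_ext (ordOD (ordO_weak b01 (isT : (2 <= 3)%N) ha) hE) => i _; ring.
Qed.

Lemma turn_expansion k :
  ordO 2 (fun i => turn K (m i) (g i) (b i) k - turn_slope K (g i) k * b i).
Proof.
rewrite /turn /turn_slope; have [_|_] := eqVneq k K; first exact: direction_expansion.
apply: ordO_ext (ordOB (direction_expansion (leq_subr k K)) (direction_expansion (leq_subr k.+1 K))) => i _.
by ring.
Qed.

Lemma slope_bounded j : ordO 0 (fun i => slope K (g i) j).
Proof. by rewrite /slope; case: eqP => _; [exact: head_slope_bounded|exact: g_bounded]. Qed.

Lemma turn_slope_bounded k : ordO 0 (fun i => turn_slope K (g i) k).
Proof.
rewrite /turn_slope; case: eqP => _; first exact: slope_bounded.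
by apply: ordOB; exact: slope_bounded.
Qed.

(** For the number [N] of tail edges, which is O(1/b): multiplying by it costs one order. *)
Lemma ordO_div k (N X : I -> R) : ordO 0 (fun i => N i * b i) -> ordO k.+1 X ->
  ordO k (fun i => N i * X i).
Proof.
move=> [C HC] /(ordO_ge0 b01)[C' C'0 HC']; exists (C * C') => i Di.
have /andP[b0 _] := b01 Di.
rewrite normrM; apply: le_trans (ler_wpM2l (normr_ge0 _) (HC' i Di)) _.
have -> : `|N i| * (C' * b i ^+ k.+1) = `|N i * b i| * (C' * b i ^+ k).
  by rewrite normrM (ger0_norm b0) exprS; ring.
have := HC i Di; rewrite mulr1 => h.
by rewrite -[leRHS]mulrA ler_wpM2r// mulr_ge0// exprn_ge0.
Qed.

End StarDeficit.

Section StarAreaExpansion.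
Variables (R : realType) (K : nat).
Variables (I : Type) (D : I -> Prop) (b : I -> R) (m : I -> nat) (g : I -> nat -> R).
Hypothesis b01 : forall i, D i -> 0 < b i <= 1.
Hypothesis g_bounded : forall j, ordO D b 0 (fun i => g i j).
Hypothesis K1 : (1 < K)%N.
Hypothesis Km : forall i, D i -> (K < m i)%N.
Hypothesis gK : forall i, D i -> g i K * b i = pi / 2 - ((m i).-1 - K)%:R * b i.
Hypothesis closing_le1 : forall i, D i -> `|closing_sin K (g i) (b i)| <= 1.
Hypothesis b_large : forall i, D i -> pi / (m i).*2%:R <= 2 * b i.
Local Notation ordO := (ordO D b).

Let b01' i : D i -> 0 <= b i <= 1.
Proof. by move=> /b01/andP[b0 ->]; rewrite ltW. Qed.

Let hb : ordO 1 b := ordO_id b01'.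

Let t i := turn_slope K (g i).
Let Th i := turn K (m i) (g i) (b i).
Let phi i := direction K (m i) (g i) (b i).
Let star_sum i := \sum_(j < m i) edge_area (phi i) (star_center K (phi i) (b i)) j.
Let defect i := \sum_(k < K.+1) arm_defect (t i) k.

Lemma sum_turn i : D i -> \sum_(k < K.+1) Th i k = g i K * b i.
Proof.
move=> Di; rewrite big_ord_recr/= {2}/Th /turn eqxx.
have E k : (k <= K)%N -> \sum_(j < k) Th i j = phi i K - phi i (K - k)%N.
  elim: k => [_|k IH kK]; first by rewrite big_ord0 subn0 subrr.
  by rewrite big_ord_recr/= IH 1?ltnW// /Th /turn ltn_eqF// /phi; ring.
by rewrite E// subnn /phi subrK /direction gtn_eqF// leqnn.
Qed.

(** The tail gives N (b/2 - 5 b^3/24) up to O(b^4), with N b = pi/2 - g_K b. The head turns sum to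
    g_K b, and half of them completes N b / 2 to pi/4. *)
Lemma star_area_expansion :
  ordO 4 (fun i => star_sum i
    - (pi / 4 - 5 * pi / 48 * b i ^+ 2 + b i ^+ 3 * (defect i + 5 / 24 * g i K))).
Proof.
have tb k : ordO 0 (fun i => t i k) by exact: turn_slope_bounded.
have ThE k : ordO 2 (fun i => Th i k - t i k * b i) by exact: turn_expansion.
have T1 := ordO_sum (fun k : 'I_K.+1 => arm_area_expansion b01' tb ThE k).
pose N i : R := ((m i).-1 - K)%:R.
have hN : ordO 0 (fun i => N i * b i).
  apply: ordO_ext (ordOB (ordO_cst D b (pi / 2)) (ordOMw b01' (isT : (0 <= 0 + 1)%N) (g_bounded K) hb)).
  by move=> i Di; rewrite gK//; rewrite /N; ring.
have hX : ordO 5 (fun i => sin (b i) - tan (b i / 2) - b i / 2 + 5 / 24 * b i ^+ 3).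
  have hs : ordO 5 (fun i => sin (b i) - b i + b i ^+ 3 / 6).
    by apply: (ordO_comp (l := 5) b01' _ hb) => i _; exact: sin_bound5.
  by apply: ordO_ext (ordOB hs (ordO_tan_half b01')) => i _; field.
apply: ordO_ext (ordOD T1 (ordO_div b01' hN hX)) => i Di.
have /andP[b0 b1] := b01 Di.
have cb := cos_half_neq0 (b01' Di).
rewrite /star_sum /phi direction_area ?Km ?gK ?closing_le1// sumrB.
have -> : \sum_(k < K.+1) (Th i k / 2 + b i ^+ 3 * arm_defect (t i) k) =
    g i K * b i / 2 + b i ^+ 3 * defect i.
  by rewrite big_split/= -mulr_suml sum_turn// -mulr_sumr.
have -> : \sum_(k < K.+1) ((arms (b i) (Th i) k.+1).1 * sin (Th i k) -
   (arms (b i) (Th i) k.+1).2 * (1 - cos (Th i k))) = \sum_(k < K.+1) arm_area K (m i) (g i) (b i) k by [].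
have NE : N i * b i = pi / 2 - g i K * b i by rewrite gK// /N; ring.
transitivity (\sum_(k < K.+1) arm_area K (m i) (g i) (b i) k
  - g i K * b i / 2 - b i ^+ 3 * defect i + N i * (sin (b i) - tan (b i / 2))
  - (N i * b i) / 2 + 5 / 24 * b i ^+ 2 * (N i * b i)); first by field.
by rewrite NE /N; field.
Qed.

Lemma star_deficit_expansion :
  ordO 4 (fun i => upper_area R (m i).*2 - star_sum i
    - deficit_coef K (g i) * (pi / (m i).*2%:R) ^+ 3).
Proof.
pose x i : R := pi / (m i).*2%:R; pose kap i := 2 * (g i K - 1 - K%:R) / pi.
have p0 := pi_gt0 R.
have x0 i : 0 <= x i by rewrite divr_ge0 ?(ltW p0).
have hkap : ordO 0 kap.
  by apply: ordO_ext (ordOZ b01' (2 / pi) (ordOB (g_bounded K) (ordO_cst D b (1 + K%:R)))) => i _;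
    rewrite /kap; ring.
have hx : ordO 1 x.
  by exists 2 => i Di; rewrite ger0_norm// expr1 b_large.
(* Exact relation between the step b and pi / n, a restatement of [gK]. *)
have xE i : D i -> x i - b i = kap i * b i * x i.
  move=> Di; have := gK Di; have Km' := Km Di.
  have m0 : (m i)%:R != 0 :> R by rewrite pnatr_eq0; clear - Km'; lia.
  have -> : ((m i).-1 - K)%:R = (m i)%:R - 1 - K%:R :> R.
    have mE : m i = ((m i).-1 - K + K + 1)%N by clear - Km'; lia.
    by rewrite [in RHS]mE !natrD; ring.
  rewrite /x /kap -muln2 natrM; move: (pi : R) p0 => p p0 H.
  have {}H : (m i)%:R * b i = p / 2 - (g i K - 1 - K%:R) * b i by lra.
  have p0' : p != 0 by rewrite gt_eqF.
  transitivity ((p / 2 - (m i)%:R * b i) / (m i)%:R); first by field.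
  by rewrite H; field; rewrite ?p0' ?m0.
have hxb : ordO 2 (fun i => x i - b i).
  apply: ordO_ext (ordOMw b01' (isT : (2 <= 1 + 1)%N) (ordOMw b01' (isT : (1 <= 0 + 1)%N) hkap hb) hx) => i Di.
  by rewrite xE.
have hx2 : ordO 4 (fun i => x i ^+ 2 - b i ^+ 2 - 2 * kap i * b i ^+ 3).
  apply: ordO_ext (ordOMw b01' (isT : (4 <= 1 + 3)%N) (ordOMw b01' (isT : (1 <= 0 + 1)%N) hkap hb)
    (ordOMw b01' (isT : (3 <= 2 + 1)%N) hxb (ordOD hx (ordOZ b01' 2 hb)))) => i Di.
  transitivity ((x i - b i) * (x i + b i) - 2 * kap i * b i ^+ 3); last by ring.
  by rewrite [in RHS]xE//; ring.
have hx3 : ordO 4 (fun i => x i ^+ 3 - b i ^+ 3).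
  apply: ordO_ext (ordOMw b01' (isT : (4 <= 2 + 2)%N) hxb (ordOD (ordOD (ordOX b01' 2 hx)
    (ordOMw b01' (isT : (2 <= 1 + 1)%N) hx hb)) (ordOX b01' 2 hb))) => i _; ring.
have hU : ordO 4 (fun i => upper_area R (m i).*2 - (pi / 4 - 5 * pi / 48 * x i ^+ 2 - x i ^+ 3 / 24)).
  apply: ordO_le (ordOZ b01' 20 (ordOX b01' 4 hx)) => i Di.
  rewrite normrM normrX (@ger0_norm _ 20)// (ger0_norm (x0 i)).
  by apply: upper_area_expansion; have := Km Di; clear - K1; lia.
have hdef : ordO 0 (fun i => deficit_coef K (g i) + 1 / 24).
  have h24 : ordO 0 (fun i => - (5 / 24 * g i K) - 5 / 12 * (g i K - (1 + K%:R))).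
    apply: ordOB; first by apply: ordON; exact: ordOZ.
    by apply: ordOZ => //; apply: ordOB => //; exact: ordO_cst.
  have tb k : ordO 0 (fun i => t i k) by exact: turn_slope_bounded.
  apply: ordO_ext (ordOB h24 (ordO_sum (fun k : 'I_K.+1 => arm_defect_bounded b01' tb k))) => i _.
  by rewrite /deficit_coef -/(t i); field.
apply: ordO_ext (ordOD (ordOD hU (ordON star_area_expansion)) (ordOD (ordOZ b01' (- (5 * pi / 48)) hx2)
  (ordON (ordOMw b01' (isT : (4 <= 0 + 4)%N) hdef hx3)))) => i Di.
rewrite /deficit_coef -/(t i) -/(defect i) -/(x i) /kap.
move: (pi : R) p0 => p p0; field.
by rewrite gt_eqF.
Qed.

End StarAreaExpansion.

Section StarEventually.
Variables (R : realType) (K : nat).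
Variables (I : Type) (D : I -> Prop) (b : I -> R) (m : I -> nat) (g : I -> nat -> R).
Let x i : R := pi / (m i).*2%:R.
Hypothesis b01 : forall i, D i -> 0 < b i <= 1.
Hypothesis b_large : forall i, D i -> x i <= 2 * b i.
Hypothesis b_small : forall i, D i -> b i <= 2 * x i.
Hypothesis g_bounded : forall j, ordO D b 0 (fun i => g i j).
Hypothesis K1 : (1 < K)%N.
Hypothesis Km : forall i, D i -> (K < m i)%N.
Hypothesis gK : forall i, D i -> g i K * b i = pi / 2 - ((m i).-1 - K)%:R * b i.
Hypothesis g_inc : forall i, D i -> forall l, (2 <= l < K)%N -> g i l < g i l.+1.
Variable gap : R.
Hypothesis gap0 : 0 < gap.
Hypothesis g_gap : forall i, D i ->
  g i 0%N + gap <= head_slope K (g i) /\ head_slope K (g i) + gap <= g i 2%N.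

Let b01' i : D i -> 0 <= b i <= 1.
Proof. by move=> /b01/andP[b0 ->]; rewrite ltW. Qed.

Lemma star_eventually eta : 0 < eta -> exists N, forall i, D i -> (N <= m i)%N ->
  let phi := direction K (m i) (g i) (b i) in
  [/\ forall j, (j.+1 < m i)%N -> phi j < phi j.+1,
      phi (m i).-1 = pi / 2,
      pathX phi (m i).-1 = (-1) ^+ m i / 2
    & exists c, `|upper_area R (m i).*2 - \sum_(j < m i) edge_area phi c j
        - deficit_coef K (g i) * x i ^+ 3| <= eta * x i ^+ 3].
Proof.
move=> eta0; have p0 := pi_gt0 R.
have [C1 C10 H1] : exists2 C, 0 <= C & forall i, D i -> `|closing_sin K (g i) (b i)| <= C * b i.
  have hE := closing_sin_expansion K b01' g_bounded.
  have hs := ordOM b01' (head_slope_bounded K b01' g_bounded) (ordO_id b01').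
  have [C C0 HC] := ordO_ge0 b01' (ordOD (ordO_weak b01' (isT : (0 + 1 <= 3)%N) hE) hs).
  by exists C => // i /HC; rewrite subrK expr1.
(* Below this step size the argument of the arcsine is at most 1 in absolute value. *)
pose e1 := (C1 + 1)^-1.
have e10 : 0 < e1 by rewrite invr_gt0; lra.
pose D' i := D i /\ b i <= e1.
have DD i : D' i -> D i by case.
have closing_le1 i : D' i -> `|closing_sin K (g i) (b i)| <= 1.
  move=> [Di bi]; apply: le_trans (H1 i Di) _; apply: le_trans (ler_wpM2l C10 bi) _.
  by rewrite ler_pdivrMr; lra.
have b01D i : D' i -> 0 < b i <= 1 by move=> /DD/b01.
have b01D' i : D' i -> 0 <= b i <= 1 by move=> /DD/b01'.
have g_bdD j : ordO D' b 0 (fun i => g i j).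
  by have [C HC] := g_bounded j; exists C => i /DD/HC.
have [C2 C20 H2] := ordO_ge0 b01D' (direction_expansion m b01D' g_bdD closing_le1 (ltnW K1)).
have [C3 C30 H3] := ordO_ge0 b01D' (star_deficit_expansion b01D g_bdD K1 (fun i h => Km (DD i h))
  (fun i h => gK (DD i h)) closing_le1 (fun i h => b_large (DD i h))).
(* As b <= 2 x, these bounds on x give in turn b <= e1, an error C2 b^2 in direction 1 below gap *
   b, and an error C3 b^4 <= 16 C3 x^4 in the deficit below eta * x^3. *)
pose e := Num.min (e1 / 2) (Num.min (gap / (2 * (C2 + 1))) (eta / (16 * (C3 + 1)))).
have e0 : 0 < e.
  by rewrite !lt_min !divr_gt0// ?mulr_gt0//; lra.
exists (Num.bound (pi / e)).+1 => i Di Nm phi.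
have m0 : (0 < m i)%N by apply: leq_trans Nm.
have x0 : 0 < x i by rewrite divr_gt0// ltr0n double_gt0.
have xe : x i <= e.
  rewrite ler_pdivrMr ?ltr0n ?double_gt0// mulrC -ler_pdivrMr//.
  apply: le_trans (ltW (archi_boundP _)) _; first by rewrite divr_ge0 ?ltW.
  by rewrite ler_nat (leq_trans (ltnW Nm))// -addnn leq_addr.
move: xe; rewrite !le_min => /and3P[xe1 xe2 xe3].
have bx := b_small Di; have /andP[b0 b1] := b01 Di.
have D'i : D' i by split=> //; lra.
have cb := cos_half_neq0 (b01' Di).
have [gap1 gap2] := g_gap Di.
have small : C2 * b i ^+ 2 < gap * b i.
  rewrite expr2 mulrA ltr_pM2r//.
  have : x i * (2 * (C2 + 1)) <= gap by rewrite -ler_pdivlMr//; lra.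
  nra.
have := H2 i D'i; rewrite /slope/= -/phi ler_norml => /andP[lo hi].
have K1m : (K < m i)%N := Km Di.
split.
- move=> j jm; apply: direction_inc => //.
  + exact: gK.
  + by rewrite -/phi; nra.
  + by rewrite -/phi; nra.
  + exact: g_inc.
- by apply: direction_mid => //; exact: gK.
- have dt := direction_tail K1 (gK Di).
  apply: (tail_half_close K1m dt cb); apply: direction_close => //; exact: closing_le1.
exists (star_center K phi (b i)); apply: le_trans (H3 i D'i) _.
have b4 : b i ^+ 4 <= (2 * x i) ^+ 4 by apply: lerXn2r => //; rewrite nnegrE; lra.
apply: le_trans (ler_wpM2l C30 b4) _.
have -> : C3 * (2 * x i) ^+ 4 = (16 * C3 * x i) * x i ^+ 3 by ring.
rewrite ler_wpM2r ?exprn_ge0 ?(ltW x0)//.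
have : x i * (16 * (C3 + 1)) <= eta by rewrite -ler_pdivlMr//; lra.
lra.
Qed.

End StarEventually.

(** * Numerical choice of the head, and the polygons B_n *)

Section HeadDirections.
Variable R : realType.

(* [deficit_coef 11 head_dir] = 0.07338831687720...; the excess absorbs the O(1/n^4) terms. *)
Definition optimal_delta : R := (733 * 10 ^+ 8 + 883 * 10 ^+ 5 + 16890) / 10 ^+ 12.

(* Rounded minimizer of [deficit_coef 11] under [arm_slope _ 12 = 0]. *)
Definition head_arm (k : nat) : R :=
  nth 0 [:: 0; 658 * 10 ^+ 3 + 694; 436 * 10 ^+ 3 + 6; 523 * 10 ^+ 3 + 906;
    490 * 10 ^+ 3 + 793; 503 * 10 ^+ 3 + 506; 498 * 10 ^+ 3 + 659; 500 * 10 ^+ 3 + 512;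
    499 * 10 ^+ 3 + 805; 500 * 10 ^+ 3 + 74; 499 * 10 ^+ 3 + 972; 500 * 10 ^+ 3 + 9;
    500 * 10 ^+ 3] k / 10 ^+ 6.

(** Inverse of the recursion for [arm_slope]: the directions are those whose arm slopes, read
    backwards, are the prescribed values [head_arm]. *)
Definition head_dir (j : nat) : R := \sum_(k < j.+1) (head_arm k.+1 + head_arm k).

Lemma head_dirS j : head_dir j.+1 = head_dir j + (head_arm j.+2 + head_arm j.+1).
Proof. by rewrite /head_dir big_ord_recr. Qed.

Lemma head_dir0 : head_dir 0 = head_arm 1 + head_arm 0.
Proof. by rewrite /head_dir big_ord_recr/= big_ord0 add0r. Qed.

Lemma head_arm_bounds k : (k < 12)%N -> 4 / 10 <= head_arm k.+1 <= 1.
Proof.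
move=> k12; rewrite /head_arm /=.
by do 12 (case: k k12 => [|k] k12; first by apply/andP; split => /=; lra).
Qed.

Lemma head_dir11 : head_dir 11 = (11 * 10 ^+ 6 + 723 * 10 ^+ 3 + 872) / 10 ^+ 6.
Proof. by rewrite /head_dir !big_ord_recr big_ord0 /head_arm/=; field. Qed.

(** The alternating sum collapses in pairs. The closing condition holds to first order thanks to the
    end values 0 and 1/2 of [head_arm]. *)
Lemma head_dir_slope : head_slope 11 head_dir = head_dir 1.
Proof.
by rewrite /head_slope !big_ord_recr big_ord0/= !head_dirS head_dir0 /head_arm /=; field.
Qed.

Let t := turn_slope 11 head_dir.

Lemma head_dir_turn k : (k < 12)%N -> t k = head_arm (12 - k) + head_arm (11 - k).
Proof.
have sE j : slope 11 head_dir j = head_dir j by rewrite /slope; have [->|_] := eqVneq j 1%N; rewrite ?head_dir_slope.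
move=> k12; rewrite /t /turn_slope !sE; case: eqP => [->|k11]; first exact: head_dir0.
have -> : (11 - k = (11 - k.+1).+1)%N by lia.
have -> : (12 - k = (11 - k.+1).+2)%N by lia.
by rewrite head_dirS; ring.
Qed.

Lemma head_dir_arm k : (k <= 12)%N -> arm_slope t k = head_arm (12 - k).
Proof.
elim: k => [_|k IH k12]; first by rewrite /head_arm /=; field.
by rewrite /= IH 1?ltnW// head_dir_turn// subSS; ring.
Qed.

Lemma head_dir_deficit : deficit_coef 11 head_dir <= (733 * 10 ^+ 8 + 883 * 10 ^+ 5 + 16878) / 10 ^+ 12.
Proof.
have cS k : arm_curv t k.+1 =
  - arm_curv t k + (arm_slope t k.+1 ^+ 2 - arm_slope t k ^+ 2) / 4 by [].
have c0 : arm_curv t 0 = 0 by [].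
have sE := head_dir_arm; have tE := head_dir_turn.
rewrite /deficit_coef head_dir11 -/t /arm_defect.
move: (t : nat -> R) (arm_curv t) (arm_slope t) cS c0 sE tE => u c s cS c0 sE uE.
rewrite !big_ord_recr big_ord0 /= !cS c0 !sE// !uE// /head_arm /=.
lra.
Qed.
End HeadDirections.

Lemma star_good (R : realType) : exists N, forall m, (N <= m)%N -> exists2 v : 'I_m.*2 -> R * R,
  small v & upper_area R m.*2 - optimal_delta R * (pi / m.*2%:R) ^+ 3 < area (convex_hull v).
Proof.
have [T TE] : exists T, T = head_dir R 11 by exists (head_dir R 11).
(* The step for which the head, of angle T b, and the m - 12 equal steps of the tail together reach
   pi/2. *)
pose D m := (12 <= m)%N; pose b m : R := pi / 2 / (T + m%:R - 12).
have p0 := pi_gt0 R; have p4 := @pihalf_lt2 R.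
have dm m : D m -> 12 <= m%:R :> R by rewrite ler_nat.
have d11 := head_dir11 R; rewrite -TE in d11.
have den m : D m -> 0 < T + m%:R - 12 by move=> /dm; rewrite d11; lra.
have b01 m : D m -> 0 < b m <= 1.
  move=> Dm; have d0 := den m Dm; have m12 := dm m Dm; rewrite divr_gt0//=; last by lra.
  by rewrite ler_pdivrMr// d11; lra.
have xE m : pi / m.*2%:R = pi / 2 / m%:R :> R.
  by rewrite -mul2n natrM invfM mulrA.
have half_le (u v : R) : 0 < u -> 0 < v -> v <= 2 * u -> pi / 2 / u <= 2 * (pi / 2 / v).
  move=> u0 v0 vu; have -> : 2 * (pi / 2 / v) = pi / 2 * (2 / v) by ring.
  by rewrite ler_pM2l ?divr_gt0// ler_pdivlMr// mulrC ler_pdivrMr.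
have b_large m : D m -> pi / m.*2%:R <= 2 * b m.
  by move=> Dm; rewrite xE half_le ?den//; have := dm m Dm; lra.
have b_small m : D m -> b m <= 2 * (pi / m.*2%:R).
  by move=> Dm; rewrite xE half_le ?den//; have := dm m Dm; lra.
have gK m : D m -> head_dir R 11 * b m = pi / 2 - (m.-1 - 11)%:R * b m.
  move=> Dm; have d0 := den m Dm; rewrite -TE.
  have -> : (m.-1 - 11)%:R = m%:R - 12 :> R by rewrite -subn1 -subnDA natrB.
  have -> : pi / 2 = b m * (T + m%:R - 12) by rewrite divfK// gt_eqF.
  by ring.
have inc l : (l < 11)%N -> head_dir R l + 1 / 2 <= head_dir R l.+1.
  move=> l11; rewrite head_dirS.
  have /andP[+ _] := head_arm_bounds R (ltnW l11 : (l < 12)%N).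
  have /andP[+ _] := head_arm_bounds R (l11 : (l.+1 < 12)%N); lra.
(* Less than the distance 12 * 10^-12 between [optimal_delta] and the bound of
   [head_dir_deficit]. *)
have eta0 : 0 < 10 ^- 12 :> R by rewrite invr_gt0 exprn_gt0.
have [N HN] := star_eventually (g := fun=> head_dir R) (gap := 1 / 2) b01 b_large b_small
  (fun j => ordO_cst D b (head_dir R j)) (isT : (1 < 11)%N) (fun m Dm => Dm) gK
  (fun m _ l h => ltac:(by have /andP[_ l11] := h; have := inc l l11; lra))
  ltac:(lra) (fun m _ => ltac:(by rewrite head_dir_slope; split; apply: inc)) eta0.
exists (maxn N 12) => m; rewrite geq_max => /andP[Nm Dm].
have [h_inc h_mid h_close [c]] := HN m Dm Nm.
have m1 : (1 < m)%N by apply: leq_trans Dm.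
have phi0 : 0 < direction 11 m (head_dir R) (b m) 0.
  rewrite /direction /= mulr_gt0//; last by have /andP[] := b01 m Dm.
  by rewrite head_dir0 /head_arm /=; lra.
have [v sv Hv] := half_star_lower m1 (ltW phi0) h_inc h_mid h_close c phi0.
rewrite ler_norml => /andP[_ hi]; exists v => //; apply: lt_le_trans Hv.
have x3 : 0 < (pi / m.*2%:R) ^+ 3 :> R.
  by rewrite exprn_gt0// divr_gt0// ltr0n double_gt0; apply: leq_trans Dm.
move: hi x3 (head_dir_deficit R); set x := (_ / _) ^+ 3; set s := \sum_(j < m) _.
have -> : 10 ^- 12 = 1 / 10 ^+ 12 :> R by rewrite div1r.
rewrite /optimal_delta; nra.
Qed.

(** * Upper bound for the area of B_n *)

Section BFamily.
Variable R : realType.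

Let bet (i : nat * R) : R := Bbeta i.1.*2 i.2.
(** Pairs (m, alpha) with n = 2 m. The range of alpha is extended down to 0 to include the default
    value of [get]. *)
Let D (i : nat * R) := (3 <= i.1)%N /\ 0 <= i.2 <= pi / i.1.*2%:R.
Let g (i : nat * R) (j : nat) : R := if j == 0%N then i.2 / bet i else i.2 / bet i + 2.

Let bet_bounds i : D i -> [/\ 0 < bet i <= 1, pi / i.1.*2%:R <= bet i,
  bet i <= 2 * (pi / i.1.*2%:R) & i.2 + (i.1%:R - 1) * bet i = pi / 2].
Proof.
case: i => m al [/= m3 /andP[al0 al1]]; have p0 := pi_gt0 R; have p4 := @pihalf_lt2 R.
have hm : 3 <= m%:R :> R by rewrite ler_nat.
have xE : m%:R * (pi / m.*2%:R) = pi / 2 :> R.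
  by rewrite -mul2n natrM; field; rewrite gt_eqF//; lra.
rewrite /bet /Bbeta /= -[in _ / 2]mul2n natrM; move: (pi / m.*2%:R) xE al1 => x xE al1.
have -> : (pi / 2 - al) / (2 * m%:R / 2 - 1) = (pi / 2 - al) / (m%:R - 1).
  by congr (_ / (_ - 1)); field.
have m1 : 0 < m%:R - 1 :> R by lra.
split.
- rewrite divr_gt0//; last by nra.
  by rewrite ler_pdivrMr//; lra.
- by rewrite ler_pdivlMr//; nra.
- by rewrite ler_pdivrMr//; nra.
- by rewrite mulrC divfK ?gt_eqF//; ring.
Qed.

Let ratio_bounds i : D i -> 0 <= i.2 / bet i <= 1.
Proof.
move=> Di; have [/andP[b0 _] b1 _ _] := bet_bounds Di.
case: Di => _ /andP[a0 a1]; rewrite divr_ge0 ?(ltW b0)//= ler_pdivrMr// mul1r.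
exact: le_trans b1.
Qed.

(** The coefficient is a cubic in a = alpha / beta, and [r] is its critical point in [0, 1],
    rounded. Removing nonnegative multiples of (a - r)^2 and a (a - r)^2 leaves an affine function
    of nearly zero slope. *)
Lemma B_deficit a : 0 <= a <= 1 ->
  optimal_delta R + 1 / 725 + 1 / 10 ^+ 7
  <= deficit_coef 2 (fun j => if j == 0%N then a else a + 2) :> R.
Proof.
move=> /andP[a0 a1].
have -> : deficit_coef 2 (fun j => if j == 0%N then a else a + 2) =
    33 / 64 - 37 / 32 * a + 7 / 16 * a ^+ 2 + 11 / 24 * a ^+ 3.
  rewrite /deficit_coef !big_ord_recr big_ord0 /arm_defect /= /turn_slope /slope /head_slope /=.
  by rewrite !big_ord_recr big_ord0 /=; field.
pose r : R := (652 * 10 ^+ 6 + 461 * 10 ^+ 3 + 659) / 10 ^+ 9.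
have h1 : 0 <= (a - r) ^+ 2 by rewrite sqr_ge0.
have h2 : 0 <= a * (a - r) ^+ 2 by rewrite mulr_ge0.
have -> : 33 / 64 - 37 / 32 * a + 7 / 16 * a ^+ 2 + 11 / 24 * a ^+ 3 =
    11 / 24 * (a * (a - r) ^+ 2) + (7 / 16 + 11 / 12 * r) * (a - r) ^+ 2
    + (33 / 64 - (7 / 16 + 11 / 12 * r) * r ^+ 2)
    + (- (37 / 32) + 7 / 8 * r + 11 / 8 * r ^+ 2) * a by field.
have r0 : 0 <= (7 / 16 + 11 / 12 * r) * (a - r) ^+ 2 by rewrite mulr_ge0// /r; lra.
move: h2 r0; set u := a * _; set w := _ * (a - r) ^+ 2 => h2 r0.
by rewrite /r /optimal_delta; lra.
Qed.

(** B_n is the case K = 2: the arcsine defining gamma is the one that closes the path through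
    direction 1, and gamma cancels from all later directions. *)
Lemma B_direction m al j : D (m, al) -> (j < m)%N ->
  \sum_(i < j.+1) Btheta m.*2 al i = direction 2 m (g (m, al)) (bet (m, al)) j.
Proof.
move=> Di jm; have [/andP[b0 b1] _ _ bE] := bet_bounds Di; rewrite /= in bE.
have abE : al / bet (m, al) * bet (m, al) = al by rewrite divfK// gt_eqF.
have abE2 : (al / bet (m, al) + 2) * bet (m, al) = al + 2 * bet (m, al).
  by rewrite [LHS]mulrDl abE.
case: j jm => [|[|j]] jm.
- by rewrite big_ord_recr big_ord0 /direction /g /= abE add0r.
- rewrite !big_ord_recr big_ord0 /direction /= /Bgamma -/(bet (m, al)) /closing_sin /g /=.
  rewrite !pathXS (path0 _).1 /= abE sin0.
  have -> : (al / bet (m, al) + 2) * bet (m, al) - bet (m, al) / 2 = al + 3 * bet (m, al) / 2.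
    by rewrite abE2; field.
  have -> : 0 + (-1) ^+ 0 * sin al + (-1) ^+ 1 * 0 +
    (-1) ^+ 2 * (sin (al + 3 * bet (m, al) / 2) / (2 * cos (bet (m, al) / 2)))
    = sin al + sin (al + 3 * bet (m, al) / 2) / (2 * cos (bet (m, al) / 2)) by ring.
  by rewrite /bet /=; ring.
have -> : \sum_(i < j.+3) Btheta m.*2 al i = al + j.+2%:R * bet (m, al).
  elim: j {jm} => [|j IH].
    by rewrite !big_ord_recr big_ord0 /= /bet /=; ring.
  by rewrite big_ord_recr IH /= -/(bet (m, al)) -(natr1 j.+2); ring.
rewrite /direction /g /=; case: ifP => [|_].
  by case: j jm => // jm _; rewrite abE2.
have -> : (m.-1 - j.+2)%:R = m%:R - 1 - j.+2%:R :> R.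
  have mE : m = (m.-1 - j.+2 + j.+2 + 1)%N by clear - jm; lia.
  by rewrite [in RHS]mE !natrD; ring.
by rewrite -bE; ring.
Qed.

Lemma Bpolygon_area_upper : exists N, forall m, (N <= m)%N ->
  area (Bpolygon R m.*2) < upper_area R m.*2 -
    (optimal_delta R + 1 / 725) * (pi / m.*2%:R) ^+ 3.
Proof.
have b01 i : D i -> 0 < bet i <= 1 by move=> /bet_bounds[].
have b_large i : D i -> pi / i.1.*2%:R <= 2 * bet i.
  by move=> /bet_bounds[/andP[h _] h' _ _]; lra.
have b_small i : D i -> bet i <= 2 * (pi / i.1.*2%:R) by move=> /bet_bounds[].
have g_bounded j : ordO D bet 0 (fun i => g i j).
  exists 3 => i /ratio_bounds/andP[h1 h2]; rewrite mulr1 /g.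
  by case: eqP => _; rewrite ger0_norm; lra.
have gK i : D i -> g i 2%N * bet i = pi / 2 - ((i.1).-1 - 2)%:R * bet i.
  move=> Di; have [/andP[b0 _] _ _ <-] := bet_bounds Di; have [m3 _] := Di.
  have -> : ((i.1).-1 - 2)%:R = (i.1)%:R - 3 :> R by rewrite -subn1 -subnDA natrB.
  by rewrite /g /= mulrDl divfK ?gt_eqF//; ring.
have inc i : D i -> forall l, (2 <= l < 2)%N -> g i l < g i l.+1.
  by move=> _ l /andP[/leq_ltn_trans h /h]; rewrite ltnn.
have gap i : D i -> g i 0%N + 1 / 2 <= head_slope 2 (g i) /\ head_slope 2 (g i) + 1 / 2 <= g i 2%N.
  move=> /ratio_bounds/andP[h1 h2]; rewrite /head_slope !big_ord_recr big_ord0 /g /=; split; lra.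
have eta0 : 0 < 1 / 10 ^+ 8 :> R by rewrite divr_gt0// exprn_gt0.
have [N HN] := star_eventually (b := bet) (m := fst) (g := g) (gap := 1 / 2)
  b01 b_large b_small g_bounded (isT : (1 < 2)%N)
  (fun i Di => Di.1) gK inc (ltac:(lra) : 0 < 1 / 2) gap eta0.
exists (maxn N 3) => m; rewrite geq_max => /andP[Nm m3].
(* Whether [get] returns a maximiser or its default value 0, the parameter lies in the extended
   range, where the bound is uniform. *)
have [al al_int ->] : exists2 al : R, 0 <= al <= pi / m.*2%:R & Bpolygon R m.*2 = Bregion m.*2 al.
  pose al : R := get [set al | Boptimal m.*2 al]; exists al => //.
  have hm : 6 <= m.*2%:R :> R by rewrite ler_nat -[6%N]/(3.*2) leq_double.
  have p0 := pi_gt0 R.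
  have [[al' opt]|none] := pselect (exists al' : R, Boptimal m.*2 al').
    have [] : Boptimal m.*2 al by have := @getPex _ [set al | Boptimal m.*2 al] (ex_intro _ al' opt).
    rewrite /Binterval /= in_itv/= => /andP[lo hi] _; rewrite hi andbT.
    apply: le_trans lo; rewrite divr_ge0 ?(ltW p0)//; lra.
  have -> : al = 0 by apply: (@getPN _ [set al | Boptimal m.*2 al]) => a opt; apply: none; exists a.
  by rewrite lexx divr_ge0 ?(ltW p0).
have Di : D (m, al) by [].
have [h_inc h_mid h_close [c Hc]] := HN (m, al) Di Nm.
have phi0 : 0 <= direction 2 m (g (m, al)) (bet (m, al)) 0.
  have /andP[a0 _] := ratio_bounds Di; have /andP[b0 _] := b01 _ Di.
  by rewrite /direction /g /= mulr_ge0 ?(ltW b0).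
have BX k : (k <= m)%N -> Bx m.*2 al k = pathX (direction 2 m (g (m, al)) (bet (m, al))) k /\
    By m.*2 al k = pathY (direction 2 m (g (m, al)) (bet (m, al))) k.
  move=> km; split; apply: eq_bigr => j _; rewrite B_direction//.
    exact: leq_trans (ltn_ord j) km.
  exact: leq_trans (ltn_ord j) km.
have m1 : (1 < m)%N by apply: leq_trans m3.
have := half_star_upper m1 phi0 h_inc h_mid h_close (v := Bvertex al) c.
have vE (k : 'I_m.*2) : (exists2 j, (j < m)%N &
    Bvertex al k = (pathX (direction 2 m (g (m, al)) (bet (m, al))) j,
                    pathY (direction 2 m (g (m, al)) (bet (m, al))) j) \/
    Bvertex al k = (- pathX (direction 2 m (g (m, al)) (bet (m, al))) j,
                    pathY (direction 2 m (g (m, al)) (bet (m, al))) j)) \/ Bvertex al k = (0, 1).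
  have kn := ltn_ord k; rewrite /Bvertex; case: eqP => [_|kN]; first by right.
  left; rewrite doubleK; case: ltnP => km.
    by exists k => //; left; have [-> ->] := BX k (ltnW km).
  have jm : (m.*2.-1 - k < m)%N by clear - km kn; lia.
  by exists (m.*2.-1 - k)%N => //; right; have [-> ->] := BX _ (ltnW jm).
move=> /(_ _ vE) h; apply: le_lt_trans h _.
move: Hc; rewrite ler_norml /= => /andP[lo _].
have x3 : 0 < (pi / m.*2%:R) ^+ 3 :> R.
  by rewrite exprn_gt0// divr_gt0 ?pi_gt0// ltr0n double_gt0; apply: leq_trans m3.
have := B_deficit (ratio_bounds Di); rewrite -/(g (m, al)).
move: lo x3; set x := (_ / _) ^+ 3; set dc := deficit_coef _ _; set s := \sum_(j < m) _.
nra.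
Qed.

End BFamily.

(** * The polygons Q_n *)

Section ImprovedPolygons.
Variable R : realType.

Lemma O_inv4_finite (h : nat -> R) N : O_inv4 (fun n => if (n < N)%N then h n else 0).
Proof.
exists (\sum_(k < N) `|h k| * k%:R ^+ 4) => n [_ n6].
have n0 : 0 < n%:R :> R by rewrite ltr0n; apply: leq_trans n6.
have [nN|_] := ltnP n N; last first.
  by rewrite normr0 divr_ge0 ?exprn_ge0 ?(ltW n0)// sumr_ge0.
rewrite ler_pdivlMr ?exprn_gt0// (bigD1 (Ordinal nN))//= lerDl sumr_ge0//.
Qed.

Lemma improved_ngons : exists (N : nat) (Q : nat -> set (R * R)), (12 < N)%N /\ forall n, even_ge6 n ->
  [/\ small_ngon n (Q n), (n < N -> optimal_small_ngon n (Q n))%N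
    & (N <= n)%N -> area (Q n) = upper_area R n - optimal_delta R * (pi / n%:R) ^+ 3
      /\ area (Bpolygon R n) < area (Q n) - 1 / 725 * (pi / n%:R) ^+ 3].
Proof.
have [N1 H1] := star_good R; have [N2 H2] := Bpolygon_area_upper R.
(* At least 13, so that Q_n is optimal for n <= 12; doubled because [N1] and [N2] are thresholds for
   n / 2. *)
pose N := maxn 13 (maxn N1 N2).*2; exists N.
have N12 : (12 < N)%N by exact: leq_maxl.
suff H n : exists P : set (R * R), even_ge6 n ->
    [/\ small_ngon n P, (n < N -> optimal_small_ngon n P)%N
    & (N <= n)%N -> area P = upper_area R n - optimal_delta R * (pi / n%:R) ^+ 3
      /\ area (Bpolygon R n) < area P - 1 / 725 * (pi / n%:R) ^+ 3].
  by have [Q HQ] := choice H; exists Q; split.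
have [[n_even n6]|] := pselect (even_ge6 n); last by exists set0.
have n2 : (2 < n)%N by apply: leq_trans n6.
have [p [cp sp dp pmax]] := optimal_strictly_convex R n2.
have opt := optimal_hull n2 cp sp dp pmax.
have [nN|Nn] := ltnP n N.
  by exists (convex_hull p) => _; split=> //; case: opt.
have nE : n = n./2.*2 by rewrite -[LHS]odd_double_half (negbTE n_even).
have [m1 m2] : (N1 <= n./2 /\ N2 <= n./2)%N.
  have : ((maxn N1 N2).*2 <= n./2.*2)%N by rewrite -nE; apply: leq_trans Nn; exact: leq_maxr.
  by rewrite leq_double geq_max => /andP[].
move: (H1 _ m1) (H2 _ m2); rewrite -nE => -[v sv Hv] HB.
have := pmax v sv; set A := area (convex_hull p) => Av.
have x3 : 0 < (pi / n%:R) ^+ 3 :> R.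
  by rewrite exprn_gt0// divr_gt0 ?pi_gt0// ltr0n; apply: leq_trans n6.
have B0 := @area_ge0 R (Bpolygon R n).
(* The prescribed area is positive since it exceeds the area of B_n. *)
have t0 : 0 < upper_area R n - optimal_delta R * (pi / n%:R) ^+ 3 by lra.
have A0 : 0 < A by lra.
have s01 : 0 < (upper_area R n - optimal_delta R * (pi / n%:R) ^+ 3) / A <= 1.
  by rewrite divr_gt0//= ler_pdivrMr// mul1r; lra.
have [P sP PA] := compress_hull n2 cp sp dp s01.
rewrite divfK ?gt_eqF// in PA.
exists P => _; split=> // _; rewrite PA; split=> //; lra.
Qed.

End ImprovedPolygons.

Theorem theorem1 (R : realType) :
  exists (delta : R) (Q : nat -> set (R * R)),
    [/\ (733 * 10 ^+ 6 + 883 * 10 ^+ 3 + 168) / 10 ^+ 10 <= delta /\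
        delta < (733 * 10 ^+ 6 + 883 * 10 ^+ 3 + 169) / 10 ^+ 10,
        forall n : nat, even_ge6 n -> small_ngon n (Q n),
        [/\ exists h : nat -> R, O_inv4 h /\
              forall n : nat, even_ge6 n ->
                upper_area R n - area (Q n)
                = delta * pi ^+ 3 / n%:R ^+ 3 + h n,
            exists h : nat -> R, O_inv4 h /\
              forall n : nat, even_ge6 n ->
                upper_area R n - area (Q n)
                < 8 * pi ^+ 3 / (109 * n%:R ^+ 3) + h n
          & exists h : nat -> R, O_inv4 h /\
              forall n : nat, even_ge6 n ->
                area (Q n) - area (Bpolygon R n)
                > pi ^+ 3 / (725 * n%:R ^+ 3) + h n]
      & forall n : nat, n \in [:: 6; 8; 10; 12]%N ->
          optimal_small_ngon n (Q n)].
Proof.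
have [N [Q [N12 HQ]]] := improved_ngons R.
have xE (c d : R) n : d != 0 -> even_ge6 n ->
    c * pi ^+ 3 / (d * n%:R ^+ 3) = c / d * (pi / n%:R) ^+ 3.
  move=> d0 [_ n6]; have n0 : n%:R != 0 :> R by rewrite pnatr_eq0 -lt0n; apply: leq_trans n6.
  by rewrite expr_div_n invfM; ring.
have x3 n : even_ge6 n -> 0 < (pi / n%:R) ^+ 3 :> R.
  by move=> [_ n6]; rewrite exprn_gt0// divr_gt0 ?pi_gt0// ltr0n; apply: leq_trans n6.
exists (optimal_delta R), Q; split; first by rewrite /optimal_delta; split; lra.
- by move=> n /HQ[].
- split.
  (* The error term is the exact difference for the finitely many n below [N] and zero beyond. *)
  + exists (fun n => if (n < N)%N then
      upper_area R n - area (Q n) - optimal_delta R * pi ^+ 3 / n%:R ^+ 3 else 0).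
    split=> [|n En]; first exact: O_inv4_finite.
    case: ltnP => [_|Nn]; first by ring.
    have [_ _ /(_ Nn)[-> _]] := HQ n En.
    by have := xE (optimal_delta R) 1 n (oner_neq0 _) En; rewrite mul1r divr1 => ->; ring.
  (* The added 1 makes the inequality strict below [N]; beyond, it follows from delta < 8/109. *)
  + exists (fun n => if (n < N)%N then
      upper_area R n - area (Q n) - 8 * pi ^+ 3 / (109 * n%:R ^+ 3) + 1 else 0).
    split=> [|n En]; first exact: O_inv4_finite.
    case: ltnP => [_|Nn]; first by rewrite addrA [X in X + 1]addrC subrK ltrDl.
    have [_ _ /(_ Nn)[-> _]] := HQ n En; rewrite xE// addr0.
    by have := x3 n En; rewrite /optimal_delta; set x := (_ / _) ^+ 3; lra.
  + exists (fun n => if (n < N)%N then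
      area (Q n) - area (Bpolygon R n) - pi ^+ 3 / (725 * n%:R ^+ 3) - 1 else 0).
    split=> [|n En]; first exact: O_inv4_finite.
    case: ltnP => [_|Nn]; first by lra.
    have [_ _ /(_ Nn)[_ h]] := HQ n En; rewrite addr0 -[pi ^+ 3]mul1r xE//; lra.
- move=> n n_small; have [En n12] : even_ge6 n /\ (n <= 12)%N.
    by move: n_small; rewrite !inE => /or4P[] /eqP ->.
  by have [_ opt _] := HQ n En; apply: opt; apply: leq_ltn_trans N12.
Qed.
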